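(* Let $\lambda=(\lambda_1,\dots,\lambda_d)=\{1^{m_1},\dots,p^{m_p}\}$ be any partition of $n$, where $m_j=\#\{i:\lambda_i=j\}$. The dual variety $(\Delta_\lambda)^\vee$ has dimension $n-m_1-1$. The formula $$\Bigl(\bigl((s_i:t_i)\bigr)_{\lambda_i\ne1},\,(g_i)_{\lambda_i\neq 1}\Bigr)\ \mapsto\ g(u,v)=\sum_{1\le i\le d,\ \lambda_i\ne1}(s_iu+t_iv)^{n-\lambda_i+2}\cdot g_i(u,v),$$ where $(s_i:t_i)\in\mathbb{P}^1$ and $g_i$ is a binary form of degree $\lambda_i-2$, represents a (generically) finite-to-one parametrization $\mathcal{J}_\lambda\dashrightarrow(\Delta_\lambda)^\vee\subset\mathbb{P}^n$ (a dominant rational map). This rational map has degree $m_2!\cdots m_p!$.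
   Context: $K$ is a field of characteristic zero; points of varieties are taken over an algebraic closure of $K$. $V=K[x,y]_n$ and $V^\vee=K[u,v]_n$ are dual spaces via $\langle f,g\rangle=\frac1{n!}\,g(\frac{\partial}{\partial x},\frac{\partial}{\partial y})f(x,y)$, and $\mathbb{P}(V)$, $\mathbb{P}(V^\vee)$ are both identified with $\mathbb{P}^n$. The multiple root locus $\Delta_\lambda\subset\mathbb{P}(V)$ is the variety of binary forms $\ell_1^{\lambda_1}\cdots\ell_d^{\lambda_d}$ with $\ell_i$ nonzero linear forms. Its dual variety $(\Delta_\lambda)^\vee\subset\mathbb{P}(V^\vee)$ is the closure of the set of $g$ with $g\perp T_f\Delta_\lambda$ for some smooth point $f$ of $\Delta_\lambda$. For $\lambda=\{1^n\}$ both $(\Delta_\lambda)^\vee$ and $\mathcal{J}_\lambda$ are empty, of dimension $-1$. The parameter space $\mathcal{J}_\lambda$ is the free (abstract) join of the $d-m_1$ varieties $\mathbb{P}^1\times\mathbb{P}^{\lambda_i-2}$ with $\lambda_i\ge2$. It is the projective toric variety whose points are the classes $[(w_i\otimes g_i)_{\lambda_i\ge2}]$, up to one common scalar, with $w_i=(s_i,t_i)\in K^2$ and $g_i$ a binary form of degree $\lambda_i-2$. Its dimension is $n-m_1-1$. A general point is uniquely represented by points $(s_i:t_i)=(s_i:1)$ together with the tuple $(g_i)_{\lambda_i\ge2}$ of forms up to common scaling, and the formula is evaluated with these representatives. *)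

(* Defs.v *)
From HB Require Import structures.
From mathcomp Require Import all_boot all_order all_algebra.
From mathcomp Require Import mpoly.

Set Implicit Arguments.
Unset Strict Implicit.
Unset Printing Implicit Defensive.

Import GRing.Theory.
Local Open Scope ring_scope.

Definition proj (F : fieldType) (W : vectType F) :=
  {U : {vspace W} | \dim U == 1%N}.

Definition point_set (F : fieldType) (W : vectType F) := proj W -> Prop.

Section Zariski.
Variables (F : fieldType) (W : vectType F).
Implicit Types (X Y Z C D U : point_set W) (x : proj W).

Definition sub_pset X Y := forall x, X x -> Y x.

Definition coords (w : W) : 'I_(\dim {:W}) -> F :=
  fun i => coord (vbasis {:W}) i w.

(* Homogeneous coordinates of a point.  [vpick] selects a nonzero vector of the
   line; for homogeneous polynomials the choice is immaterial. *)
Definition hcoords x := coords (vpick (val x)).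

Definition vanishes_at (p : {mpoly F[\dim {:W}]}) x := p.@[hcoords x] = 0.

Definition homogeneous_poly (p : {mpoly F[\dim {:W}]}) :=
  exists e : nat, p \is e.-homog.

Definition zclosed C :=
  exists2 S : {mpoly F[\dim {:W}]} -> Prop,
    (forall p, S p -> homogeneous_poly p) &
    (forall x, C x <-> forall p, S p -> vanishes_at p x).

Definition zclosure X : point_set W :=
  fun x => forall C, zclosed C -> sub_pset X C -> C x.

Definition closed_in X Z :=
  exists2 C, zclosed C & forall x, Z x <-> X x /\ C x.

Definition open_in X U :=
  exists2 C, zclosed C & forall x, U x <-> X x /\ ~ C x.

Definition dense_in X U := sub_pset U X /\ sub_pset X (zclosure U).

Definition irreducible Z :=
  (exists x, Z x) /\
  forall C D, zclosed C -> zclosed D ->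
    (forall x, Z x -> C x \/ D x) -> sub_pset Z C \/ sub_pset Z D.

Definition has_chain X (m : nat) :=
  exists Z : nat -> point_set W,
    (forall i, (i <= m)%N -> closed_in X (Z i) /\ irreducible (Z i)) /\
    (forall i, (i < m)%N -> sub_pset (Z i) (Z i.+1) /\
                            ~ sub_pset (Z i.+1) (Z i)).

(* Krull dimension of the topological space [X]; a chain with [m] inclusions has
   [m.+1] members, so the empty set has dimension -1. *)
Definition has_dim X (k : int) :=
  (-1 <= k)%R /\ forall m : nat, has_chain X m <-> (m%:Z <= k)%R.

(* [T] is the affine cone in [W] over the embedded (projective) Zariski tangent
   space of [X] at [x]. *)
Definition is_tangent_space X x (T : {vspace W}) :=
  forall h : W, h \in T <->
    forall p, homogeneous_poly p -> (forall y, X y -> vanishes_at p y) ->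
      \sum_i (p^`M(i)).@[hcoords x] * coords h i = 0.

(* Meant for irreducible [X], whose local dimension at each point is dim X. *)
Definition smooth_point X x :=
  X x /\ exists T : {vspace W}, exists k : nat,
    [/\ is_tangent_space X x T, has_dim X k%:Z & \dim T = k.+1].

End Zariski.

Section RationalMaps.
Variables (F : fieldType) (W W' : vectType F).
Implicit Types (X : point_set W) (Y : point_set W').
Implicit Type phi : proj W -> proj W' -> Prop.

Definition graph_domain phi : point_set W := fun x => exists y, phi x y.
Definition graph_image phi : point_set W' := fun y => exists x, phi x y.

Definition eval_polys (Q : 'I_(\dim {:W'}) -> {mpoly F[\dim {:W}]}) x : W' :=
  \sum_j (Q j).@[hcoords x] *: (vbasis {:W'})`_j.

(* A rational map X --> Y is given by the graph of a morphism from a dense open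
   subset of [X] to [Y], i.e. a map which is locally given by homogeneous
   polynomials of one common degree. *)
Definition rational_map X Y phi :=
  [/\ forall x y, phi x y -> X x /\ Y y,
      forall x y y', phi x y -> phi x y' -> y = y',
      open_in X (graph_domain phi) /\ dense_in X (graph_domain phi) &
      forall x, graph_domain phi x ->
        exists e : nat, exists Q : 'I_(\dim {:W'}) -> {mpoly F[\dim {:W}]},
          [/\ forall j, Q j \is e.-homog,
              eval_polys Q x != 0 &
              forall x' y', phi x' y' -> eval_polys Q x' != 0 ->
                val y' = <[eval_polys Q x']>%VS]].

Definition dominant Y phi := dense_in Y (graph_image phi).

Definition generically_finite Y phi :=
  exists U : point_set W', [/\ open_in Y U, dense_in Y U &
    forall y, U y -> exists s : seq (proj W), forall x, phi x y -> x \in s].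

(* Degree as the number of points in a general fibre; over an algebraically
   closed field of characteristic zero it is the degree of the extension of
   function fields. *)
Definition has_degree Y phi (k : nat) :=
  exists U : point_set W', [/\ open_in Y U, dense_in Y U &
    forall y, U y -> exists s : seq (proj W),
      [/\ uniq s, size s = k & forall x, x \in s <-> phi x y]].

End RationalMaps.

Section BinaryForms.
Variable F : fieldType.

(* Used both for K[x,y]_n and for its dual K[u,v]_n; the variables are
   ['X_ord0] and ['X_ord_max]. *)
Definition form (n : nat) : vectType F := dhomog 2 F n.

Definition form_poly n (f : form n) : {mpoly F[2]} := mpoly_of_dhomog f.

(* g(d/dx, d/dy) f *)
Definition diff_action (g f : {mpoly F[2]}) : {mpoly F[2]} :=
  \sum_(m <- msupp g) g@_m *: f^`M[m].

(* For forms of degree [n] the polynomial [diff_action g f] is constant. *)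
Definition pairing n (f g : form n) : F :=
  (n`!%:R)^-1 * (diff_action (form_poly g) (form_poly f))@_0%MM.

(* X is a subvariety of P(V); the result is a subvariety of P(V^dual). *)
Definition dual_variety n (X : point_set (form n)) : point_set (form n) :=
  zclosure (fun y : proj (form n) =>
    exists x : proj (form n), exists T : {vspace form n},
      [/\ smooth_point X x, is_tangent_space X x T &
          forall f g, f \in T -> g \in val y -> pairing f g = 0]).

End BinaryForms.

Definition is_partition (n : nat) (la : seq nat) : bool :=
  [&& sorted geq la, all (leq 1) la & sumn la == n].

Section MultipleRootLoci.
Variables (F : fieldType) (n : nat) (la : seq nat).

Definition part (i : 'I_(size la)) : nat := nth 0%N la i.

Definition multiple_root_locus : point_set (form F n) :=
  fun x => exists ell : 'I_(size la) -> form F 1,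
    (forall i, ell i != 0) /\
    exists2 f : form F n,
      form_poly f = \prod_i form_poly (ell i) ^+ part i & val x = <[f]>%VS.

(* The direct sum, over the parts part i >= 2, of F^2 (x) F[u,v]_(part i - 2), in
   the coordinates given by the monomial bases: the index (i, (a, b)) stands for
   e_a (x) u^b v^(part i - 2 - b).  For part i = 1 there is no index, since
   'I_(part i).-1 is then empty. *)
Definition join_index := {i : 'I_(size la) & 'I_2 * 'I_(part i).-1}%type.
Definition join_space : vectType F := {ffun join_index -> F^o}.

Definition bimonomial (k b : nat) : 'X_{1..2} :=
  [multinom (if j == ord0 then b else (k - b)%N) | j < 2].

(* Data attached to a part equal to 1 (where part i - 2 = 0) are never used. *)
Definition cofactors := forall i : 'I_(size la), form F (part i - 2).

(* The tuple of the w_i (x) g_i, with w_i = (s i, t i). *)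
Definition join_vector (s t : 'I_(size la) -> F) (g : cofactors) : join_space :=
  [ffun k : join_index =>
     let i := tag k in let: (a, b) := tagged k in
     (if a == ord0 then s i else t i)
       * (form_poly (g i))@_(bimonomial (part i - 2) b)].

Definition join_variety : point_set join_space :=
  fun x => exists (s t : 'I_(size la) -> F) (g : cofactors),
    val x = <[join_vector s t g]>%VS.

Definition param_formula (s t : 'I_(size la) -> F) (g : cofactors) :
    {mpoly F[2]} :=
  \sum_(i | part i != 1%N)
    (s i *: 'X_ord0 + t i *: 'X_ord_max) ^+ (n - part i + 2)
      * form_poly (g i).

(* The formula evaluated at the points having the unique representatives
   (s_i : 1), g_i != 0, wherever it gives a nonzero form. *)
Definition param_map (x : proj join_space) (y : proj (form F n)) : Prop :=
  exists (s : 'I_(size la) -> F) (g : cofactors),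
    [/\ forall i, part i != 1%N -> g i != 0,
        val x = <[join_vector s (fun=> 1) g]>%VS &
        exists2 f : form F n,
          form_poly f = param_formula s (fun=> 1) g & val y = <[f]>%VS].

End MultipleRootLoci.

(* Main.v *)
From HB Require Import structures.
From mathcomp Require Import all_boot all_order all_algebra all_fingroup.
From mathcomp Require Import mpoly.
From mathcomp Require Import ring zify.
From Stdlib Require Import Classical.
Require Import Defs.

Set Implicit Arguments.
Unset Strict Implicit.
Unset Printing Implicit Defensive.

Import GRing.Theory Num.Theory Order.TTheory.
Local Open Scope ring_scope.

(** The proof works with explicit parametrizations.  In affine coordinates, with
    y = 1 for the variables x, y and u = 1 for u, v, a general point of the
    multiple root locus is c * prod_i (X - a_i)^(la_i), and the formula reads
    sum_(la_i >= 2) (X + s_i)^(n - la_i + 2) * g_i.  The bridge between the two is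
    apolarity: for m <= n + 1, a form of degree n is divisible by (X - s)^m exactly
    when it is orthogonal to all the forms (X + s)^(n + 1 - m) * h with deg h < m
    ([apolar_contact], [contact_apolar]).

    At distinct roots, the tangent space of the root locus consists of the
    multiples of prod_i (X - a_i)^(la_i - 1) ([root_family_tangent]), so by apolarity
    and a dimension count its annihilator consists of the values of the formula at
    s = a ([conormal_dual]).  Smooth points of the root locus are limits of forms
    with distinct finite roots and conormal vectors are limits along with them,
    because each of them is the gradient of an equation of the locus
    ([dual_base_closure]); conversely every value of the formula is a limit of
    conormal vectors at general, hence smooth, points ([dual_image_sub]).  Hence the
    dual variety is the closure of the image of the formula.

    Where the s_i are distinct and g_i(-s_i) != 0, the formula is an immersion in
    its n - m_1 affine parameters, since multiples of powers of distinct linear forms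
    are independent in low degree ([dual_powers_free]).  The projective closure of
    the image of a polynomial map that is somewhere an immersion in N parameters and
    is compatible with scaling has dimension N - 1 ([param_has_dim]): a chain of
    closed sets is bounded by algebraic dependence, and a flag of linear sections of
    the parameter space gives a chain of the right length.

    For the degree, let w be a general vector of the cone over the dual variety.  By
    Chevalley's theorem ([image_contains_open]) w is a value of the formula.  By
    generic smoothness ([generic_tangent_bound]) the tangent space at w is the image
    of the differential at any preimage (s, g) of w, so two preimages (s, g) and
    (s', g') have the same image of the differential.  This image contains all the
    multiples of (X + s'_i)^(n + 1 - la_i) and is contained in the sum of those of
    the (X + s_j)^(n + 1 - la_j); by apolarity (X - s'_i)^(la_i) divides
    prod_j (X - s_j)^(la_j) ([tangent_contact]).  Comparing multiplicities, s' is s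
    composed with a permutation of equal parts, and g' follows by independence
    ([fibre_matching]).  So the fibre is a torsor under the group of permutations of
    equal parts at least 2, which has m_2! ... m_p! elements
    ([card_color_perms]).  Both generic finiteness and dominance follow. *)

(** * Polynomials in several variables *)

Section ChainRule.
Variables (R : comNzRingType) (S : comNzRingType) (n : nat).
Variables (f : {rmorphism R -> S}) (a : 'I_n -> S) (d : {additive S -> S}).
Hypothesis dM : forall x y, d (x * y) = d x * y + x * d y.
Hypothesis df : forall c, d (f c) = 0.

Let good (p : {mpoly R[n]}) :=
  d (mmap f a p) = \sum_i mmap f a p^`M(i) * d (a i).

Let good1 : good 1.
Proof.
rewrite /good mmapC df big1 // => i _.
by rewrite -[1]/(1%:MP) mderivC mmap0 mul0r.
Qed.

Let goodM p q : good p -> good q -> good (p * q).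
Proof.
move=> gp gq; rewrite /good rmorphM /= dM gp gq mulr_suml mulr_sumr -big_split.
apply: eq_bigr => i _; rewrite mderivM mmapD !rmorphM /= mulrDl.
by rewrite mulrAC mulrA.
Qed.

Let goodU i : good 'X_i.
Proof.
rewrite /good mmapX mmap1U (bigD1 i) //= big1 ?addr0 => [|j ji].
  have U0 : (U_(i) - U_(i))%MM = 0%MM :> 'X_{1..n} by rewrite -[X in (X - _)%MM]add0m addmK.
  by rewrite mderivX mnm1E eqxx scale1r U0 mpolyX0 rmorph1 mul1r.
by rewrite mderivX mnm1E eq_sym (negbTE ji) scale0r mmap0 mul0r.
Qed.

Let goodX m : good 'X_[m].
Proof.
rewrite mpolyXE_id; apply: (big_ind good) => // i _.
by elim: (m i) => [|k IH]; rewrite ?expr0 // exprS; apply: goodM.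
Qed.

(** Stated for an arbitrary derivation d, because it is applied both to partial
    derivatives of compositions and to the restriction of a polynomial to a curve. *)
Lemma chain_rule p : d (mmap f a p) = \sum_i mmap f a p^`M(i) * d (a i).
Proof.
elim/mpolyind: p => [|c m p _ _ gp].
  by rewrite mmap0 raddf0 big1 // => i _; rewrite mderiv0 mmap0 mul0r.
rewrite mmapD mmapZ raddfD /= dM df mul0r add0r gp goodX mulr_sumr -big_split /=.
by apply: eq_bigr => i _; rewrite mderivD mderivZ mmapD mmapZ mulrDl mulrA.
Qed.
End ChainRule.

Section CompMpoly.
Variables (R : comNzRingType).

Lemma mderiv_comp m n (p : {mpoly R[m]}) (f : m.-tuple {mpoly R[n]}) j :
  (p \mPo f)^`M(j) = \sum_i (p^`M(i) \mPo f) * (tnth f i)^`M(j).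
Proof.
rewrite /comp_mpoly (@chain_rule R _ m (@mpolyC n R) (tnth f) (mderiv j)) //.
  exact: mderivM.
exact: mderivC.
Qed.

(** The restriction of p to the polynomial curve a. *)
Definition along n (p : {mpoly R[n]}) (a : 'I_n -> {poly R}) : {poly R} :=
  mmap polyC a p.

Lemma deriv_along n (p : {mpoly R[n]}) a :
  (along p a)^`() = \sum_i along p^`M(i) a * (a i)^`().
Proof.
rewrite /along (@chain_rule R _ n polyC a (@deriv R)) //.
  exact: derivM.
exact: derivC.
Qed.

Lemma horner_along n (p : {mpoly R[n]}) a x :
  (along p a).[x] = p.@[fun i => (a i).[x]].
Proof.
rewrite /along /meval /mmap horner_sum; apply: eq_bigr => m _.
rewrite hornerM hornerC /mmap1 horner_prod; congr (_ * _).
by apply: eq_bigr => i _; rewrite horner_exp.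
Qed.
End CompMpoly.

Section Muni.
Variable R : comNzRingType.

(** Evaluation at v extended by t agrees with evaluating the last variable after
    the others ([meval_muni]); this carries the inductions on the number of variables. *)
Definition rcons_pt n (v : 'I_n -> R) (t : R) (i : 'I_n.+1) : R :=
  oapp v t (unlift ord_max i).

Lemma rcons_pt_max n (v : 'I_n -> R) t : rcons_pt v t ord_max = t.
Proof. by rewrite /rcons_pt unlift_none. Qed.

Lemma rcons_pt_lift n (v : 'I_n -> R) t i :
  rcons_pt v t (widen_ord (leqnSn _) i) = v i.
Proof.
rewrite /rcons_pt (_ : widen_ord _ _ = lift ord_max i) ?liftK //.
by apply: val_inj; rewrite /= /bump leqNgt ltn_ord.
Qed.

Lemma meval_muni n (p : {mpoly R[n.+1]}) (v : 'I_n -> R) t :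
  p.@[rcons_pt v t] = (map_poly (meval v) (muni p)).[t].
Proof.
rewrite muniE [in LHS](mpolyE p) !raddf_sum /= horner_sum.
apply: eq_bigr => m _; rewrite mevalZ mevalX map_polyZ map_polyXn.
rewrite /= hornerZ hornerXn mevalZ mevalX big_ord_recr /= rcons_pt_max mulrA.
congr (_ * _ * _); apply: eq_bigr => i _.
by rewrite rcons_pt_lift mnmE.
Qed.

Lemma muni_neq0 n (p : {mpoly R[n.+1]}) : p != 0 -> muni p != 0.
Proof.
rewrite -msupp_eq0; case: (msupp p) (@mcoeff_msupp _ _ p) (msupp_uniq p) (muniE p) => //= m s.
move=> /(_ m); rewrite inE eqxx /= => /esym pm /andP[ms us] pE _.
pose m' := [multinom m (widen_ord (leqnSn n) i) | i < n].
apply: contraNneq pm => p0; have: ((muni p)`_(m ord_max))@_m' = 0.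
  by rewrite p0 coef0 mcoeff0.
rewrite pE coef_sum raddf_sum big_cons /= coefZ coefXn eqxx mulr1.
rewrite mcoeffZ mcoeffX eqxx mulr1 big_seq big1 ?addr0 ?mcoeff0 => [->//|m1 m1s].
rewrite coefZ coefXn; case: eqP => e; last by rewrite mulr0 mcoeff0.
rewrite mulr1 mcoeffZ mcoeffX; case: eqP => e'; last by rewrite mulr0.
suff em : m1 = m by rewrite em (negbTE ms) in m1s.
apply/mnmP => i; case: (unliftP ord_max i) => [j ->|->]; last by rewrite e.
have -> : lift ord_max j = widen_ord (leqnSn n) j by apply: val_inj; rewrite /= /bump leqNgt ltn_ord.
by have /mnmP/(_ j) := e'; rewrite !mnmE.
Qed.
End Muni.

Definition infinite_field (F : fieldType) := forall s : seq F, exists x, x \notin s.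

Section Points.
Variables (F : fieldType) (infF : infinite_field F).

Lemma poly_point (p : {poly F}) : p != 0 -> exists x, p.[x] != 0.
Proof.
move=> p0.
have ex_uniq k : exists s : seq F, uniq s /\ size s = k.
  elim: k => [|k [s [us ss]]]; first by exists [::].
  by have [x xs] := infF s; exists (x :: s); rewrite /= xs us ss.
have [s [us ss]] := ex_uniq (size p).
have /allPn[x _ px] : ~~ all (root p) s.
  apply/negP => rs; have := max_poly_roots p0 rs us.
  by rewrite ss ltnn.
by exists x.
Qed.

Lemma mpoly_point n (p : {mpoly F[n]}) : p != 0 -> exists v, p.@[v] != 0.
Proof.
elim: n p => [|n IH] p p0.
  exists (fun _ => 0); apply: contraNneq p0 => pv.
  by rewrite [p]nvar0_mpolyC in pv *; rewrite mevalC in pv; rewrite pv.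
have := muni_neq0 p0; rewrite -lead_coef_eq0 => /IH[v pv].
have : map_poly (meval v) (muni p) != 0.
  apply: contraNneq pv => e; have : (map_poly (meval v) (muni p))`_(size (muni p)).-1 = 0.
    by rewrite e coef0.
  by rewrite coef_map => /eqP.
by move=> /poly_point[t pt]; exists (rcons_pt v t); rewrite meval_muni.
Qed.

Lemma mpoly_eq0_points n (p : {mpoly F[n]}) : (forall v, p.@[v] = 0) -> p = 0.
Proof.
move=> H; apply/eqP; apply: contraT => /mpoly_point[v].
by rewrite H eqxx.
Qed.

Lemma mpoly_eq_points n (p q : {mpoly F[n]}) : (forall v, p.@[v] = q.@[v]) -> p = q.
Proof.
by move=> H; apply/eqP; rewrite -subr_eq0; apply/eqP/mpoly_eq0_points => v; rewrite mevalB H subrr.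
Qed.
End Points.

Section AlgDep.
Variable F : fieldType.

(** Pigeonhole on dimensions: the monomials of multidegree below k in m polynomials
    are of degree O(k) in N < m variables, so for large k there are more of them
    than monomials available to express them. *)
Lemma alg_dependent N m (f : m.-tuple {mpoly F[N]}) : (N < m)%N ->
  exists2 h : {mpoly F[m]}, h != 0 & h \mPo f = 0.
Proof.
move=> Nm; pose D := (\max_(i < m) msize (tnth f i))%N.
(* E indexes monomials in m variables with exponents below k, and T those in N variables
   with exponents below B, a bound for the degrees of the images of the former.  The choice
   of k makes B ^ N = (k * C) ^ N < k ^ N.+1 <= k ^ m. *)
pose C := (m * D).+1; pose k := (C ^ N).+1; pose B := (k * C)%N.
pose E := {ffun 'I_m -> 'I_k}; pose T := {ffun 'I_N -> 'I_B}.
pose mo (e : E) : 'X_{1..m} := [multinom (e i : nat) | i < m].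
pose mt (t : T) : 'X_{1..N} := [multinom (t i : nat) | i < N].
have card : (#|{: T}| < #|{: E}|)%N.
  rewrite !card_ffun !card_ord /B expnMn.
  apply: (@leq_trans (k ^ N.+1)); last by rewrite leq_exp2l // ltnS expn_gt0.
  by rewrite expnSr ltn_pmul2l ?expn_gt0.
have szf (e : E) : (msize ('X_[mo e] \mPo f) <= B)%N.
  rewrite comp_mpolyX.
  apply: (@leq_trans (\sum_(i < m) e i * D).+1).
    elim/big_rec2: _ => [|i y1 y2 _ IH]; first by rewrite msize1.
    have [->|y10] := eqVneq y2 0; first by rewrite mulr0 msize0.
    have sX k' : (msize (tnth f i ^+ k') <= (k' * D).+1)%N.
      elim: k' => [|k' IHk]; first by rewrite expr0 msize1.
      rewrite exprS; have [->|f0] := eqVneq (tnth f i ^+ k') 0; first by rewrite mulr0 msize0.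
      have [->|fi0] := eqVneq (tnth f i) 0; first by rewrite mul0r msize0.
      rewrite msizeM // mulSn.
      have := leq_bigmax i (F := fun i => msize (tnth f i)); rewrite -/D => Di.
      have -> : (msize (tnth f i) + msize (tnth f i ^+ k')).-1 = (msize (tnth f i) + (msize (tnth f i ^+ k')).-1)%N.
        by case: (msize (tnth f i ^+ k')) (msize_poly_eq0 (tnth f i ^+ k')) => [|l]; rewrite ?(negbTE f0) // addnS.
      rewrite -addnS leq_add //.
      by case: (msize _) IHk => //= l; rewrite ltnS => /leq_trans->.
    rewrite mnmE; have [->|f0] := eqVneq (tnth f i ^+ e i) 0; first by rewrite mul0r msize0.
    rewrite msizeM //; have := sX (e i).
    have := msize_poly_eq0 (tnth f i ^+ e i); rewrite (negbTE f0).
    case: (msize _) => //= l _; rewrite ltnS => le.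
    by rewrite -addnS leq_add.
  apply: (@leq_trans (\sum_(i < m) (C ^ N) * D).+1).
    by rewrite ltnS leq_sum // => i _; rewrite leq_mul2r -ltnS ltn_ord orbT.
  rewrite sum_nat_const card_ord /B /k mulnCA /C mulSn addSn ltnS.
  by apply: leq_trans (leq_addl _ _); rewrite [X in (_ <= X)%N]mulnS leq_addl.
pose A := \matrix_(i < #|{: E}|, j < #|{: T}|)
   ('X_[mo (enum_val i)] \mPo f)@_(mt (enum_val j)).
have /rowV0Pn[u /sub_kermxP uA u0] : kermx A != 0.
  rewrite kermx_eq0 -row_leq_rank -ltnNge; exact: leq_ltn_trans (rank_leq_col _) card.
exists (\sum_i u 0 i *: 'X_[mo (enum_val i)]).
  have [i ui] : exists i, u 0 i != 0 by apply/rV0Pn.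
  apply: contraNneq ui => /(congr1 (mcoeff (mo (enum_val i)))).
  rewrite mcoeff0 raddf_sum (bigD1 i) //= mcoeffZ mcoeffX eqxx mulr1.
  rewrite big1 ?addr0 => [->//|j ji].
  rewrite mcoeffZ mcoeffX; case: eqP => [e|]; last by rewrite mulr0.
  case/eqP: ji; apply: enum_val_inj; apply/ffunP => l; apply: val_inj.
  by move/mnmP: e => /(_ l); rewrite !mnmE.
rewrite linear_sum; apply/mpolyP => t; rewrite mcoeff0 raddf_sum /=.
have [ts|ts] := ltnP (mdeg t) B; last first.
  apply: big1 => i _; rewrite comp_mpolyZ mcoeffZ.
  by rewrite memN_msupp_eq0 ?mulr0 // msize_mdeg_ge // (leq_trans (szf _)).
have tB i : (t i < B)%N.
  by apply: leq_ltn_trans ts; rewrite mdegE (bigD1 i) //= leq_addr.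
pose t' : T := [ffun i => Ordinal (tB i)].
have <- : mt t' = t by apply/mnmP => i; rewrite mnmE ffunE.
transitivity ((u *m A) 0 (enum_rank t')); last by rewrite uA mxE.
rewrite mxE; apply: eq_bigr => i _.
by rewrite comp_mpolyZ mcoeffZ [A _ _]mxE enum_rankK.
Qed.

Hypothesis charF : [pchar F] =i pred0.

Lemma mderiv_all0 n (p : {mpoly F[n]}) :
  (forall i, p^`M(i) = 0) -> p = (p@_0%MM)%:MP.
Proof.
move=> H; apply/mpolyP => m; rewrite mcoeffC.
case: eqP => [->|m0]; rewrite ?mulr1 // mulr0.
have [i mi] : exists i, m i != 0%N.
  apply/existsP; apply: contra_notT m0; rewrite negb_exists => /forallP H'.
  by apply/mnmP => i; have := H' i; rewrite negbK mnm0E => /eqP.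
have Um : (U_(i) <= m)%MM by rewrite lep1mP.
have := congr1 (mcoeff (m - U_(i))%MM) (H i).
rewrite mcoeff_deriv mcoeff0 submK // => /eqP.
rewrite -mulr_natr mulf_eq0 => /orP[/eqP//|].
by move/pcharf0P: charF => ->.
Qed.

Lemma msize_mderiv n (p : {mpoly F[n]}) i :
  p != 0 -> (msize p^`M(i) < msize p)%N.
Proof.
move=> p0; have sp : (0 < msize p)%N by rewrite lt0n msize_poly_eq0.
rewrite [X in (X < _)%N]msizeE -(prednK sp) ltnS.
apply/bigmax_leqP_seq => m; rewrite mcoeff_msupp mcoeff_deriv => H _.
rewrite -ltnS (prednK sp).
have : (m + U_(i))%MM \in msupp p.
  by rewrite mcoeff_msupp; apply: contraNneq H => ->; rewrite mul0rn.
by move/msize_mdeg_lt; rewrite mdegD mdeg1 addn1.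
Qed.

(** A nonzero partial derivative of a relation of minimal degree is not a relation, being
    of smaller degree; and not all the partial derivatives vanish, since in
    characteristic zero the relation would then be constant. *)
Lemma separable_relation N m (f : m.-tuple {mpoly F[N]}) :
  (exists2 h : {mpoly F[m]}, h != 0 & h \mPo f = 0) ->
  exists h : {mpoly F[m]}, h \mPo f = 0 /\ exists i, h^`M(i) \mPo f != 0.
Proof.
case=> h; have [k] := ubnP (msize h); elim: k h => // k IH h sh h0 hf.
have [/existsP[i hi]|] := boolP [exists i, h^`M(i) \mPo f != 0].
  by exists h; split => //; exists i.
rewrite negb_exists => /forallP H.
have {}H i : h^`M(i) \mPo f = 0 by apply/eqP; rewrite -[_ == _]negbK.
have [/existsP[i hi]|] := boolP [exists i, h^`M(i) != 0].
  by apply: (IH h^`M(i)) => //; apply: leq_trans (msize_mderiv i h0) _.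
rewrite negb_exists => /forallP H'.
have {}H' i : h^`M(i) = 0 by apply/eqP; rewrite -[_ == _]negbK.
move: hf h0; rewrite (mderiv_all0 H') comp_mpolyC => /eqP.
by rewrite mpolyC_eq0 => /eqP->; rewrite eqxx.
Qed.
End AlgDep.

(** * Parametrizations of maximal rank *)

Section Jacobian.
Variables (F : fieldType).
Hypotheses (infF : infinite_field F) (charF : [pchar F] =i pred0).

Lemma comp_mpolyA m n k (p : {mpoly F[m]}) (f : m.-tuple {mpoly F[n]})
    (g : n.-tuple {mpoly F[k]}) :
  (p \mPo f) \mPo g = p \mPo [tuple tnth f i \mPo g | i < m].
Proof.
apply: (mpoly_eq_points infF) => v; rewrite !comp_mpoly_meval.
by apply: meval_eq => i; rewrite tnth_mktuple comp_mpoly_meval.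
Qed.

Lemma mderivU n (k i : 'I_n) : ('X_k : {mpoly F[n]})^`M(i) = (k == i)%:R.
Proof.
rewrite mderivX mnm1E; case: eqP => [->|_]; last by rewrite scale0r.
by rewrite scale1r -[X in (X - _)%MM]add0m addmK mpolyX0.
Qed.

Definition jac N M (f : M.-tuple {mpoly F[N]}) (v : 'I_N -> F) : 'M_(N, M) :=
  \matrix_(i, k) ((tnth f k)^`M(i)).@[v].

Definition linear_forms M N (B : 'M[F]_(M, N)) : N.-tuple {mpoly F[M]} :=
  [tuple \sum_k B k j *: 'X_k | j < N].

Definition comp_tuple m n k (f : m.-tuple {mpoly F[n]}) (g : n.-tuple {mpoly F[k]})
  : m.-tuple {mpoly F[k]} := [tuple tnth f i \mPo g | i < m].

(** Multiplication by the adjugate: the determinant of the Jacobian matrix over the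
    polynomial ring is nonzero because its value at v is. *)
Lemma jac_indep N (f : N.-tuple {mpoly F[N]}) v (c : 'I_N -> {mpoly F[N]}) :
  jac f v \in unitmx ->
  (forall j, \sum_i c i * (tnth f i)^`M(j) = 0) -> forall i, c i = 0.
Proof.
move=> Jv H i; pose J : 'M_N := \matrix_(i, j) (tnth f i)^`M(j).
have detJ : \det J != 0.
  apply: contraTneq Jv => dJ; rewrite unitmxE unitfE negbK -det_tr.
  have -> : (jac f v)^T = map_mx (meval v) J by apply/matrixP => a b; rewrite !mxE.
  by rewrite det_map_mx dJ /= meval0.
have cJ : \row_i c i *m J = 0.
  by apply/rowP => j; rewrite !mxE -[RHS](H j); apply: eq_bigr => k _; rewrite !mxE.
have : (\row_i c i *m J) *m \adj J = 0 by rewrite cJ mul0mx.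
rewrite -mulmxA mul_mx_adj mul_mx_scalar => /rowP/(_ i); rewrite !mxE => /eqP.
by rewrite mulf_eq0 (negbTE detJ) => /eqP.
Qed.

(** Differentiating a separable relation would give a linear relation between the
    rows of an invertible Jacobian matrix. *)
Lemma jac_alg_indep N (f : N.-tuple {mpoly F[N]}) v :
  jac f v \in unitmx -> forall h, h \mPo f = 0 -> h = 0.
Proof.
move=> Jv h hf; apply/eqP; apply: contraT => h0.
have [g [gf [i]]] := separable_relation charF (ex_intro2 _ _ h h0 hf).
rewrite (jac_indep (c := fun i => g^`M(i) \mPo f) Jv) ?eqxx // => j.
by rewrite -mderiv_comp gf mderiv0.
Qed.

(** Composing with linear forms reduces a Jacobian of full row rank to a square
    invertible one. *)
Lemma jac_linear_forms N M (f : M.-tuple {mpoly F[N]}) (B : 'M_(M, N)) v :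
  jac (comp_tuple (linear_forms B) f) v = jac f v *m B.
Proof.
apply/matrixP => i j; rewrite !mxE !tnth_mktuple (raddf_sum (comp_mpoly f)) (raddf_sum (mderiv i)) raddf_sum.
apply: eq_bigr => k _.
by rewrite /= comp_mpolyZ comp_mpolyXU -tnth_nth mderivZ mevalZ mxE mulrC.
Qed.

Lemma row_free_rinv N M (A : 'M[F]_(N, M)) : row_free A -> exists B, A *m B = 1%:M.
Proof. by case/row_freeP => B AB; exists B. Qed.

(** A relation between N linear forms on the smaller image exists because it has
    fewer than N parameters; on the larger image those forms are independent. *)
Lemma small_image_relation N M N' (f : M.-tuple {mpoly F[N]}) v
    (f' : M.-tuple {mpoly F[N']}) :
  row_free (jac f v) -> (N' < N)%N ->
  exists h : {mpoly F[M]}, h \mPo f != 0 /\ h \mPo f' = 0.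
Proof.
move=> /row_free_rinv[B JB] N'N.
have [h h0 hf'] := alg_dependent (comp_tuple (linear_forms B) f') N'N.
exists (h \mPo linear_forms B); rewrite !comp_mpolyA; split => //.
apply: contraNneq h0 => /(jac_alg_indep (v := v))->//.
by rewrite jac_linear_forms JB unitmx1.
Qed.

(** Generic smoothness: the tangent space cut out by all the equations of the image
    injects into the N-dimensional space of coordinates h *m B.  Each coordinate of
    the ambient space is algebraic over the N independent linear forms given by B;
    differentiating a separable relation shows that the coordinate of a tangent
    vector h is determined by h *m B, wherever the leading derivative q is nonzero. *)
Lemma generic_tangent_bound N M (f : M.-tuple {mpoly F[N]}) v :
  row_free (jac f v) ->
  exists q : {mpoly F[M]}, q \mPo f != 0 /\ exists B : 'M[F]_(M, N),
  forall w, q.@[w] != 0 -> forall h : 'rV_M,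
   (forall p, p \mPo f = 0 -> \sum_k (p^`M(k)).@[w] * h 0 k = 0) ->
   h *m B = 0 -> h = 0.
Proof.
move=> /row_free_rinv[B JB].
suff H k : exists q : {mpoly F[M]}, q \mPo f != 0 /\
  forall w, q.@[w] != 0 -> forall h : 'rV_M,
   (forall p, p \mPo f = 0 -> \sum_k (p^`M(k)).@[w] * h 0 k = 0) ->
   h *m B = 0 -> h 0 k = 0.
  have [q qP] := fin_all_exists H; exists (\prod_k q k); split.
    rewrite rmorph_prod /=; apply/prodf_neq0 => k _; exact: (qP k).1.
  exists B => w; rewrite rmorph_prod /= => /prodf_neq0 qw h hT hB.
  by apply/rowP => k; rewrite mxE; apply: (qP k).2 hT hB; apply: qw.
(* the k-th coordinate together with the N independent linear forms *)
pose fM : N.+1.-tuple {mpoly F[M]} :=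
  [tuple oapp (tnth (linear_forms B)) 'X_k (unlift ord0 i) | i < N.+1].
pose fN := comp_tuple fM f.
have fN0 : tnth fM ord0 = 'X_k by rewrite tnth_mktuple unlift_none.
have fNS j : tnth fM (lift ord0 j) = tnth (linear_forms B) j.
  by rewrite tnth_mktuple liftK.
have [h [hf [i hi]]] := separable_relation charF (alg_dependent fN (ltnSn N)).
(* If the derivative in the k-th coordinate vanished on the image, so would all the others,
   by the independence of the linear forms. *)
exists (h^`M(ord0) \mPo fM); rewrite comp_mpolyA; split.
  apply: contraNneq hi => h0.
  suff {i} : forall i, h^`M(i) \mPo fN = 0 by move->.
  have U : jac (comp_tuple (linear_forms B) f) v \in unitmx.
    by rewrite jac_linear_forms JB unitmx1.
  have := jac_indep (c := fun j => h^`M(lift ord0 j) \mPo fN) U.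
  move=> HH i; case: (unliftP ord0 i) => [j ->|->] //; apply: HH => {}j.
  have : (h \mPo fN)^`M(j) = 0 by rewrite hf mderiv0.
  rewrite mderiv_comp big_ord_recl h0 mul0r add0r => {2}<-.
  apply: eq_bigr => l _; rewrite [tnth fN _]tnth_mktuple fNS.
  by rewrite [tnth (comp_tuple _ _) _]tnth_mktuple.
move=> w qw u uT uB.
have := uT (h \mPo fM); rewrite comp_mpolyA => /(_ hf).
under eq_bigr do rewrite mderiv_comp raddf_sum mulr_suml.
rewrite exchange_big big_ord_recl /= [X in _ + X]big1 ?addr0 => [|j _].
  under eq_bigr do rewrite mevalM -mulrA.
  rewrite -mulr_sumr => /eqP; rewrite mulf_eq0 (negbTE qw) /= fN0.
  rewrite (bigD1 k) //= big1 => [|l lk].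
    by rewrite addr0 mderivU eqxx meval1 mul1r => /eqP.
  by rewrite mderivU eq_sym (negbTE lk) meval0 mul0r.
under eq_bigr do rewrite mevalM -mulrA.
rewrite -mulr_sumr; set S := \sum_(_ < M) _.
suff -> : S = (u *m B) 0 j by rewrite uB mxE mulr0.
rewrite mxE; apply: eq_bigr => l _; rewrite fNS tnth_mktuple mulrC; congr (_ * _).
rewrite (raddf_sum (mderiv l)) raddf_sum (bigD1 l) //= big1 => [|l' ll'].
  by rewrite mderivZ mevalZ mderivU eqxx meval1 mulr1 addr0.
by rewrite mderivZ mevalZ mderivU (negbTE ll') meval0 mulr0.
Qed.
End Jacobian.

(** The image of the hypersurface P = 0 lies in a proper closed subset of the closure
    of the image of f.  The equation h is a norm of P: in a relation between P and
    N independent linear forms in f, made prime to P, the part free of P must vanish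
    wherever P does. *)
Lemma image_hypersurface (F : fieldType) (infF : infinite_field F) (charF : [pchar F] =i pred0)
    N M (f : M.-tuple {mpoly F[N]}) v (P : {mpoly F[N]}) :
  row_free (jac f v) -> P != 0 ->
  exists h : {mpoly F[M]}, h \mPo f != 0 /\ forall v', P.@[v'] = 0 -> (h \mPo f).@[v'] = 0.
Proof.
move=> /row_free_rinv[B JB] P0; pose L := comp_tuple (linear_forms B) f.
have [R R0 RL] := alg_dependent [tuple rcons_pt (tnth L) P i | i < N.+1] (ltnSn N).
have [m [T]] := multiplicity_XsubC (muni R) 0.
rewrite (muni_neq0 R0) /= subr0 => T0 RE.
have LE w (c : {mpoly F[N]}) : (c \mPo L).@[w] = c.@[fun j => (tnth L j).@[w]].
  by rewrite comp_mpoly_meval.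
have Tw w : P.@[w] != 0 -> (map_poly (meval (fun j => (tnth L j).@[w])) T).[P.@[w]] = 0.
  move=> Pw; have : (R \mPo [tuple rcons_pt (tnth L) P i | i < N.+1]).@[w] = 0 by rewrite RL meval0.
  rewrite comp_mpoly_meval (meval_eq (v2 := rcons_pt (fun j => (tnth L j).@[w]) P.@[w])); last first.
    by move=> i; rewrite tnth_mktuple /rcons_pt; case: unlift.
  rewrite meval_muni RE rmorphM hornerM rmorphXn /= map_polyX hornerXn => /eqP.
  by rewrite mulf_eq0 expf_eq0 (negbTE Pw) andbF orbF => /eqP.
pose r := (map_poly (comp_mpoly L) T).[P].
have rE w : r.@[w] = (map_poly (meval (fun j => (tnth L j).@[w])) T).[P.@[w]].
  rewrite /r -horner_map -map_poly_comp /=; congr (_.[_]).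
  by apply: eq_map_poly => c /=; rewrite LE.
have r0 : r = 0.
  apply/eqP; apply: contraT => r0; have [w] := mpoly_point infF (mulf_neq0 r0 P0).
  by rewrite mevalM mulf_eq0 negb_or => /andP[/eqP rw Pw]; case: rw; rewrite rE Tw.
(* T is the relation as a polynomial in P, so that T.[0] is its part free of P. *)
exists (T.[0] \mPo linear_forms B); rewrite (comp_mpolyA infF) -/L; split.
  apply: contraNneq T0 => /(jac_alg_indep charF (v := v)) T00; rewrite /root T00 //.
  by rewrite jac_linear_forms JB unitmx1.
move=> w Pw; rewrite LE; transitivity r.@[w]; last by rewrite r0 meval0.
rewrite rE Pw.
by have := horner_map (meval (fun j => (tnth L j).@[w])) T 0; rewrite /= meval0 => ->.
Qed.

(** * Chevalley's theorem for a polynomial map *)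

Lemma min_measure (T : Type) (P : T -> Prop) (f : T -> nat) :
  (exists x, P x) -> exists2 x, P x & forall y, P y -> (f x <= f y)%N.
Proof.
case=> x; have [k] := ubnP (f x); elim: k x => // k IH x fx Px.
have [[y [Py fy]]|H] := classic (exists y, P y /\ (f y < f x)%N).
  by apply: IH Py; apply: leq_trans fy _.
by exists x => // y Py; rewrite leqNgt; apply/negP => fy; apply: H; exists y.
Qed.

Section Extension.
Variables (F : closedFieldType) (infF : infinite_field F) (R : idomainType).

Section OneStep.
Variables (S : idomainType) (e : {rmorphism S -> R}) (x : R).

Let E : {rmorphism {poly S} -> R} := horner_eval x \o map_poly e.

Let truncate (p : {poly S}) : exists q, [/\ map_poly e q = map_poly e p &
  (size q <= size (map_poly e p))%N].
Proof.
exists (\poly_(i < size (map_poly e p)) p`_i); split; last exact: size_poly.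
apply/polyP => i; rewrite coef_map coef_poly.
by case: ltnP => h; [rewrite coef_map|rewrite nth_default //; exact: rmorph0].
Qed.

Let EZ s q : E (s *: q) = e s * E q.
Proof. by rewrite /E /= /horner_eval map_polyZ hornerZ. Qed.

Let EC s : E s%:P = e s.
Proof. by rewrite /E /= /horner_eval map_polyC hornerC. Qed.

Let E_truncate p q : map_poly e q = map_poly e p -> E q = E p.
Proof. by rewrite /E /= => ->. Qed.

(** One step of the extension of specializations.  The subring S[x] of R, with e the
    structure map, is the image of {poly S} under evaluation at x; a specialization
    phi of S that respects the kernel of e extends to it provided that a single
    element a, which depends on b but not on phi, does not vanish under phi, and b
    can be kept nonzero.  If x is transcendental over S, any value for x outside
    finitely many works.  Otherwise v is taken as a root of a relation p for x of
    minimal degree: pseudo-division by p makes all the relations of x vanish at v once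
    the leading coefficient of p survives, and a nonzero element of S that is a multiple
    of b in S[x] guards b. *)
Lemma specialization_step (b : {poly S}) : (map_poly e b).[x] != 0 ->
  exists2 a : S, e a != 0 & forall phi : {rmorphism S -> F},
    (forall s, e s = 0 -> phi s = 0) -> phi a != 0 ->
    exists2 v : F, (forall p, (map_poly e p).[x] = 0 -> (map_poly phi p).[v] = 0) &
      (map_poly phi b).[v] != 0.
Proof.
move=> b0.
(* p is a relation for x whose coefficients are not all 0 in R. *)
pose P p := map_poly e p != 0 /\ E p = 0.
have [/(min_measure (fun p : {poly S} => size p))[p [pe0 Ep] pmin]|noP] := classic (exists p, P p); last first.
  have {}noP p : E p = 0 -> map_poly e p = 0.
    by move=> Ep; apply/eqP; apply: contraT => pe; case: noP; exists p.
  have be0 : map_poly e b != 0 by apply: contraNneq b0 => ->; rewrite horner0.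
  exists b`_(size (map_poly e b)).-1.
    by rewrite -coef_map -lead_coefE lead_coef_eq0.
  move=> phi kphi ba.
  have : map_poly phi b != 0.
    by apply: contraNneq ba => /polyP/(_ (size (map_poly e b)).-1); rewrite coef_map coef0 => ->.
  case/(poly_point infF) => v bv; exists v => // q /noP q0.
  suff -> : map_poly phi q = 0 by rewrite horner0.
  apply/polyP => i; rewrite coef_map coef0; apply: kphi.
  by rewrite -coef_map q0 coef0.
have full (r : {poly S}) : (forall r', map_poly e r' = map_poly e r -> (size r <= size r')%N) ->
   map_poly e r != 0 -> e (lead_coef r) != 0.
  move=> rmin r0; have [r' [rr' sr']] := truncate r.
  have := leq_trans (rmin _ rr') sr' => srr.
  have ss : size (map_poly e r) = size r.
    by apply/eqP; rewrite eqn_leq size_poly srr.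
  by rewrite lead_coefE -coef_map -ss -lead_coefE lead_coef_eq0.
have pc0 : e (lead_coef p) != 0.
  apply: full => // r re; apply: pmin; split; first by rewrite re.
  by rewrite (E_truncate re).
set c := lead_coef p in pc0.
have p0 : p != 0 by apply: contraNneq pe0 => ->; rewrite rmorph0.
have minp r : E r = 0 -> (size r < size p)%N -> map_poly e r = 0.
  move=> Er; rewrite ltnNge => H; apply/eqP; apply: contraT => re.
  by case/negP: H; apply: pmin.
(* r is a nonzero multiple of b in the ring generated by x; one of minimal degree is a
   constant, since otherwise dividing p by r would give a shorter relation than p. *)
pose Q r := E r != 0 /\ exists w : {poly S}, E r = E (w * b).
have [|r [Er [w Erw]] rmin] := @min_measure _ Q (fun r : {poly S} => size r).
  by exists b; split => //; exists 1; rewrite mul1r.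
have srp : (size r < size p)%N.
  have := Pdiv.Idomain.divp_eq r p.
  set k : nat := scalp r p; set A : {poly S} := divp r p; set r' : {poly S} := modp r p => dE.
  have Er' : E r' = e c ^+ k * E r.
    by have := congr1 E dE; rewrite rmorphD rmorphM Ep mulr0 add0r => <-; rewrite EZ rmorphXn.
  apply: (leq_ltn_trans _ (ltn_modpN0 r p0)); apply: rmin; split.
    by rewrite Er' mulf_neq0 // expf_neq0.
  by exists ((c ^+ k)%:P * w); rewrite Er' Erw -mulrA [in RHS]rmorphM EC rmorphXn.
have r0 : r != 0 by apply: contraNneq Er => ->; rewrite rmorph0.
have re0 : map_poly e r != 0.
  by apply: contraNneq Er; rewrite /E /= /horner_eval => ->; rewrite horner0.
have rc0 : e (lead_coef r) != 0.
  apply: full => // r' re; apply: rmin; rewrite /Q (E_truncate re).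
  by split => //; exists w.
have r1 : (size r <= 1)%N.
  rewrite leqNgt; apply/negP => r1.
  have := Pdiv.Idomain.divp_eq p r.
  set k : nat := scalp p r; set A : {poly S} := divp p r; set r' : {poly S} := modp p r => dE.
  have sr' : (size r' < size r)%N by rewrite ltn_modpN0.
  have EE : E A * E r + E r' = 0.
    by rewrite -rmorphM -rmorphD -dE EZ Ep mulr0.
  have Er' : E r' = 0.
    apply/eqP; apply: contraT => r'0; have : (size r <= size r')%N.
      apply: rmin; split => //; exists (- A * w); rewrite -mulrA mulNr rmorphN rmorphM -Erw.
      by apply/eqP; rewrite -addr_eq0 addrC EE.
    by rewrite leqNgt sr'.
  have EA : E A = 0.
    by move/eqP: EE; rewrite Er' addr0 mulf_eq0 (negbTE Er) orbF => /eqP.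
  have r'e : map_poly e r' = 0 by apply: minp => //; apply: ltn_trans srp.
  have Ae : map_poly e A = 0.
    apply: minp => //; have [->|A0] := eqVneq A 0; first by rewrite size_poly0 size_poly_gt0.
    have sAr : (size (A * r)%R <= size p)%N.
      have -> : A * r = lead_coef r ^+ k *: p - r' by rewrite dE addrK.
      apply: leq_trans (size_polyD _ _) _; rewrite geq_max size_scale_leq size_polyN.
      by apply: ltnW; apply: ltn_trans srp.
    move: sAr; rewrite size_mul //; case: (size r) r1 => [|[|l]] // _.
    by rewrite addnS /= => H; apply: leq_trans _ H; rewrite addnS ltnS leq_addr.
  have := congr1 (map_poly e) dE.
  rewrite rmorphD rmorphM /= Ae mul0r r'e addr0 map_polyZ => /eqP.
  by rewrite -mul_polyC mulf_eq0 polyC_eq0 (negbTE pe0) orbF rmorphXn expf_eq0 (negbTE rc0) andbF.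
have [s rs] : exists s, r = s%:P by exists r`_0; apply: size1_polyC.
have es0 : e s != 0 by rewrite rs lead_coefC in rc0.
exists (c * s); first by rewrite rmorphM mulf_neq0.
move=> phi kphi; rewrite rmorphM mulf_eq0 negb_or => /andP[pc ps].
have sp1 : (1 < size p)%N.
  rewrite ltnNge; apply/negP => /size1_polyC pE; move: Ep pc0.
  rewrite /c pE lead_coefC /E /= /horner_eval map_polyC hornerC => ->.
  by rewrite eqxx.
have /closed_rootP[v pv] : size (map_poly phi p) != 1.
  by rewrite size_map_poly_id0 // gtn_eqF.
have kv q : E q = 0 -> (map_poly phi q).[v] = 0.
  move=> Eq; have := Pdiv.Idomain.divp_eq q p.
  set k : nat := scalp q p; set A : {poly S} := divp q p; set r' : {poly S} := modp q p => dE.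
  have Er' : E r' = 0.
    by have := congr1 E dE; rewrite rmorphD rmorphM Ep mulr0 add0r => <-; rewrite EZ Eq mulr0.
  have r'phi : map_poly phi r' = 0.
    have re : map_poly e r' = 0 by apply: minp => //; rewrite ltn_modpN0.
    by apply/polyP => i; rewrite coef_map coef0; apply: kphi; rewrite -coef_map re coef0.
  have := congr1 (fun p => (map_poly phi p).[v]) dE.
  rewrite /= rmorphD rmorphM /= r'phi addr0 hornerM (rootP pv) mulr0.
  rewrite map_polyZ hornerZ => /eqP.
  by rewrite mulf_eq0 rmorphXn expf_eq0 (negbTE pc) andbF => /eqP.
exists v => //.
have : (map_poly phi (r - w * b)).[v] = 0 by apply: kv; rewrite rmorphB Erw subrr.
rewrite rmorphB rmorphM /= hornerD hornerN hornerM rs map_polyC hornerC => /eqP.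
by rewrite subr_eq0 => /eqP psE; apply: contraNneq ps; rewrite psE => ->; rewrite mulr0.
Qed.
End OneStep.

(** Adjoining finitely many elements one at a time; the nonvanishing condition is
    pulled back through each step. *)
Lemma specialization_extends (xs : seq R) (S : idomainType) (e : {rmorphism S -> R}) :
  exists2 a : S, e a != 0 & forall phi : {rmorphism S -> F},
    (forall s, e s = 0 -> phi s = 0) -> phi a != 0 ->
    exists (S' : idomainType) (i : {rmorphism S -> S'}) (e' : {rmorphism S' -> R})
           (phi' : {rmorphism S' -> F}),
    [/\ forall s, e' (i s) = e s, forall s, phi' (i s) = phi s,
        forall s, e' s = 0 -> phi' s = 0 & {in xs, forall x, exists s, e' s = x}].
Proof.
elim: xs S e => [|x xs IH] S e.
  exists 1; first by rewrite rmorph1 oner_eq0.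
  by move=> phi kphi _; exists S, idfun, e, phi; split.
pose E : {rmorphism {poly S} -> R} := horner_eval x \o map_poly e.
have [b b0 bP] := IH {poly S} E.
have [a a0 aP] := specialization_step b0.
exists a => // phi kphi pa; have [v vk bv] := aP phi kphi pa.
pose G : {rmorphism {poly S} -> F} := horner_eval v \o map_poly phi.
have [S' [i [e' [phi' [ie ip k' xs']]]]] := bP G vk bv.
exists S', (i \o polyC), e', phi'; split => [s|s|//|y].
- by rewrite /= ie /= /horner_eval map_polyC hornerC.
- by rewrite /= ip /= /horner_eval map_polyC hornerC.
rewrite inE => /orP[/eqP->|/xs'//].
by exists (i 'X); rewrite ie /= /horner_eval map_polyX hornerX.
Qed.
End Extension.

Lemma rmorph_mmap (R S S' : comNzRingType) n (f : {rmorphism R -> S}) (h : 'I_n -> S)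
  (g : {rmorphism S -> S'}) p : g (mmap f h p) = mmap (g \o f) (g \o h) p.
Proof.
rewrite /mmap rmorph_sum; apply: eq_bigr => m _; rewrite rmorphM; congr (_ * _).
by rewrite /mmap1 rmorph_prod; apply: eq_bigr => i _; rewrite rmorphXn.
Qed.

(** Chevalley's theorem: a point w of the closure of the image is a specialization of
    the coordinate ring {mpoly F[M]} that kills the relations of f.  Outside a = 0 it
    extends to the ring generated by the parameters, where it is a preimage of w. *)
Lemma image_contains_open (F : closedFieldType) (infF : infinite_field F) N M
    (f : M.-tuple {mpoly F[N]}) :
  exists2 a : {mpoly F[M]}, a \mPo f != 0 & forall w : 'I_M -> F,
    (forall p, p \mPo f = 0 -> p.@[w] = 0) -> a.@[w] != 0 ->
    exists v, forall k, (tnth f k).@[v] = w k.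
Proof.
have [a a0 aP] := specialization_extends infF [seq 'X_i | i : 'I_N] (comp_mpoly f : {rmorphism {mpoly F[M]} -> {mpoly F[N]}}).
exists a => // w kw aw.
have [S [i [e [phi [ie ip ke xs]]]]] := aP (meval w : {rmorphism _ -> _}) kw aw.
have /fin_all_exists[t tE] (j : 'I_N) : exists s, e s = 'X_j.
  by apply: xs; apply: image_f.
exists (phi \o t) => k.
pose P := mmap (i \o @mpolyC M F) t (tnth f k).
have eP : e P = tnth f k.
  rewrite /P rmorph_mmap [RHS]mpolyE; apply: eq_bigr => m _.
  rewrite /= ie /= comp_mpolyC mul_mpolyC mpolyXE_id; congr (_ *: _).
  by apply: eq_bigr => j _; rewrite /= tE.
have pP : phi P = (tnth f k).@[phi \o t].
  rewrite /P rmorph_mmap; apply: eq_bigr => m _.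
  by rewrite /= ip /= mevalC.
rewrite -pP; have : phi (P - i 'X_k) = 0.
  by apply: ke; rewrite rmorphB eP ie /= comp_mpolyXU -tnth_nth subrr.
by rewrite rmorphB ip /= mevalXU => /eqP; rewrite subr_eq0 => /eqP.
Qed.

(** * Dimension of a parametrized projective set *)

Section Cones.
Variables (F : fieldType) (infF : infinite_field F) (W : vectType F).
Local Notation M := (\dim {:W}).
Implicit Types (p q : {mpoly F[M]}) (x : proj W) (w : W) (X Z : point_set W).

Lemma coordsZ c w i : coords (c *: w) i = c * coords w i.
Proof. by rewrite /coords linearZ. Qed.

Lemma coordsD w w' i : coords (w + w') i = coords w i + coords w' i.
Proof. by rewrite /coords linearD. Qed.

Lemma coords_sum (a : 'I_M -> F) i : coords (\sum_k a k *: (vbasis {:W})`_k) i = a i.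
Proof. by rewrite /coords coord_sum_free ?(basis_free (vbasisP _)). Qed.

Lemma sum_coords w : w = \sum_k coords w k *: (vbasis {:W})`_k.
Proof. by apply: coord_vbasis; rewrite memvf. Qed.

Lemma coords_inj w w' : coords w =1 coords w' -> w = w'.
Proof. by move=> H; rewrite (sum_coords w) (sum_coords w'); apply: eq_bigr => k _; rewrite H. Qed.

Lemma point_of w : w != 0 -> exists x : proj W, val x = <[w]>%VS.
Proof.
move=> w0; have d : \dim <[w]> == 1%N by rewrite dim_vline w0.
by exists (exist (fun U : {vspace W} => \dim U == 1%N) _ d).
Qed.

Lemma vpick_point x : vpick (val x) != 0.
Proof. by rewrite vpick0 -dimv_eq0 (eqP (valP x)). Qed.

Lemma point_line x w : w \in val x -> w != 0 -> val x = <[w]>%VS.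
Proof.
move=> wx w0; apply/esym/eqP; rewrite eqEdim -memvE wx dim_vline w0.
by rewrite (eqP (valP x)).
Qed.

Lemma mem_line x w w' : w \in val x -> w != 0 -> w' \in val x -> exists c, w' = c *: w.
Proof. by move=> wx w0; rewrite (point_line wx w0) => /vlineP[c ->]; exists c. Qed.

Lemma mem_point x : exists2 w, w \in val x & w != 0.
Proof. by exists (vpick (val x)); rewrite ?memv_pick ?vpick_point. Qed.

(** Unlike vanishing at the homogeneous coordinates chosen by [vpick], this makes sense
    for polynomials that are not homogeneous; over an infinite field it means that
    all the homogeneous components vanish. *)
Definition cone_vanish p x := forall w, w \in val x -> p.@[coords w] = 0.

(** A polynomial restricted to the line through v: the coefficients are the values of
    its homogeneous components at v. *)
Lemma meval_scale n (p : {mpoly F[n]}) (v : 'I_n -> F) c :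
  p.@[fun i => c * v i] = \sum_(d < msize p) c ^+ d * (pihomog mdeg d p).@[v].
Proof.
rewrite {1}(pihomog_partitionE (leqnn (msize p))) raddf_sum; apply: eq_bigr => d _ /=.
rewrite pihomogE !raddf_sum mulr_sumr; apply: eq_bigr => m /eqP <-.
rewrite /= !mevalZ !mevalX mulrCA; congr (_ * _).
rewrite mdegE -prodrXr -big_split /=.
by apply: eq_bigr => i _; rewrite exprMn.
Qed.

Lemma meval_homog n (p : {mpoly F[n]}) d (v : 'I_n -> F) c :
  p \is d.-homog -> p.@[fun i => c * v i] = c ^+ d * p.@[v].
Proof.
move=> pd; rewrite (mpolyE p) !raddf_sum mulr_sumr big_seq [RHS]big_seq.
apply: eq_bigr => m /(dhomog_mf pd) <-; rewrite /= !mevalZ !mevalX mulrCA.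
rewrite mdegE -prodrXr -big_split /=; congr (_ * _).
by apply: eq_bigr => i _; rewrite exprMn.
Qed.

Lemma pihomog_vanish n (p : {mpoly F[n]}) (v : 'I_n -> F) :
  (forall c, c != 0 -> p.@[fun i => c * v i] = 0) -> forall d, (pihomog mdeg d p).@[v] = 0.
Proof.
move=> H d; pose P := \poly_(d < msize p) (pihomog mdeg d p).@[v].
have P0 : P = 0.
  apply/eqP; apply: contraT => P0; have : 'X * P != 0 by rewrite mulf_neq0 ?polyX_eq0.
  case/(poly_point infF) => c; rewrite hornerM hornerX mulf_eq0 negb_or => /andP[c0].
  by rewrite horner_poly; under eq_bigr do rewrite mulrC; rewrite -meval_scale H ?eqxx.
have [dp|dp] := ltnP d (msize p).
  by have := coef_poly (msize p) (fun d => (pihomog mdeg d p).@[v]) d; rewrite -/P P0 coef0 dp.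
rewrite pihomogE big_seq_cond big1 ?meval0 // => m /andP[ms /eqP md].
by have := msize_mdeg_lt ms; rewrite md ltnNge dp.
Qed.

Lemma vanishes_cone p d x : p \is d.-homog -> vanishes_at p x -> cone_vanish p x.
Proof.
move=> pd px w wx; have [c ->] := mem_line (memv_pick (val x)) (vpick_point x) wx.
rewrite (meval_eq (v2 := fun i => c * hcoords x i)); last by move=> i; rewrite coordsZ.
by rewrite (meval_homog _ _ pd) px mulr0.
Qed.

Lemma cone_vanishes p x : cone_vanish p x -> vanishes_at p x.
Proof. by apply; apply: memv_pick. Qed.

(** A polynomial vanishes on a line through the origin of an infinite field exactly
    when its homogeneous components do.  Hence closed sets may be described by
    arbitrary polynomials, as long as these vanish on cones. *)
Lemma zclosed_cone (S : {mpoly F[M]} -> Prop) :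
  zclosed (fun x => forall p, S p -> cone_vanish p x).
Proof.
exists (fun q => exists p d, S p /\ q = pihomog mdeg d p).
  by move=> q [p [d [_ ->]]]; exists d; apply: pihomogP.
move=> x; split => [H q [p [d [Sp ->]]]|H p Sp w wx].
  apply: pihomog_vanish => c _; rewrite -(H p Sp (c *: vpick (val x))).
    by apply: meval_eq => i; rewrite coordsZ.
  by rewrite memvZ // memv_pick.
rewrite (pihomog_partitionE (leqnn (msize p))) raddf_sum big1 //= => d _.
apply: (vanishes_cone (pihomogP mdeg d p)) wx.
by apply: H; exists p, d.
Qed.

Lemma zclosed_conesP C : zclosed C ->
  exists S : {mpoly F[M]} -> Prop, forall x, C x <-> (forall p, S p -> cone_vanish p x).
Proof.
move=> [S hS CS]; exists S => x; rewrite CS; split => H p Sp.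
  by have [d pd] := hS _ Sp; apply: vanishes_cone pd (H _ Sp).
by apply: cone_vanishes; apply: H.
Qed.

Lemma zclosed_cone1 p : zclosed (cone_vanish p).
Proof.
have [S hS CS] := zclosed_cone (eq p); exists S => // x.
by rewrite -CS; split => [H _ <-|H]; [|apply: H].
Qed.

(** The restriction of polynomials to a line takes values in the domain {poly F}. *)
Lemma point_prime p q x : (forall w, w \in val x -> p.@[coords w] * q.@[coords w] = 0) ->
  cone_vanish p x \/ cone_vanish q x.
Proof.
move=> H; have [w0 w0x w00] := mem_point x.
pose a i : {poly F} := coords w0 i *: 'X.
have aE (r : {mpoly F[M]}) c : (along r a).[c] = r.@[coords (c *: w0)].
  rewrite horner_along; apply: meval_eq => i.
  by rewrite /a hornerZ hornerX coordsZ mulrC.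
have : along p a * along q a = 0.
  apply/eqP; apply: contraT => /(poly_point infF)[c].
  by rewrite hornerM !aE H ?eqxx // memvZ.
move/eqP; rewrite mulf_eq0 => /orP[] /eqP r0; [left|right] => w wx;
  by have [c ->] := mem_line w0x w00 wx; rewrite -aE r0 horner0.
Qed.

Lemma irreducible_prime Z p q : irreducible Z ->
  (forall x, Z x -> forall w, w \in val x -> p.@[coords w] * q.@[coords w] = 0) ->
  (forall x, Z x -> cone_vanish p x) \/ (forall x, Z x -> cone_vanish q x).
Proof.
move=> [_ irr] H.
by apply: irr (zclosed_cone1 p) (zclosed_cone1 q) _ => x Zx; apply: point_prime (H x Zx).
Qed.

(** Algebraic independence of g modulo the ideal of the cone over Z, expressed by
    values. *)
Definition indep_mod Z k (g : 'I_k -> {mpoly F[M]}) :=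
  forall h : {mpoly F[k]}, h != 0 ->
    exists x, Z x /\ exists2 w, w \in val x & h.@[fun i => (g i).@[coords w]] != 0.

(** The step in the bound on chains: a polynomial p that vanishes on Z but not on the
    larger irreducible Z' is independent of any g that is independent modulo Z.
    After division by a power of p, which is harmless as Z' is irreducible, a relation
    restricts on Z to a nontrivial relation between the g. *)
Lemma indep_mod_rcons Z Z' k (g : 'I_k -> {mpoly F[M]}) p :
  sub_pset Z Z' -> irreducible Z' -> (forall x, Z x -> cone_vanish p x) ->
  ~ (forall x, Z' x -> cone_vanish p x) ->
  indep_mod Z g -> indep_mod Z' (rcons_pt g p).
Proof.
move=> ZZ' irr pZ pZ' ig h h0.
have P0 := muni_neq0 h0.
have [m [P]] := multiplicity_XsubC (muni h) 0.
rewrite P0 /= subr0 => rP PE.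
pose G := [tuple g i | i < k].
pose r := (map_poly (comp_mpoly G) P).[p].
have rE w : r.@[coords w] = (map_poly (meval (fun i => (g i).@[coords w])) P).[p.@[coords w]].
  rewrite /r -horner_map -map_poly_comp /=; congr (_.[_]).
  apply: eq_map_poly => c /=; rewrite comp_mpoly_meval.
  by apply: meval_eq => i; rewrite tnth_mktuple.
have hE w : h.@[fun i => (rcons_pt g p i).@[coords w]] = r.@[coords w] * (p ^+ m).@[coords w].
  rewrite (meval_eq (v2 := rcons_pt (fun i => (g i).@[coords w]) p.@[coords w])); last first.
    by move=> i; rewrite /rcons_pt; case: unlift.
  rewrite meval_muni PE rmorphM hornerM /= -rE; congr (_ * _).
  by rewrite rmorphXn /= map_polyX hornerXn rmorphXn.
apply: NNPP => Hno.
have {}Hno x : Z' x -> forall w, w \in val x -> r.@[coords w] * (p ^+ m).@[coords w] = 0.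
  move=> Zx w wx; apply/eqP; apply: contraT => hw; case: Hno.
  by exists x; split => //; exists w => //; rewrite hE.
case: (irreducible_prime irr Hno) => H.
  have [x [Zx [w wx]]] := ig _ rP.
  case/eqP; rewrite -(H x (ZZ' _ Zx) w wx) rE (pZ x Zx w wx).
  by rewrite -[in RHS](raddf0 (meval (fun i => (g i).@[coords w]))) horner_map.
apply: pZ' => x Zx w wx; have := H x Zx w wx.
by rewrite rmorphXn => /eqP; rewrite expf_eq0 => /andP[_ /eqP].
Qed.

Section Parametrized.
Variables (N : nat) (f : M.-tuple {mpoly F[N]}).

(** The polynomial map f, read as a map into W in the chosen basis. *)
Definition param_vec (v : 'I_N -> F) : W :=
  \sum_k (tnth f k).@[v] *: (vbasis {:W})`_k.

Lemma coords_param v k : coords (param_vec v) k = (tnth f k).@[v].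
Proof. exact: coords_sum. Qed.

Lemma meval_param p v : p.@[coords (param_vec v)] = (p \mPo f).@[v].
Proof. by rewrite comp_mpoly_meval; apply: meval_eq => k; apply: coords_param. Qed.

(** The projective closure of the image of f, through its equations. *)
Definition in_image_closure : point_set W := fun x =>
  forall p, p \mPo f = 0 -> cone_vanish p x.

Lemma zclosed_image_closure : zclosed in_image_closure.
Proof. exact: zclosed_cone. Qed.

Lemma image_in_closure v x : val x = <[param_vec v]>%VS ->
  (forall c, exists v', param_vec v' = c *: param_vec v) -> in_image_closure x.
Proof.
move=> xv H p pf w; rewrite xv => /vlineP[c ->]; have [v' <-] := H c.
by rewrite meval_param pf meval0.
Qed.

(** Along a chain the number of polynomials independent modulo Z_i increases by one at
    each step.  It starts at 1, because a cone over a point is already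
    one-dimensional, and cannot exceed the number of parameters of f. *)
Lemma chain_bound X m : sub_pset X in_image_closure -> has_chain X m -> (m < N)%N.
Proof.
move=> Xf [Z [ZX Zs]].
have H i : (i <= m)%N -> exists g : 'I_i.+1 -> {mpoly F[M]}, indep_mod (Z i) g.
  elim: i => [_|i IH im].
    have [_ [[x Zx] _]] := ZX 0%N (leq0n _).
    have [w wx w0] := mem_point x.
    have [k wk] : exists k, coords w k != 0.
      apply: NNPP => H; case/eqP: w0; apply: coords_inj => k.
      rewrite -(scale0r 0) coordsZ mul0r; apply/eqP; apply: contraT => wk.
      by case: H; exists k.
    (* on the line through w the coordinate k takes all values *)
    exists (fun _ => 'X_k) => h /(mpoly_point infF)[v hv].
    exists x; split => //; exists (v ord0 / coords w k *: w); first by rewrite memvZ.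
    rewrite (meval_eq (v2 := v)) // => j.
    by rewrite mevalXU coordsZ divfK // (ord1 j).
  have [g ig] := IH (ltnW im).
  have [ZZ' nZ] := Zs i im.
  have [[C clC ZC] _] := ZX i (ltnW im).
  have [clZ' irr] := ZX i.+1 im; have [D _ ZD] := clZ'.
  have [S CS] := zclosed_conesP clC.
  have [p [pZ pZ']] : exists p, (forall x, Z i x -> cone_vanish p x) /\
      ~ (forall x, Z i.+1 x -> cone_vanish p x).
    apply: NNPP => H; apply: nZ => x Zx; apply/ZC; split; first by case/ZD: Zx.
    apply/CS => p Sp; apply: NNPP => pw; apply: H; exists p; split.
      by move=> y /ZC[_ /CS]; apply.
    by move=> /(_ _ Zx).
  exists (rcons_pt g p); exact: (indep_mod_rcons ZZ' irr pZ pZ' ig).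
have [g ig] := H m (leqnn m); rewrite ltnNge; apply/negP => Nm.
(* the chain yields m + 1 independent polynomials on a set with N parameters *)
have [h h0 hg] := alg_dependent [tuple g i \mPo f | i < m.+1] Nm.
have [x [Zx [w wx /eqP[]]]] := ig h h0.
have [[C _ ZC] _] := ZX m (leqnn m); have [Xx _] := (ZC x).1 Zx.
have := Xf x Xx (h \mPo [tuple g i | i < m.+1]).
rewrite (comp_mpolyA infF) => /(_ _ w wx); rewrite comp_mpoly_meval.
rewrite (@meval_eq _ _ _ (fun i => (g i).@[coords w])); last by move=> i; rewrite tnth_mktuple.
apply; rewrite -[RHS]hg; congr (h \mPo _); apply: eq_from_tnth => i.
by rewrite !tnth_mktuple.
Qed.
End Parametrized.

Section Flag.
Variables (N : nat) (f : M.-tuple {mpoly F[N.+1]}) (v0 : 'I_N.+1 -> F).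
Hypothesis Jf : row_free (jac f v0).
Hypotheses (charF : [pchar F] =i pred0).

Definition scale_first (c : F) n (u : 'I_n.+1 -> F) (j : 'I_n.+1) : F :=
  if j == ord0 then c * u j else u j.

Hypothesis f_scale : forall c u, param_vec f (scale_first c u) = c *: param_vec f u.
Variable X : point_set W.
Hypothesis image_X : forall v x, val x = <[param_vec f v]>%VS -> X x.

Let flag_pt i (u : 'I_i.+1 -> F) (j : 'I_N.+1) : F := oapp u (v0 j) (insub (val j)).
Let flag i : N.+1.-tuple {mpoly F[i.+1]} :=
  [tuple oapp (fun k : 'I_i.+1 => 'X_k) (v0 j)%:MP (insub (val j)) | j < N.+1].
Let fi i := comp_tuple f (flag i).

Let flagE i u j : (tnth (flag i) j).@[u] = flag_pt u j.
Proof.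
rewrite tnth_mktuple /flag_pt.
by case: insub => [k|] /=; rewrite ?mevalXU ?mevalC.
Qed.

Let fiE i u : param_vec (fi i) u = param_vec f (flag_pt u).
Proof.
apply: eq_bigr => k _; congr (_ *: _); rewrite tnth_mktuple comp_mpoly_meval.
by apply: meval_eq => j; rewrite flagE.
Qed.

Let base i (iN : (i <= N)%N) : 'I_i.+1 -> F := v0 \o @widen_ord i.+1 N.+1 iN.

Let flag_base i (iN : (i <= N)%N) j : flag_pt (base iN) j = v0 j.
Proof.
rewrite /flag_pt; case: insubP => [k _ e|//] /=.
by congr v0; apply: val_inj.
Qed.

Let Jfi i (iN : (i <= N)%N) : row_free (jac (fi i) (base iN)).
Proof.
have [B JB] := row_free_rinv Jf.
pose wd : 'I_i.+1 -> 'I_N.+1 := @widen_ord i.+1 N.+1 iN.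
have -> : jac (fi i) (base iN) = rowsub wd (jac f v0).
  apply/matrixP => k l; rewrite !mxE tnth_mktuple mderiv_comp raddf_sum.
  rewrite (bigD1 (wd k)) //= big1 ?addr0 => [|j jk].
    rewrite mevalM tnth_mktuple.
    rewrite insubT ?ltn_ord //= => lt; rewrite mderivU.
    rewrite (_ : Sub _ _ = k) ?eqxx ?meval1 ?mulr1; last exact: val_inj.
    rewrite comp_mpoly_meval; apply: meval_eq => j; rewrite flagE.
    exact: flag_base.
  rewrite mevalM tnth_mktuple.
  case: insubP => [l' lt e|_] /=; last by rewrite mderivC meval0 mulr0.
  rewrite mderivU; case: eqP => [kl|]; last by rewrite meval0 mulr0.
  by case/eqP: jk; apply: val_inj; rewrite /= -kl e.
apply/row_freeP; exists (B *m colsub wd 1%:M); rewrite mulmxA.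
rewrite mul_rowsub_mx JB mulmx_colsub mulmx1.
by apply/matrixP => a b; rewrite !mxE -val_eqE /= -val_eqE.
Qed.

Let Zi i : point_set W := fun x => X x /\ in_image_closure (fi i) x.

Let nonzero_coord i (iN : (i <= N)%N) : exists k, tnth (fi i) k != 0.
Proof.
apply: NNPP => H; have /row_freeP[B] := Jfi iN.
have -> : jac (fi i) (base iN) = 0.
  apply/matrixP => a k; rewrite [LHS]mxE mxE; have [->|fk] := eqVneq (tnth (fi i) k) 0.
    by rewrite mderiv0 meval0.
  by case: H; exists k.
by rewrite mul0mx => /matrixP/(_ ord0 ord0)/eqP; rewrite !mxE eqxx eq_sym oner_eq0.
Qed.

Let Zi_point i (iN : (i <= N)%N) (h : {mpoly F[M]}) : h \mPo fi i != 0 ->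
  exists x u, [/\ Zi i x, val x = <[param_vec (fi i) u]>%VS & (h \mPo fi i).@[u] != 0].
Proof.
move=> hf; have [k fk] := nonzero_coord iN.
have [u] := mpoly_point infF (mulf_neq0 hf fk).
rewrite mevalM mulf_eq0 negb_or => /andP[hu fu].
have [|x xu] := @point_of (param_vec (fi i) u).
  apply: contraNneq fu => e; rewrite -coords_param e.
  by rewrite -(scale0r 0) coordsZ mul0r.
exists x, u; split => //; split.
  by apply: (image_X (v := flag_pt u)); rewrite xu fiE.
apply: image_in_closure xu _ => c; exists (scale_first c u).
rewrite !fiE -f_scale; apply: eq_bigr => l _; congr (_ *: _); apply: meval_eq => j.
rewrite /flag_pt /scale_first; case: insubP => [j' _ e|] /=.
  by rewrite -!val_eqE /= e.
by rewrite -leqNgt; case: eqP => [->|].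
Qed.

(** The closures of the images of a flag of affine subspaces through v0 form a chain:
    they are irreducible as images, and strictly increasing by the rank of the
    Jacobian.  The first parameter acts by scaling, so that these images are cones. *)
Lemma flag_chain m : (m <= N)%N -> has_chain X m.
Proof.
move=> mN; exists Zi; split => i im; have iN := leq_trans im mN.
  split; first by exists (in_image_closure (fi i)) => //; apply: zclosed_image_closure.
  split.
    have [|x [u [Zx _ _]]] := Zi_point iN (h := 1); last by exists x.
    by rewrite comp_mpoly1 oner_eq0.
  move=> C D clC clD H.
  have [S CS] := zclosed_conesP clC; have [T DT] := zclosed_conesP clD.
  have [ZC|nZC] := classic (sub_pset (Zi i) C); [by left|right].
  apply: NNPP => nZD.
  have wit (E : point_set W) (Q : {mpoly F[M]} -> Prop) :
      (forall x, E x <-> forall p, Q p -> cone_vanish p x) -> ~ sub_pset (Zi i) E ->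
      exists2 p, Q p & p \mPo fi i != 0.
    move=> EQ nE; apply: NNPP => nq; apply: nE => x [_ Zx]; apply/EQ => p Qp.
    apply: Zx; apply/eqP; apply: contraT => pf; case: nq; by exists p.
  have [p Sp pf] := wit _ _ CS nZC; have [q Tq qf] := wit _ _ DT nZD.
  have [|x [u [Zx xu]]] := Zi_point iN (h := p * q).
    by rewrite rmorphM mulf_neq0.
  rewrite rmorphM mevalM mulf_eq0 negb_or -!meval_param => /andP[pu qu].
  have ux : param_vec (fi i) u \in val x by rewrite xu memv_line.
  case: (H x Zx) => [/CS/(_ _ Sp _ ux) e|/DT/(_ _ Tq _ ux) e].
    by rewrite e eqxx in pu.
  by rewrite e eqxx in qu.
have iN' : (i.+1 <= N)%N := leq_trans im mN.
split => [x [Xx Zx]|H].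
  split=> // p pf; apply: Zx; apply: (mpoly_eq0_points infF) => u.
  rewrite -meval_param fiE.
  pose u' (j : 'I_i.+2) : F := flag_pt u (@widen_ord i.+2 N.+1 iN' j).
  rewrite (_ : param_vec f _ = param_vec (fi i.+1) u').
    by rewrite meval_param pf meval0.
  rewrite fiE; apply: eq_bigr => k _; congr (_ *: _); apply: meval_eq => j.
  rewrite {2}/flag_pt; case: insubP => [j' _ e|] /=; last first.
    rewrite /flag_pt; case: insubP => //= l lt _; rewrite -leqNgt => lt'.
    by have := ltn_trans lt lt'; rewrite ltnn.
  by rewrite /u' (_ : widen_ord _ _ = j) //; apply: val_inj.
have [h [hf hf']] := small_image_relation infF charF (fi i) (Jfi iN') (ltnSn _).
have [x [u [Zx xu]]] := Zi_point iN' hf; rewrite -meval_param => /eqP[].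
have [_ /(_ _ hf')] := H x Zx; apply; by rewrite xu memv_line.
Qed.
End Flag.

Lemma jac_line n m (f : m.-tuple {mpoly F[n]}) v (e : 'rV_n) k :
  (e *m jac f v) 0 k = (along (tnth f k) (fun i => (v i)%:P + e 0 i *: 'X))^`().[0].
Proof.
rewrite deriv_along horner_sum mxE; apply: eq_bigr => i _.
rewrite hornerM horner_along mxE mulrC; congr (_ * _).
  by apply: meval_eq => j; rewrite !hornerE ?mulr0 ?addr0.
by rewrite derivD derivC add0r derivZ derivX hornerZ hornerC mulr1.
Qed.

Lemma poly_eq_points (p q : {poly F}) : (forall t, p.[t] = q.[t]) -> p = q.
Proof.
move=> H; apply/eqP; rewrite -subr_eq0; apply: contraT => /(poly_point infF)[t].
by rewrite hornerD hornerN H subrr eqxx.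
Qed.

Lemma unitmx_row n (e : 'rV[F]_n.+1) : e != 0 ->
  exists2 E : 'M_n.+1, E \in unitmx & row ord0 E = e.
Proof.
move=> e0; have re : \rank e = 1%N by rewrite rank_rV e0.
pose c := col_ebase e 0 0.
have c0 : c != 0.
  have := col_ebase_unit e; rewrite unitmxE.
  by rewrite [col_ebase e]mx11_scalar det_scalar1 unitfE.
exists (diag_mx (\row_i (if i == ord0 then c else 1)) *m row_ebase e).
  rewrite unitmx_mul row_ebase_unit andbT unitmxE det_diag unitfE.
  by apply/prodf_neq0 => i _; rewrite mxE; case: ifP; rewrite ?oner_eq0.
rewrite -[RHS]mulmx_ebase re row_mul; congr (_ *m _).
apply/rowP => j; rewrite !mxE big_ord1 !mxE -/c eqxx /=.
by rewrite andbT mulr_natr.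
Qed.

Section HasDim.
Variables (N : nat) (f : M.-tuple {mpoly F[N]}) (v0 : 'I_N -> F) (e : 'rV[F]_N).
Hypotheses (charF : [pchar F] =i pred0) (Jf : row_free (jac f v0)).
Hypothesis f_euler : forall t,
  param_vec f (fun i => v0 i + t * e 0 i) = (1 + t) *: param_vec f v0.
Hypothesis fv0 : (0 < N)%N -> param_vec f v0 != 0.
Variable X : point_set W.
Hypothesis image_X : forall v x, val x = <[param_vec f v]>%VS -> X x.
Hypothesis X_closure : sub_pset X (in_image_closure f).

Let euler : e *m jac f v0 = \row_k (tnth f k).@[v0].
Proof.
apply/rowP => k; rewrite jac_line mxE.
have -> : along (tnth f k) (fun i => (v0 i)%:P + e 0 i *: 'X) = (1 + 'X) * ((tnth f k).@[v0])%:P.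
  apply: poly_eq_points => t; rewrite horner_along hornerM hornerC hornerD hornerX hornerC.
  have := congr1 (fun w => coords w k) (f_euler t); rewrite coordsZ !coords_param => <-.
  by apply: meval_eq => i; rewrite !hornerE mulrC.
by rewrite derivM derivD derivX !derivC mulr0 addr0 add0r mul1r hornerC.
Qed.

(** Only the scaling of the value at v0 along the direction e is assumed of f.  After a
    linear change of parameters that makes e the first one, f is replaced by the cone
    'X_0 * f over the affine hyperplane spanned by the other parameters; Euler's
    relation [euler] shows that the Jacobian does not change, and now the first
    parameter scales. *)
Lemma param_has_chain m : (m < N)%N -> has_chain X m.
Proof.
case: N f v0 e Jf euler fv0 image_X => // n g u0 d Jg eul gu0 imX mn.
have d0 : d != 0.
  apply: contraNneq (gu0 isT) => dE; apply/eqP/coords_inj => k.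
  rewrite coords_param -(scale0r 0) coordsZ mul0r.
  by have /rowP/(_ k) := eul; rewrite dE mul0mx !mxE.
have [E uE rE] := unitmx_row d0.
(* E is invertible with first row the direction d of scaling; A parametrizes the affine
   subspace through u0 spanned by its other rows. *)
pose A : n.+1.-tuple {mpoly F[n.+1]} :=
  [tuple (u0 j)%:MP + \sum_(l | l != ord0) E l j *: 'X_l | j < n.+1].
have AE u j : (tnth A j).@[u] = u0 j + \sum_(l | l != ord0) E l j * u l.
  rewrite tnth_mktuple mevalD mevalC raddf_sum; congr (_ + _).
  by apply: eq_bigr => l _; rewrite /= mevalZ mevalXU.
pose h : M.-tuple {mpoly F[n.+1]} := [tuple 'X_ord0 * (tnth g k \mPo A) | k < M].
have hE u k : (tnth h k).@[u] = u ord0 * (tnth g k).@[fun j => (tnth A j).@[u]].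
  by rewrite tnth_mktuple mevalM mevalXU comp_mpoly_meval.
have hv u : param_vec h u = u ord0 *: param_vec g (fun j => (tnth A j).@[u]).
  by apply: coords_inj => k; rewrite coordsZ !coords_param hE.
(* h takes at b the value of g at u0 *)
pose b (i : 'I_n.+1) : F := (i == ord0)%:R.
have Jh : jac h b = E *m jac g u0.
  apply/row_matrixP => l; rewrite row_mul [in LHS]rowE; apply/rowP => k.
  rewrite jac_line; have [->|l0] := eqVneq l ord0.
    rewrite rE eul mxE.
    have -> : along (tnth h k) (fun i => (b i)%:P + (delta_mx 0 ord0 : 'rV_n.+1) 0 i *: 'X) =
       (1 + 'X) * ((tnth g k).@[u0])%:P.
      apply: poly_eq_points => t; rewrite horner_along hE hornerM hornerC !hornerE.
      rewrite mxE !eqxx mul1r; congr (_ * _); apply: meval_eq => j.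
      rewrite AE big1 ?addr0 // => i i0; rewrite !hornerE mxE /b (negbTE i0) /=.
      by rewrite mul0r addr0 mulr0.
    by rewrite derivM derivD derivX !derivC mulr0 addr0 add0r mul1r hornerC.
  rewrite jac_line; congr (_^`()).[0]; apply: poly_eq_points => t.
  rewrite !horner_along hE !hornerE mxE eq_sym (negbTE l0) /= /b eqxx mul0r addr0 mul1r.
  apply: meval_eq => j; rewrite AE (bigD1 l) //= big1 => [|i /andP[i0 il]].
    by rewrite !hornerE !mxE !eqxx /b (negbTE l0) /= add0r mul1r addr0.
  by rewrite !hornerE mxE /b (negbTE i0) (negbTE il) /= mul0r addr0 mulr0.
apply: (flag_chain (f := h) (v0 := b)) => //.
- have [B JB] := row_free_rinv Jg; apply/row_freeP; exists (B *m invmx E).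
  by rewrite Jh mulmxA -[E *m _ *m _]mulmxA JB mulmx1 mulmxV.
- move=> c u; rewrite !hv /scale_first eqxx scalerA; congr (_ *: _).
  apply: eq_bigr => k _; congr (_ *: _); apply: meval_eq => j; rewrite !AE.
  by congr (_ + _); apply: eq_bigr => l l0; rewrite (negbTE l0).
move=> u x xu; have u00 : u ord0 != 0.
  have [w wx w0] := mem_point x; apply: contraNneq w0 => u00.
  by move: wx; rewrite xu hv u00 scale0r => /vlineP[c ->]; rewrite scaler0.
apply: (imX (fun j => (tnth A j).@[u])); rewrite xu hv.
apply/eqP; rewrite eqEdim -memvE memvZ ?memv_line //= !dim_vline scaler_eq0.
by rewrite (negbTE u00).
Qed.

Lemma param_has_dim : has_dim X (N%:Z - 1).
Proof.
split; first by rewrite lerBrDl addrC subrr.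
move=> m; split => [/(chain_bound X_closure) H|H].
  by rewrite lerBrDl -intS lez_nat.
by apply: param_has_chain; move: H; rewrite lerBrDl -intS lez_nat.
Qed.
End HasDim.
End Cones.

(** * Apolarity and powers of linear forms *)

Section Apolarity.
Variables (F : fieldType) (charF : [pchar F] =i pred0) (n : nat).
Implicit Types (p q f g h : {poly F}) (s : F).

(** The duality between forms of degree n in the affine coordinates y = 1 and u = 1:
    the monomial X^k pairs with X^(n - k) to the inverse of a binomial coefficient. *)
Definition apolar p q : F := \sum_(k < n.+1) ('C(n, k)%:R)^-1 * (p`_k * q`_(n - k)).

Lemma natF_eq0 m : (m%:R == 0 :> F) = (m == 0%N).
Proof. by move/pcharf0P: charF => ->. Qed.

Lemma bin_neq0 k : (k <= n)%N -> 'C(n, k)%:R != 0 :> F.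
Proof. by move=> kn; rewrite natF_eq0 -lt0n bin_gt0. Qed.

Lemma apolar_sumr (I : Type) (r : seq I) (P : pred I) p (E : I -> {poly F}) :
  apolar p (\sum_(i <- r | P i) E i) = \sum_(i <- r | P i) apolar p (E i).
Proof.
rewrite exchange_big; apply: eq_bigr => k _ /=.
by rewrite coef_sum !mulr_sumr.
Qed.

Lemma apolar_suml (I : Type) (r : seq I) (P : pred I) q (E : I -> {poly F}) :
  apolar (\sum_(i <- r | P i) E i) q = \sum_(i <- r | P i) apolar (E i) q.
Proof.
rewrite exchange_big; apply: eq_bigr => k _ /=.
by rewrite coef_sum mulr_suml mulr_sumr.
Qed.

Lemma apolarZl c p q : apolar (c *: p) q = c * apolar p q.
Proof.
rewrite mulr_sumr; apply: eq_bigr => k _.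
by rewrite coefZ; ring.
Qed.

Lemma apolarZr c p q : apolar p (c *: q) = c * apolar p q.
Proof.
rewrite mulr_sumr; apply: eq_bigr => k _.
by rewrite coefZ; ring.
Qed.

Lemma apolar_Xnl i q : (i <= n)%N -> apolar 'X^i q = ('C(n, i)%:R)^-1 * q`_(n - i).
Proof.
move=> iN; rewrite /apolar (bigD1 (Ordinal (iN : i < n.+1)%N)) //= coefXn eqxx mul1r.
rewrite big1 ?addr0 // => k ki; rewrite coefXn; case: eqP => [e|_]; last by rewrite mul0r mulr0.
by case/eqP: ki; apply: val_inj.
Qed.

Lemma apolar_Xnr p j : (j <= n)%N -> apolar p 'X^j = ('C(n, j)%:R)^-1 * p`_(n - j).
Proof.
move=> jN; have lt : (n - j < n.+1)%N by rewrite ltnS leq_subr.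
rewrite /apolar (bigD1 (Ordinal lt)) //= subKn // coefXn eqxx mulr1 bin_sub //.
rewrite big1 ?addr0 // => k kj; rewrite coefXn; case: eqP => [e|_]; last by rewrite !mulr0.
case/eqP: kj; apply: val_inj => /=.
by rewrite -e subKn // -ltnS.
Qed.

Lemma poly_sum_coef p : (size p <= n.+1)%N -> p = \sum_(i < n.+1) p`_i *: 'X^i.
Proof.
move=> sp; rewrite -poly_def; apply/polyP => i; rewrite coef_poly.
by case: ltnP => // H; rewrite nth_default // (leq_trans sp H).
Qed.

Lemma coef_XaddC_exp (a : F) i k : (('X + a%:P) ^+ i)`_k = a ^+ (i - k) *+ 'C(i, k).
Proof.
rewrite exprDn_comm; last exact: mulrC.
rewrite coef_sum; have [ki|ik] := leqP k i; last first.
  rewrite bin_small // mulr0n big1 // => j _.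
  rewrite coefMn -polyC_exp coefMC coefXn; case: eqP => [e|_]; last by rewrite mul0r mul0rn.
  by move: ik; rewrite e ltnNge leq_subr.
have lt : (i - k < i.+1)%N by rewrite ltnS leq_subr.
rewrite (bigD1 (Ordinal lt)) //= big1 => [|j jk].
  by rewrite coefMn -polyC_exp coefMC coefXn subKn // eqxx mul1r addr0 bin_sub.
rewrite coefMn -polyC_exp coefMC coefXn; case: eqP => [e|_]; last by rewrite mul0r mul0rn.
by case/eqP: jk; apply: val_inj; rewrite /= e subKn // -ltnS ltn_ord.
Qed.

Lemma bin_exchange i j : (i <= n)%N -> (j <= n)%N ->
  ('C(n, i) * 'C(i, n - j) = 'C(n, j) * 'C(j, n - i))%N.
Proof.
move=> iN jN; have [nij|] := leqP (n - j) i; last first.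
  move=> H; have H' : (j < n - i)%N by lia.
  by rewrite (bin_small H) (bin_small H') !muln0.
have nji : (n - i <= j)%N by lia.
apply/eqP; rewrite -(eqn_pmul2r (fact_gt0 (n - j))) -(eqn_pmul2r (fact_gt0 (n - i))).
rewrite -(eqn_pmul2r (fact_gt0 (i - (n - j)))).
have e : (i - (n - j) = j - (n - i))%N.
  by lia.
have E a b : (a <= n)%N -> (n - b <= a)%N ->
    ('C(n, a) * 'C(a, n - b) * (n - b)`! * (n - a)`! * (a - (n - b))`! = n`!)%N.
  move=> an ba; have := bin_fact an; have := bin_fact ba.
  move: 'C(n, a) 'C(a, n - b) a`! (n - b)`! (a - (n - b))`! (n - a)`! n`! => x y z t u v w.
  by move=> <- <-; lia.
by apply/eqP; rewrite (E i j) // e -(E j i) //; lia.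
Qed.

(** Translation x -> x + a y is adjoint to the translation v -> v + a u.  It is checked
    on monomials, where it is an identity between products of binomials. *)
Lemma apolar_shift a p q : (size p <= n.+1)%N -> (size q <= n.+1)%N ->
  apolar (p \Po ('X + a%:P)) q = apolar p (q \Po ('X + a%:P)).
Proof.
move=> sp sq; rewrite {1}(poly_sum_coef sp) {2}(poly_sum_coef sq).
rewrite !linear_sum /= apolar_suml apolar_sumr.
under eq_bigr => i _.
  rewrite comp_polyZ comp_Xn_poly apolarZl {1}(poly_sum_coef sq) apolar_sumr mulr_sumr.
  under eq_bigr => j _ do rewrite apolarZr apolar_Xnr ?leq_ord // coef_XaddC_exp.
  over.
under [RHS]eq_bigr => j _.
  rewrite comp_polyZ comp_Xn_poly apolarZr {1}(poly_sum_coef sp) apolar_suml mulr_sumr.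
  under eq_bigr => i _ do rewrite apolarZl apolar_Xnl ?leq_ord // coef_XaddC_exp.
  over.
rewrite exchange_big; apply: eq_bigr => j _; apply: eq_bigr => i _ /=.
rewrite mulrCA; congr (_ * (_ * _)).
have iN := leq_ord i; have jN := leq_ord j.
rewrite -[a ^+ _ *+ 'C(i, _)]mulr_natr -[a ^+ _ *+ 'C(j, _)]mulr_natr.
have [nij|nij] := leqP (n - j) i; last first.
  have H' : (j < n - i)%N by lia.
  by rewrite (bin_small nij) (bin_small H') !mulr0.
have e : (i - (n - j) = j - (n - i))%N by lia.
rewrite e mulrCA [RHS]mulrCA; congr (_ * _).
rewrite ![_^-1 * _]mulrC; apply/eqP; rewrite eqr_div ?bin_neq0 // -!natrM.
by rewrite mulnC bin_exchange // mulnC.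
Qed.

Lemma apolar_shiftK a p q : (size p <= n.+1)%N -> (size q <= n.+1)%N ->
  apolar p q = apolar (p \Po ('X + a%:P)) (q \Po ('X - a%:P)).
Proof.
move=> sp sq; have szs : (size (q \Po ('X - a%:P)) <= n.+1)%N.
  by rewrite size_comp_poly2 ?size_XsubC.
rewrite apolar_shift // -comp_polyA comp_polyB comp_polyX comp_polyC addrK.
by rewrite comp_polyXr.
Qed.

Lemma XsubC_comp (a : F) : ('X - a%:P) \Po ('X + a%:P) = 'X.
Proof. by rewrite comp_polyB comp_polyX comp_polyC addrK. Qed.

Lemma XaddC_comp (a : F) : ('X + a%:P) \Po ('X - a%:P) = 'X.
Proof. by rewrite comp_polyD comp_polyX comp_polyC subrK. Qed.

Lemma size_exp_XaddC (a : F) k : size (('X + a%:P) ^+ k) = k.+1.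
Proof. by rewrite -[a]opprK polyCN size_exp_XsubC. Qed.

Lemma exp_XaddC_neq0 (a : F) k : ('X + a%:P) ^+ k != 0.
Proof. by rewrite -size_poly_gt0 size_exp_XaddC. Qed.

(** After translating s to 0 both factors are divisible by powers of X whose exponents
    add up to n + 1, and no product of coefficients is left in the pairing. *)
Lemma apolar_contact s m f h : (m <= n.+1)%N -> (size f <= n.+1)%N ->
  ('X - s%:P) ^+ m %| f -> (size h <= m)%N ->
  apolar f (('X + s%:P) ^+ (n.+1 - m) * h) = 0.
Proof.
move=> mn sf /dvdpP[f1 fE] sh; have [->|h0] := eqVneq h 0.
  by rewrite mulr0 /apolar big1 // => k _; rewrite coef0 !mulr0.
have m0 : (0 < m)%N by apply: leq_trans sh; rewrite size_poly_gt0.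
rewrite (apolar_shiftK s) //; last first.
  rewrite size_mul ?exp_XaddC_neq0 // size_exp_XaddC addSn /=.
  by apply: leq_trans (leq_add (leqnn _) sh) _; rewrite subnK.
rewrite fE !comp_polyM !rmorphXn /= XsubC_comp XaddC_comp.
apply: big1 => k _; rewrite coefMXn coefXnM.
have [km|km] := ltnP k m; first by rewrite mul0r mulr0.
by rewrite ifT ?mulr0 //; have := leq_ord k; lia.
Qed.

(** After translating s to 0, pairing with (X + s)^(n - k) extracts the coefficient of
    X^k. *)
Lemma contact_apolar s m f : (m <= n.+1)%N -> (size f <= n.+1)%N ->
  (forall h, (size h <= m)%N -> apolar f (('X + s%:P) ^+ (n.+1 - m) * h) = 0) ->
  ('X - s%:P) ^+ m %| f.
Proof.
move=> mn sf H.
suff : 'X^m %| f \Po ('X + s%:P).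
  case/dvdpP => f1 f1E; apply/dvdpP; exists (f1 \Po ('X - s%:P)).
  by rewrite -[LHS](comp_polyXaddC_K f s) f1E comp_polyM comp_Xn_poly.
have z k : (k < m)%N -> (f \Po ('X + s%:P))`_k = 0.
  move=> km; have := H (('X + s%:P) ^+ (m - k.+1)).
  rewrite size_exp_XaddC subnSK // leq_subr => /(_ isT).
  rewrite -exprD -comp_Xn_poly -apolar_shift //; last first.
    by rewrite size_polyXn; lia.
  have kn : (k <= n)%N by rewrite -ltnS (leq_trans km).
  have -> : (n.+1 - m + (m - k.+1) = n - k)%N by lia.
  rewrite apolar_Xnr ?leq_subr // subKn // => /eqP.
  by rewrite mulf_eq0 invr_eq0 (negbTE (bin_neq0 (leq_subr _ _))) => /eqP.
apply/dvdpP; exists (drop_poly m (f \Po ('X + s%:P))).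
rewrite -[LHS](poly_take_drop m) (_ : take_poly m _ = 0) ?add0r //.
by apply/polyP => i; rewrite coef_take_poly coef0; case: ifP => // /z.
Qed.

(** The pairing of two multiples of complementary powers of X has only one term. *)
Lemma apolar_lowest m p q : (m <= n)%N ->
  apolar (p * 'X^m) (q * 'X^(n - m)) = ('C(n, m)%:R)^-1 * (p`_0 * q`_0).
Proof.
move=> mn; rewrite /apolar (bigD1 (Ordinal (mn : m < n.+1)%N)) //=.
rewrite !coefMXn !ltnn !subnn big1 ?addr0 // => k km; rewrite !coefMXn.
have [//|mk] := ltnP k m; first by rewrite mul0r mulr0.
rewrite ifT ?mulr0 //; have := leq_ord k.
have : k != m :> nat by apply: contraNneq km => e; apply/eqP/val_inj.
lia.
Qed.

Section DualPowers.
Variables (I : finType) (s : I -> F) (mu : I -> nat).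
Hypothesis sum_mu : (\sum_i mu i <= n.+1)%N.
Hypothesis s_inj : forall i j, (0 < mu i)%N -> (0 < mu j)%N -> s i = s j -> i = j.

Let mu_n i : (mu i <= n.+1)%N.
Proof. by apply: leq_trans sum_mu; rewrite (bigD1 i) //= leq_addr. Qed.

Lemma size_prod_XsubC (P : pred I) :
  size (\prod_(i | P i) ('X - (s i)%:P) ^+ mu i) = (\sum_(i | P i) mu i).+1.
Proof.
rewrite size_prod => [|i _]; last by rewrite expf_neq0 ?polyXsubC_eq0.
under eq_bigr => i _ do rewrite size_exp_XsubC -addn1.
by rewrite big_split /= sum1_card subSn ?leq_addl // addnK.
Qed.

(** If k_j were nonzero, with order of vanishing r at -s_j, the form f below would be
    orthogonal to all the other terms by [apolar_contact], while its pairing with the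
    j-th term is the product of two nonzero lowest coefficients. *)
Lemma dual_powers_free (k : I -> {poly F}) : (forall i, size (k i) <= mu i)%N ->
  \sum_i ('X + (s i)%:P) ^+ (n.+1 - mu i) * k i = 0 -> forall i, k i = 0.
Proof.
move=> sk sum0 j; apply/eqP; apply: contraT => kj0.
have kap0 : k j \Po ('X - (s j)%:P) != 0 by rewrite comp_poly2_eq0 ?size_XsubC.
have skap : size (k j \Po ('X - (s j)%:P)) = size (k j) by rewrite size_comp_poly2 ?size_XsubC.
have [r [kap]] := multiplicity_XsubC (k j \Po ('X - (s j)%:P)) 0.
rewrite kap0 /= subr0 rootE horner_coef0 => kr kapE.
have rmu : (r < mu j)%N.
  have kap'0 : kap != 0 by apply: contraNneq kr => ->; rewrite coef0.
  apply: leq_trans (sk j); rewrite -skap kapE size_mulXn //.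
  by rewrite -addn1 leq_add2l size_poly_gt0.
pose m := ((mu j).-1 - r)%N.
have mn : (m <= n)%N by have := mu_n j; rewrite /m; lia.
pose R := \prod_(i | i != j) ('X - (s i)%:P) ^+ mu i.
(* f vanishes to order mu i at s i for i != j, but only to order m = mu j - 1 - r at s j,
   which complements the order n - m of the j-th term at - s j. *)
pose f := R * ('X - (s j)%:P) ^+ m.
have sf : (size f <= n.+1)%N.
  have R0 : R != 0 by rewrite -size_poly_gt0 size_prod_XsubC.
  rewrite /f size_mul ?expf_neq0 ?polyXsubC_eq0 // size_exp_XsubC size_prod_XsubC addnS /=.
  apply: leq_trans sum_mu; rewrite [X in (_ <= X)%N](bigD1 j) //=.
  by move: (\sum_(i | i != j) mu i)%N => S; rewrite /m; lia.
have := congr1 (apolar f) sum0; rewrite apolar_sumr (bigD1 j) //= big1 ?addr0; last first.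
  move=> i ij; apply: apolar_contact => //.
  by rewrite /f /R (bigD1 i) //= -!mulrA dvdp_mulr.
have -> : apolar f 0 = 0 by rewrite /apolar big1 // => l _; rewrite coef0 !mulr0.
rewrite (apolar_shiftK (s j)) //; last first.
  rewrite size_mul ?exp_XaddC_neq0 // size_exp_XaddC addSn /=.
  by apply: leq_trans (leq_add (leqnn _) (sk j)) _; rewrite subnK.
rewrite !comp_polyM kapE !rmorphXn /= XsubC_comp XaddC_comp mulrCA -exprD.
have -> : (n.+1 - mu j + r = n - m)%N by have := mu_n j; rewrite /m; lia.
rewrite apolar_lowest // => /eqP; rewrite !mulf_eq0 (negbTE kr) orbF.
rewrite invr_eq0 (negbTE (bin_neq0 mn)) /=.
rewrite -horner_coef0 horner_comp hornerD hornerX hornerC add0r horner_prod.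
case/idPn; apply/prodf_neq0 => i ij; rewrite horner_exp.
have [->|mi] := posnP (mu i); first by rewrite expr0 oner_eq0.
rewrite expf_neq0 // hornerXsubC subr_eq0; apply: contraNneq ij => e.
by apply/eqP; apply: s_inj => //; apply: leq_trans rmu.
Qed.

(** The annihilator of the multiples of prod_i (X - s_i)^(mu_i) is spanned by the
    multiples of the dual powers.  One inclusion is [apolar_contact]; the dimensions
    agree by [dual_powers_free]. *)
Lemma apolar_complement (G : {poly F}) : (size G <= n.+1)%N ->
  (forall h, (size (\prod_i ('X - (s i)%:P) ^+ mu i * h)%R <= n.+1)%N ->
     apolar (\prod_i ('X - (s i)%:P) ^+ mu i * h) G = 0) ->
  exists2 k : I -> {poly F}, (forall i, size (k i) <= mu i)%N &
    G = \sum_i ('X + (s i)%:P) ^+ (n.+1 - mu i) * k i.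
Proof.
move=> sG; set P := \prod_i _ => H.
have sP : size P = (\sum_i mu i).+1 by apply: size_prod_XsubC.
have P0 : P != 0 by rewrite -size_poly_gt0 sP.
pose r := (\sum_i mu i)%N; pose J := {i : I & 'I_(mu i)}.
have cJ : #|{: J}| = r by rewrite card_tagged sumnE big_map big_enum; apply: eq_bigr => i _; rewrite card_ord.
pose E (a : J) : {poly F} := ('X + (s (tag a))%:P) ^+ (n.+1 - mu (tag a)) * 'X^(tagged a).
have sE a : (size (E a) <= n.+1)%N.
  rewrite size_mul ?exp_XaddC_neq0 -?size_poly_gt0 ?size_polyXn // size_exp_XaddC addnS /=.
  have := ltn_ord (tagged a); have := mu_n (tag a); lia.
pose A := \matrix_(a < #|{: J}|) (poly_rV (E (enum_val a)) : 'rV_n.+1).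
pose kk (u : 'rV_(#|{: J}|)) i : {poly F} :=
  \sum_(b < mu i) u 0 (enum_rank (Tagged (fun i => 'I_(mu i)) b)) *: 'X^b.
have skk u i : (size (kk u i) <= mu i)%N.
  rewrite /kk; apply: (leq_trans (size_sum _ _ _)); apply/bigmax_leqP => b _.
  by apply: leq_trans (size_scale_leq _ _) _; rewrite size_polyXn.
have uA u : rVpoly (u *m A) = \sum_i ('X + (s i)%:P) ^+ (n.+1 - mu i) * kk u i.
  rewrite mulmx_sum_row linear_sum /=.
  transitivity (\sum_(a : J) u 0 (enum_rank a) *: E a).
    rewrite (reindex enum_rank) /=; last by exists enum_val => ? _; rewrite ?enum_valK ?enum_rankK.
    by apply: eq_bigr => a _; rewrite linearZ /= rowK enum_rankK poly_rV_K.
  rewrite (eq_bigr (fun i => \sum_(b < mu i)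
     u 0 (enum_rank (Tagged (fun i => 'I_(mu i)) b)) *: E (Tagged (fun i => 'I_(mu i)) b))).
    by rewrite sig_big_dep /=; apply: eq_bigr => -[i b] _.
  by move=> i _; rewrite mulr_sumr; apply: eq_bigr => b _; rewrite -scalerAr.
(* the rows of A span the multiples of the dual powers *)
have Afree : row_free A.
  rewrite -kermx_eq0; apply/rowV0P => u /sub_kermxP uA0.
  have := uA u; rewrite uA0 linear0 => /esym/(dual_powers_free (skk u)) k0.
  apply/rowP => a; rewrite mxE; have := k0 (tag (enum_val a)).
  move=> /(congr1 (fun p : {poly F} => p`_(tagged (enum_val a)))).
  rewrite coef0 coef_sum (bigD1 (tagged (enum_val a))) //= coefZ coefXn eqxx mulr1.
  rewrite big1 ?addr0 => [|b bne].
    by rewrite (_ : Tagged _ _ = enum_val a) ?enum_valK //; case: (enum_val a).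
  rewrite coefZ coefXn; case: eqP => [e|]; last by rewrite mulr0.
  by case/eqP: bne; apply: val_inj.
(* the kernel of B is the annihilator of the multiples of P *)
pose B := \matrix_(l < n.+1, c < n.+1 - r) apolar (P * 'X^c) 'X^l.
have gB (G' : {poly F}) : (size G' <= n.+1)%N -> forall c, (poly_rV G' *m B) 0 c = apolar (P * 'X^c) G'.
  move=> sG' c; rewrite {2}(poly_sum_coef sG') apolar_sumr mxE; apply: eq_bigr => l _.
  by rewrite !mxE apolarZr.
have sPX (c : 'I_(n.+1 - r)) : (size (P * 'X^c)%R <= n.+1)%N.
  by rewrite size_mul -?size_poly_gt0 ?size_polyXn ?sP // addnS /=; have := ltn_ord c; rewrite /r; lia.
have rB : \rank B = (n.+1 - r)%N.
  rewrite -mxrank_tr; apply/eqP; change (row_free B^T); rewrite -kermx_eq0; apply/rowV0P => v /sub_kermxP vB.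
  have V0 : P * rVpoly v = 0.
    apply/polyP => l; rewrite coef0; have [ln|ln] := leqP l n; last first.
      rewrite nth_default //; apply: leq_trans ln; apply: (leq_trans (size_polyMleq _ _)).
      rewrite sP addSn /=; apply: leq_trans (leq_add (leqnn _) (size_poly _ _)) _.
      by rewrite subnKC.
    have nl : (n - l < n.+1)%N by rewrite ltnS leq_subr.
    have := congr1 (fun M : 'rV_n.+1 => M 0 (Ordinal nl)) vB; rewrite !mxE.
    under eq_bigr do rewrite !mxE -apolarZl.
    rewrite -apolar_suml apolar_Xnr ?leq_subr //= subKn // => /eqP.
    rewrite mulf_eq0 invr_eq0 (negbTE (bin_neq0 (leq_subr _ _))) /= => /eqP e.
    rewrite -[RHS]e; congr (nth 0 (polyseq _) l); rewrite /rVpoly poly_def mulr_sumr; apply: eq_bigr => c _.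
    by rewrite insubT //= => lt; rewrite -scalerAr (_ : Sub _ _ = c) //; apply: val_inj.
  have rv0 : rVpoly v = 0.
    by move/eqP: V0; rewrite mulf_eq0 (negbTE P0) => /eqP.
  by rewrite -[v]rVpolyK rv0 linear0.
have AB : (A <= kermx B)%MS.
  apply/row_subP => a; apply/sub_kermxP; rewrite rowK; apply/rowP => c.
  rewrite gB // mxE /E; apply: apolar_contact => //; last by rewrite size_polyXn.
  by rewrite /P (bigD1 (tag (enum_val a))) //= -!mulrA dvdp_mulr.
have BA : (kermx B <= A)%MS.
  rewrite -(geq_leqif (mxrank_leqif_sup AB)) mxrank_ker rB.
  by rewrite (eqP Afree) cJ subKn.
have GB : (poly_rV G <= kermx B)%MS.
  by apply/sub_kermxP/rowP => c; rewrite gB // mxE; apply: H.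
have /submxP[u uE] := submx_trans GB BA.
exists (kk u) => //.
by rewrite -uA -uE poly_rV_K.
Qed.
End DualPowers.
End Apolarity.

(** * Binary forms as univariate polynomials *)

Section Dehomogenize.
Variables (F : fieldType) (n : nat).
Implicit Types (p : {mpoly F[2]}) (q : {poly F}) (f g : form F n).

Lemma mdeg_bimonomial k : (k <= n)%N -> mdeg (bimonomial n k) = n.
Proof.
move=> kn; rewrite mdegE big_ord_recl big_ord1 !mnmE eqxx.
by rewrite (_ : (lift _ _ == _) = false) // subnKC.
Qed.

Lemma bimonomial0 k : bimonomial n k ord0 = k.
Proof. by rewrite mnmE. Qed.

Lemma bimonomialE m : mdeg m = n -> m = bimonomial n (m ord0) /\ (m ord0 <= n)%N.
Proof.
rewrite mdegE big_ord_recl big_ord1 => mn; split; last by rewrite -mn leq_addr.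
apply/mnmP => i; rewrite mnmE; case: (unliftP ord0 i) => [j ->|->]; last by rewrite eqxx.
by rewrite (ord1 j) (_ : (lift _ _ == _) = false) // -mn addKn.
Qed.

Lemma homog_expand p : p \is n.-homog ->
  p = \sum_(k < n.+1) p@_(bimonomial n k) *: 'X_[bimonomial n k].
Proof.
move=> pn; apply/mpolyP => m; rewrite raddf_sum /=.
have [mn|mn] := eqVneq (mdeg m) n; last first.
  rewrite (dhomog_nemf_coeff pn mn) big1 // => k _.
  rewrite mcoeffZ mcoeffX; case: eqP => [e|]; last by rewrite mulr0.
  by move: mn; rewrite -e mdeg_bimonomial ?eqxx // leq_ord.
have [mE m0] := bimonomialE mn.
rewrite (bigD1 (Ordinal (m0 : m ord0 < n.+1)%N)) //= -mE mcoeffZ mcoeffX eqxx mulr1.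
rewrite big1 ?addr0 // => k km; rewrite mcoeffZ mcoeffX; case: eqP => [e|]; last by rewrite mulr0.
by case/eqP: km; apply: val_inj; rewrite /= -e bimonomial0.
Qed.

Definition dehom (i : 'I_2) p : {poly F} := mmap polyC (fun j => if j == i then 'X else 1) p.

HB.instance Definition _ i := GRing.RMorphism.copy (dehom i) (mmap polyC (fun j => if j == i then 'X else 1)).

Lemma dehomZ i c p : dehom i (c *: p) = c *: dehom i p.
Proof. by rewrite /dehom mmapZ mul_polyC. Qed.

Lemma dehomX0 k : dehom ord0 'X_[bimonomial n k] = 'X^k.
Proof.
rewrite /dehom mmapX /mmap1 big_ord_recl big_ord1 /= mnmE /=.
by rewrite expr1n mulr1.
Qed.

Lemma dehomX1 k : dehom ord_max 'X_[bimonomial n k] = 'X^(n - k).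
Proof.
rewrite /dehom mmapX /mmap1 big_ord_recl big_ord1 /= mnmE /=.
by rewrite expr1n mul1r mnmE.
Qed.

Lemma dehom0E p : p \is n.-homog -> dehom ord0 p = \poly_(k < n.+1) p@_(bimonomial n k).
Proof.
move=> pn; rewrite {1}(homog_expand pn) raddf_sum poly_def; apply: eq_bigr => k _ /=.
by rewrite dehomZ dehomX0.
Qed.

Lemma dehom1E p : p \is n.-homog -> dehom ord_max p = \poly_(k < n.+1) p@_(bimonomial n (n - k)).
Proof.
move=> pn; rewrite {1}(homog_expand pn) raddf_sum poly_def.
rewrite (reindex_inj rev_ord_inj); apply: eq_bigr => k _ /=.
by rewrite dehomZ dehomX1 subSS subKn // -ltnS.
Qed.

Definition homogenize q : {mpoly F[2]} := \sum_(k < n.+1) q`_k *: 'X_[bimonomial n k].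

Lemma homogenize_homog q : homogenize q \is n.-homog.
Proof.
by apply: rpred_sum => k _; rewrite rpredZ // dhomogX /= mdeg_bimonomial // leq_ord.
Qed.

Definition xform q : form F n := DHomog (homogenize_homog q).

Lemma form_homog f : form_poly f \is n.-homog.
Proof. exact: dhomog_is_dhomog. Qed.

Lemma form_inj f g : form_poly f = form_poly g -> f = g.
Proof. exact: val_inj. Qed.

Definition xpoly f := dehom ord0 (form_poly f).
Definition vpoly f := dehom ord_max (form_poly f).

Lemma size_xpoly f : (size (xpoly f) <= n.+1)%N.
Proof. by rewrite /xpoly dehom0E ?form_homog // size_poly. Qed.

Lemma size_vpoly f : (size (vpoly f) <= n.+1)%N.
Proof. by rewrite /vpoly dehom1E ?form_homog // size_poly. Qed.

Lemma xformK q : (size q <= n.+1)%N -> xpoly (xform q) = q.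
Proof.
move=> sq; rewrite [RHS](poly_sum_coef sq) /xpoly /= /homogenize raddf_sum.
by apply: eq_bigr => k _ /=; rewrite dehomZ dehomX0.
Qed.

Lemma xpolyK f : xform (xpoly f) = f.
Proof.
apply: form_inj; rewrite [RHS](homog_expand (form_homog f)).
by apply: eq_bigr => k _; rewrite /xpoly dehom0E ?form_homog // coef_poly ltn_ord.
Qed.

Lemma xpoly_inj : injective xpoly.
Proof. exact: can_inj xpolyK. Qed.

Lemma xpoly_is_linear : linear xpoly.
Proof. by move=> c f g; rewrite /xpoly raddfD /= dehomZ. Qed.
HB.instance Definition _ := GRing.isLinear.Build F (form F n) {poly F} _ xpoly xpoly_is_linear.

Lemma vpoly_is_linear : linear vpoly.
Proof. by move=> c f g; rewrite /vpoly raddfD /= dehomZ. Qed.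
HB.instance Definition _ := GRing.isLinear.Build F (form F n) {poly F} _ vpoly vpoly_is_linear.

Lemma xform_is_linear : linear xform.
Proof.
move=> c p q; apply: form_inj; rewrite /= scaler_sumr -big_split /=; apply: eq_bigr => k _.
by rewrite coefD coefZ scalerDl scalerA.
Qed.
HB.instance Definition _ := GRing.isLinear.Build F {poly F} (form F n) _ xform xform_is_linear.

(** Reversal of the coefficients, which exchanges the two ways to set a variable to 1. *)
Definition flip q := \poly_(k < n.+1) q`_(n - k).

Lemma flipK q : (size q <= n.+1)%N -> flip (flip q) = q.
Proof.
move=> sq; apply/polyP => k; rewrite coef_poly.
have [kn|kn] := ltnP k n.+1; first by rewrite coef_poly ltnS leq_subr subKn // -ltnS.
by rewrite nth_default // (leq_trans sq).
Qed.

Lemma flip_is_linear : linear flip.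
Proof.
move=> c p q; apply/polyP => k; rewrite coefD coefZ !coef_poly coefD coefZ.
by case: ifP; rewrite ?mulr0 ?addr0.
Qed.
HB.instance Definition _ := GRing.isLinear.Build F {poly F} {poly F} _ flip flip_is_linear.

(** Forms in u, v are read as polynomials in v, forms in x, y as polynomials in x; the
    linear form s u + v is then 'X + s. *)
Definition vform q : form F n := xform (flip q).
HB.instance Definition _ := GRing.Linear.copy vform (xform \o flip).

Lemma vpoly_flip f : vpoly f = flip (xpoly f).
Proof.
rewrite /vpoly /xpoly dehom1E ?form_homog // dehom0E ?form_homog //.
apply/polyP => k; rewrite !coef_poly; case: ifP => // _.
by rewrite ltnS leq_subr.
Qed.

Lemma vformK q : (size q <= n.+1)%N -> vpoly (vform q) = q.
Proof. by move=> sq; rewrite vpoly_flip xformK ?size_poly // flipK. Qed.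

Lemma vpolyK f : vform (vpoly f) = f.
Proof. by rewrite vpoly_flip /vform flipK ?size_xpoly // xpolyK. Qed.

Lemma vpoly_inj : injective vpoly.
Proof. exact: can_inj vpolyK. Qed.

Hypothesis charF : [pchar F] =i pred0.

(** In the affine coordinates the pairing of the duality between forms is [apolar]; the
    factorials of the differentiated monomials combine into inverse binomials. *)
Lemma pairingE f g : pairing f g = apolar n (xpoly f) (vpoly g).
Proof.
rewrite /pairing /diff_action raddf_sum /=.
pose G m := (form_poly g)@_m * ((form_poly f)^`M[m])@_0%MM.
rewrite (eq_bigr G); last by move=> m _; rewrite mcoeffZ.
have -> : \sum_(m <- msupp (form_poly g)) G m = \sum_(k < n.+1) G (bimonomial n k).
  (* the support of a form of degree n consists of the monomials of S *)
  pose S := [seq bimonomial n k | k <- iota 0 n.+1].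
  have uS : uniq S.
    rewrite map_inj_uniq ?iota_uniq // => a b e.
    by rewrite -(bimonomial0 a) e bimonomial0.
  rewrite -(big_mkord xpredT (fun k => G (bimonomial n k))) /index_iota subn0.
  rewrite -(big_map (bimonomial n) xpredT G) -/S.
  rewrite [RHS](bigID (fun m => m \in msupp (form_poly g))) /= [X in _ + X]big1 ?addr0; last first.
    by move=> m mg; rewrite /G memN_msupp_eq0 // mul0r.
  rewrite -[RHS]big_filter; apply: perm_big; apply: (uniq_perm (msupp_uniq _) (filter_uniq _ uS)) => m.
  rewrite mem_filter andb_idr // => mg.
  have [mE m0] := bimonomialE (dhomog_mf (form_homog g) mg).
  by rewrite mE; apply: map_f; rewrite mem_iota.
rewrite mulr_sumr; apply: eq_bigr => k _; rewrite /G mcoeff_mderivm addm0.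
rewrite /xpoly /vpoly dehom0E ?dehom1E ?form_homog // !coef_poly ltn_ord ltnS leq_subr.
have kn := leq_ord k; rewrite subKn // big_ord_recl big_ord1.
rewrite !mnmE /= !ffactnn -[_ *+ (_ * _)]mulr_natr.
have fN m : m`!%:R != 0 :> F by rewrite natF_eq0 // -lt0n fact_gt0.
have -> : n`!%:R = 'C(n, k)%:R * (k`!%:R * (n - k)`!%:R) :> F.
  by rewrite -!natrM bin_fact.
rewrite natrM; field.
by rewrite !fN bin_neq0.
Qed.
End Dehomogenize.

(** * Families of forms and their differentials *)

Section Directional.
Variables (F : fieldType) (N : nat) (v u : 'I_N -> F).
Implicit Types (p : {mpoly F[N]}) (P Q : {poly {mpoly F[N]}}).

Definition dirder p : F := \sum_l u l * (p^`M(l)).@[v].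

Lemma dirder_is_linear : linear_for *%R dirder.
Proof.
move=> c p q; rewrite /dirder mulr_sumr -big_split /=; apply: eq_bigr => l _.
by rewrite mderivD mderivZ mevalD mevalZ mulrDr mulrCA.
Qed.
HB.instance Definition _ := GRing.isLinear.Build F {mpoly F[N]} F *%R dirder dirder_is_linear.

Lemma dirderM p q : dirder (p * q) = dirder p * q.@[v] + p.@[v] * dirder q.
Proof.
rewrite /dirder mulr_suml mulr_sumr -big_split /=; apply: eq_bigr => l _.
by rewrite mderivM mevalD !mevalM; ring.
Qed.

Lemma dirderX l : dirder 'X_l = u l.
Proof.
rewrite /dirder (bigD1 l) //= mderivU eqxx meval1 mulr1 big1 ?addr0 // => k kl.
by rewrite mderivU eq_sym (negbTE kl) meval0 mulr0.
Qed.

Lemma dirderC c : dirder c%:MP = 0.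
Proof. by rewrite /dirder big1 // => l _; rewrite mderivC meval0 mulr0. Qed.

Definition evalp (P : {poly {mpoly F[N]}}) : {poly F} := map_poly (meval v) P.
HB.instance Definition _ := GRing.RMorphism.copy evalp (map_poly (meval v)).

(** Derivative in the parameters, coefficientwise; [evalp] is the value. *)
Definition derp (P : {poly {mpoly F[N]}}) : {poly F} := map_poly dirder P.

Lemma coef_derp P i : (derp P)`_i = dirder P`_i.
Proof. by rewrite coef_map_id0 ?raddf0. Qed.

Lemma coef_evalp P i : (evalp P)`_i = (P`_i).@[v].
Proof. exact: coef_map. Qed.

Lemma derpD P Q : derp (P + Q) = derp P + derp Q.
Proof. by apply/polyP => i; rewrite coefD !coef_derp coefD raddfD. Qed.

Lemma derp0 : derp 0 = 0.
Proof. by apply/polyP => i; rewrite coef_derp !coef0 raddf0. Qed.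

Lemma derp_sum (I : Type) (r : seq I) (A : pred I) (E : I -> {poly {mpoly F[N]}}) :
  derp (\sum_(i <- r | A i) E i) = \sum_(i <- r | A i) derp (E i).
Proof. by apply: big_morph; [exact: derpD|exact: derp0]. Qed.

Lemma derpC p : derp p%:P = (dirder p)%:P.
Proof. by apply/polyP => i; rewrite coef_derp !coefC; case: eqP; rewrite ?raddf0. Qed.

Lemma derpX : derp 'X = 0.
Proof.
apply/polyP => i; rewrite coef_derp coefX coef0; case: eqP => _; last by rewrite raddf0.
by rewrite -[X in dirder X]mpolyC1 dirderC.
Qed.

Lemma evalpC p : evalp p%:P = (p.@[v])%:P.
Proof. exact: map_polyC. Qed.

Lemma evalpX : evalp 'X = 'X.
Proof. exact: map_polyX. Qed.

Lemma evalp_XsubC p : evalp ('X - p%:P) = 'X - (p.@[v])%:P.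
Proof. by rewrite rmorphB /= evalpX evalpC. Qed.

Lemma evalp_XaddC p : evalp ('X + p%:P) = 'X + (p.@[v])%:P.
Proof. by rewrite rmorphD /= evalpX evalpC. Qed.

Lemma derpM P Q : derp (P * Q) = derp P * evalp Q + evalp P * derp Q.
Proof.
apply/polyP => i; rewrite coef_derp !coefD !coefM raddf_sum -big_split /=.
apply: eq_bigr => j _.
by rewrite dirderM !coef_derp !coef_evalp.
Qed.

Lemma derp1 : derp 1 = 0.
Proof. by rewrite -[X in derp X]/(1%:P) derpC -mpolyC1 dirderC. Qed.

Lemma derp_exp P k : derp (P ^+ k) = (evalp P ^+ k.-1 * derp P) *+ k.
Proof.
elim: k => [|k IH]; first by rewrite expr0 derp1 mulr0n.
rewrite exprS derpM IH /= rmorphXn; case: k {IH} => [|k].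
  by rewrite !expr0 mulr1 mul1r mulr0n mulr0 addr0.
rewrite /= mulrnAr mulrA -exprS [derp P * _]mulrC.
by rewrite [RHS]mulrS.
Qed.

Lemma derp_prod (I : eqType) (r : seq I) (E : I -> {poly {mpoly F[N]}}) : uniq r ->
  derp (\prod_(i <- r) E i) =
  \sum_(i <- r) derp (E i) * \prod_(j <- r | j != i) evalp (E j).
Proof.
elim: r => [|x r IH] /=; first by rewrite !big_nil derp1.
case/andP=> xr ur; rewrite !big_cons derpM IH // rmorph_prod eqxx /=.
have Ex : \prod_(j <- r | j != x) evalp (E j) = \prod_(j <- r) evalp (E j).
  rewrite big_seq_cond [RHS]big_seq; apply: eq_bigl => j.
  by rewrite andb_idr // => jr; apply: contraNneq xr => <-.
rewrite Ex; congr (_ + _); rewrite mulr_sumr [LHS]big_seq [RHS]big_seq.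
apply: eq_bigr => i ir; rewrite big_cons ifT; first by rewrite mulrCA.
by apply: contraNneq xr => ->.
Qed.

Lemma size_derp P : (size (derp P) <= size P)%N.
Proof. exact: size_poly. Qed.

Lemma size_evalp P : (size (evalp P) <= size P)%N.
Proof. exact: size_poly. Qed.
End Directional.

Section Family.
Variables (F : fieldType) (n N : nat) (T : {linear {poly F} -> form F n}).
Local Notation M := (\dim {: form F n}).
Variable Q : {poly {mpoly F[N]}}.
Hypothesis sQ : (size Q <= n.+1)%N.

(** The tuple of coordinate functions, so that the results on polynomial maps apply to
    forms whose coefficients depend on parameters. *)
Definition family : M.-tuple {mpoly F[N]} :=
  [tuple \sum_(j < n.+1) coords (T 'X^j) k *: Q`_j | k < M].

Lemma param_family v : param_vec family v = T (evalp v Q).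
Proof.
apply: coords_inj => k; rewrite coords_param tnth_mktuple raddf_sum /=.
have -> : evalp v Q = \sum_(j < n.+1) (Q`_j).@[v] *: 'X^j.
  rewrite [LHS](@poly_sum_coef F n) ?(leq_trans (size_evalp _ _)) //.
  by apply: eq_bigr => j _; rewrite coef_evalp.
rewrite linear_sum /coords linear_sum; apply: eq_bigr => j _.
by rewrite !linearZ /= mulrC.
Qed.

Lemma jac_family v (u : 'rV_N) k :
  (u *m jac family v) 0 k = coords (T (derp v (fun l => u 0 l) Q)) k.
Proof.
have -> : derp v (fun l => u 0 l) Q = \sum_(j < n.+1) dirder v (fun l => u 0 l) Q`_j *: 'X^j.
  rewrite [LHS](@poly_sum_coef F n) ?(leq_trans (size_derp _ _ _)) //.
  by apply: eq_bigr => j _; rewrite coef_derp.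
rewrite linear_sum /coords linear_sum mxE.
under eq_bigr => l _.
  rewrite mxE tnth_mktuple (raddf_sum (mderiv l)) raddf_sum mulr_sumr.
  under eq_bigr => j _ do rewrite /= mderivZ mevalZ.
  over.
rewrite exchange_big; apply: eq_bigr => j _ /=.
rewrite !linearZ /= /dirder mulr_suml; apply: eq_bigr => l _.
by rewrite /coords; ring.
Qed.

Hypothesis T_inj : forall q : {poly F}, (size q <= n.+1)%N -> T q = 0 -> q = 0.

Lemma family_row_free v :
  (forall u, derp v u Q = 0 -> forall l, u l = 0) -> row_free (jac family v).
Proof.
move=> H; rewrite -kermx_eq0; apply/rowV0P => u /sub_kermxP uJ.
apply/rowP => l; rewrite mxE; apply: (H (fun l => u 0 l)).
apply: T_inj; first exact: leq_trans (size_derp _ _ _) sQ.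
apply: coords_inj => k; rewrite -jac_family uJ mxE.
by rewrite -(scale0r 0) coordsZ mul0r.
Qed.
End Family.

(** * Explicit parametrizations and their differentials *)

Section Partition.
Variables (n : nat) (la : seq nat) (hla : is_partition n la).
Local Notation I := 'I_(size la).
Implicit Types i j : I.

Lemma part_gt0 i : (0 < part i)%N.
Proof. by case/and3P: hla => _ /allP la1 _; apply: la1; apply: mem_nth. Qed.

Lemma sum_part : (\sum_(i : I) part i = n)%N.
Proof.
case/and3P: hla => _ _ /eqP <-; rewrite sumnE (big_nth 0%N) big_mkord.
by apply: eq_bigr.
Qed.

Lemma part_le i : (part i <= n)%N.
Proof. by rewrite -sum_part (bigD1 i) //= leq_addr. Qed.

(** A part equal to 1 gives no parameter of the formula; with multiplicity 0 it can stay
    in all the sums and products. *)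
Definition big_part i : nat := if part i == 1%N then 0%N else part i.

Lemma big_part_gt0 i : (0 < big_part i)%N = (part i != 1%N).
Proof. by rewrite /big_part; case: eqP => // _; rewrite part_gt0. Qed.

Lemma big_partE i : part i != 1%N -> big_part i = part i.
Proof. by rewrite /big_part => /negbTE->. Qed.

Lemma sum_big_part : (\sum_(i : I) big_part i + count_mem 1%N la = n)%N.
Proof.
have -> : count_mem 1%N la = (\sum_(i : I) (part i == 1%N))%N.
  rewrite -sum1_count big_mkcond (big_nth 0%N) big_mkord.
  by apply: eq_bigr => i _; rewrite /part /=; case: eqP.
rewrite -big_split -[RHS]sum_part; apply: eq_bigr => i _ /=.
by rewrite /big_part; case: eqP => [->|_]; rewrite ?addn0.
Qed.

Lemma sum_big_part_le : (\sum_(i : I) big_part i <= n)%N.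
Proof. by rewrite -[X in (_ <= X)%N]sum_big_part leq_addr. Qed.

Lemma sum_pred_part : (\sum_(i : I) (part i).-1 + size la = n)%N.
Proof.
have e : (\sum_(i < size la) 1)%N = size la by rewrite sum1_card card_ord.
rewrite -[X in (_ + X)%N = _]e -big_split -[RHS]sum_part; apply: eq_bigr => i _ /=.
by rewrite addn1 prednK ?part_gt0.
Qed.

Section Roots.
Variables (F : fieldType) (charF : [pchar F] =i pred0).

Definition root_poly (R : comNzRingType) (c : R) (a : I -> R) : {poly R} :=
  c%:P * \prod_i ('X - (a i)%:P) ^+ part i.

Lemma size_root_poly (R : idomainType) (c : R) a : (size (root_poly c a) <= n.+1)%N.
Proof.
rewrite /root_poly mul_polyC; apply: leq_trans (size_scale_leq _ _) _.
rewrite size_prod => [|i _]; last by rewrite expf_neq0 ?polyXsubC_eq0.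
under eq_bigr => i _ do rewrite size_exp_XsubC -addn1.
by rewrite big_split /= sum1_card subSn ?leq_addl // addnK sum_part.
Qed.

(** The first parameter is the leading coefficient, the others are the roots. *)
Definition root_family_poly : {poly {mpoly F[(size la).+1]}} :=
  root_poly 'X_ord0 (fun i => 'X_(lift ord0 i)).

Implicit Types (v u : 'I_(size la).+1 -> F).
Local Notation roots v := (fun i : I => v (lift ord0 i)).

Lemma size_root_family : (size root_family_poly <= n.+1)%N.
Proof. exact: size_root_poly. Qed.

Lemma eval_root_family v : evalp v root_family_poly = root_poly (v ord0) (roots v).
Proof.
rewrite /root_family_poly /root_poly rmorphM /= rmorph_prod evalpC mevalXU.
congr (_ * _); apply: eq_bigr => i _.
by rewrite rmorphXn /= evalp_XsubC mevalXU.
Qed.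

Definition tangent_factor (a : I -> F) : {poly F} := \prod_i ('X - (a i)%:P) ^+ (part i).-1.

(** The logarithmic derivative, with the common factor taken out. *)
Definition tangent_cofactor v u : {poly F} :=
  (u ord0)%:P * \prod_i ('X - (v (lift ord0 i))%:P)
  - (v ord0)%:P * \sum_i (u (lift ord0 i) * (part i)%:R)%:P * \prod_(j | j != i) ('X - (v (lift ord0 j))%:P).

Lemma derp_root_family v u :
  derp v u root_family_poly = tangent_factor (roots v) * tangent_cofactor v u.
Proof.
rewrite /root_family_poly /root_poly derpM evalpC mevalXU derpC dirderX.
rewrite derp_prod ?index_enum_uniq // rmorph_prod /tangent_cofactor mulrBr; congr (_ + _).
  rewrite mulrCA; congr (_ * _); rewrite -big_split; apply: eq_bigr => i _ /=.
  rewrite rmorphXn /= evalp_XsubC mevalXU -exprSr prednK //; exact: part_gt0.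
rewrite mulrCA -mulrN; congr (_ * _); rewrite mulr_sumr -sumrN; apply: eq_bigr => i _.
rewrite derp_exp derpD derpX add0r -mulNr.
have -> : derp v u (- ('X_(lift ord0 i))%:P) = - (u (lift ord0 i))%:P.
  by rewrite -polyCN derpC raddfN /= dirderX polyCN.
rewrite evalp_XsubC mevalXU.
rewrite /tangent_factor [in RHS](bigD1 i) //= -[_ *+ part i]mulr_natr.
have -> : \prod_(j | j != i) evalp v (('X - ('X_(lift ord0 j))%:P) ^+ part j) =
   \prod_(j | j != i) ('X - (v (lift ord0 j))%:P) ^+ (part j).-1 *
   \prod_(j | j != i) ('X - (v (lift ord0 j))%:P).
  rewrite -big_split; apply: eq_bigr => j _ /=.
  by rewrite rmorphXn /= evalp_XsubC mevalXU -exprSr prednK ?part_gt0.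
rewrite polyCM polyC_natr; ring.
Qed.

Lemma horner_tangent_cofactor v u i :
  (tangent_cofactor v u).[v (lift ord0 i)] =
  - (v ord0 * (u (lift ord0 i) * (part i)%:R * \prod_(j | j != i) (v (lift ord0 i) - v (lift ord0 j)))).
Proof.
rewrite /tangent_cofactor hornerD hornerN !hornerM !hornerC horner_prod (bigD1 i) //=.
rewrite hornerXsubC subrr mul0r mulr0 add0r; congr (- (_ * _)).
rewrite horner_sum (bigD1 i) //= hornerM hornerC horner_prod [X in _ + X]big1 ?addr0 => [|j ji].
  by congr (_ * _); apply: eq_bigr => j _; rewrite hornerXsubC.
by rewrite hornerM horner_prod (bigD1 i) ?[i == j]eq_sym //= hornerXsubC subrr mul0r mulr0.
Qed.

Lemma part_neq0F i : (part i)%:R != 0 :> F.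
Proof. by rewrite natF_eq0 // -lt0n part_gt0. Qed.

Lemma prod_diff_neq0 (a : I -> F) i : injective a -> \prod_(j | j != i) (a i - a j) != 0.
Proof.
move=> a_inj; apply/prodf_neq0 => j ji; rewrite subr_eq0.
by apply: contraNneq ji => /a_inj->.
Qed.

(** The value of the cofactor at the i-th root is a nonzero multiple of the variation of
    that root. *)
Lemma root_family_immersion v : v ord0 != 0 -> injective (roots v) ->
  forall u, derp v u root_family_poly = 0 -> forall l, u l = 0.
Proof.
move=> v0 vinj u; rewrite derp_root_family => /eqP; rewrite mulf_eq0.
have -> /= : (tangent_factor (roots v) == 0) = false.
  by apply/negbTE/prodf_neq0 => i _; rewrite expf_neq0 ?polyXsubC_eq0.
move=> /eqP c0; have ul i : u (lift ord0 i) = 0.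
  have := horner_tangent_cofactor v u i; rewrite c0 horner0 => /esym/eqP.
  rewrite oppr_eq0 !mulf_eq0 (negbTE v0) (negbTE (part_neq0F i)) orbF /=.
  by rewrite (negbTE (@prod_diff_neq0 (roots v) i vinj)) orbF => /eqP.
move=> l; case: (unliftP ord0 l) => [i ->|->] //.
move: c0; rewrite /tangent_cofactor [X in _ - _ * X]big1 => [|i _].
  rewrite mulr0 subr0 => /eqP; rewrite mulf_eq0 polyC_eq0 => /orP[/eqP//|].
  by case/idPn; apply/prodf_neq0 => i _; rewrite polyXsubC_eq0.
by rewrite ul mul0r polyC0 mul0r.
Qed.

(** Lagrange interpolation: the variations of the roots are chosen to match the values of
    h at the roots, and the variation of c its leading coefficient. *)
Lemma root_family_tangent v (h : {poly F}) : v ord0 != 0 -> injective (roots v) ->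
  (size h <= (size la).+1)%N ->
  exists u, derp v u root_family_poly = tangent_factor (roots v) * h.
Proof.
move=> v0 vinj sh; pose d := size la.
pose al i := - h.[v (lift ord0 i)] /
   (v ord0 * ((part i)%:R * \prod_(j | j != i) (v (lift ord0 i) - v (lift ord0 j)))).
pose u (l : 'I_d.+1) : F := oapp al h`_d (unlift ord0 l).
have uS i : u (lift ord0 i) = al i by rewrite /u liftK.
have u0 : u ord0 = h`_d by rewrite /u unlift_none.
exists u; rewrite derp_root_family; congr (_ * _); apply/eqP; rewrite -subr_eq0.
set D := _ - h; have sprod (A : pred I) :
    size (\prod_(i | A i) ('X - (v (lift ord0 i))%:P)) = #|A|.+1.
  rewrite size_prod => [|i _]; last by rewrite polyXsubC_eq0.
  under eq_bigr do rewrite size_XsubC.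
  by rewrite sum_nat_const muln2 -addnn -addSn addnK.
have sD : (size D <= d)%N.
  have -> : D = ((h`_d)%:P * \prod_i ('X - (v (lift ord0 i))%:P) - h) -
     (v ord0)%:P * \sum_i (u (lift ord0 i) * (part i)%:R)%:P * \prod_(j | j != i) ('X - (v (lift ord0 j))%:P).
    by rewrite /D /tangent_cofactor u0 addrAC.
  apply: leq_trans (size_polyD _ _) _; rewrite geq_max size_polyN; apply/andP; split.
    have sP : size (\prod_i ('X - (v (lift ord0 i))%:P)) = d.+1 by rewrite sprod card_ord.
    apply/leq_sizeP => l; rewrite leq_eqVlt coefB mul_polyC coefZ => /orP[/eqP <-|dl].
      have : \prod_i ('X - (v (lift ord0 i))%:P) \is monic.
        by apply: monic_prod => i _; apply: monicXsubC.
      by rewrite monicE lead_coefE sP /= => /eqP ->; rewrite mulr1 subrr.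
    rewrite [h`_l]nth_default ?(leq_trans sh) // [X in _ * X]nth_default ?sP //.
    by rewrite mulr0 subrr.
  rewrite mul_polyC; apply: leq_trans (size_scale_leq _ _) _.
  apply: leq_trans (size_sum _ _ _) _; apply/bigmax_leqP => i _.
  rewrite mul_polyC; apply: leq_trans (size_scale_leq _ _) _.
  by rewrite sprod cardC1 card_ord prednK // (leq_trans _ (ltn_ord i)).
apply: contraT => D0.
(* the difference has degree below the number of roots and vanishes at all of them *)
have := max_poly_roots D0 (rs := [seq v (lift ord0 i) | i : I]).
rewrite size_map -cardE card_ord map_inj_uniq // enum_uniq => /(_ _ isT).
rewrite ltnNge sD; apply; apply/allP => _ /mapP[i _ ->].
rewrite rootE hornerD hornerN horner_tangent_cofactor uS /al subr_eq0; apply/eqP.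
field; rewrite v0 part_neq0F /=.
by rewrite (@prod_diff_neq0 (roots v) i vinj).
Qed.

Lemma size_tangent_factor a : (size (tangent_factor a) + size la)%N = n.+1.
Proof.
by rewrite /tangent_factor size_prod_XsubC addSn sum_pred_part.
Qed.
End Roots.

Section Dual.
Variables (F : fieldType) (charF : [pchar F] =i pred0).

(** The formula of the theorem at t = 1. *)
Definition dual_poly (R : comNzRingType) (s : I -> R) (g : I -> {poly R}) : {poly R} :=
  \sum_(i | part i != 1%N) ('X + (s i)%:P) ^+ (n - part i + 2) * g i.

Lemma dual_exponent i : part i != 1%N -> (n - part i + 2 = n.+1 - (part i).-1)%N.
Proof. by move=> _; have := part_le i; have := part_gt0 i; lia. Qed.

Lemma tangent_exponent i : ((n - part i + 2).-1 = n.+1 - part i)%N.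
Proof. by have := part_le i; have := part_gt0 i; lia. Qed.

Lemma size_dual_term (R : idomainType) (s : R) (g : {poly R}) i :
  part i != 1%N -> (size g <= (part i).-1)%N ->
  (size (('X + s%:P) ^+ (n - part i + 2) * g)%R <= n.+1)%N.
Proof.
move=> i1 sg; apply: leq_trans (size_polyMleq _ _) _.
rewrite -[s]opprK polyCN size_exp_XsubC addSn /=.
apply: leq_trans (leq_add (leqnn _) sg) _.
by have := part_le i; have := part_gt0 i; lia.
Qed.

Lemma size_dual_poly (R : idomainType) (s : I -> R) (g : I -> {poly R}) :
  (forall i, part i != 1%N -> (size (g i) <= (part i).-1)%N) -> (size (dual_poly s g) <= n.+1)%N.
Proof.
move=> sg; apply: leq_trans (size_sum _ _ _) _; apply/bigmax_leqP => i i1.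
by apply: size_dual_term (sg i i1).
Qed.

(** The parameters: (i, 0) is s_i, and (i, b.+1) is the coefficient of degree b of g_i. *)
Definition dual_index := {i : I & 'I_(big_part i)}.
Local Notation N := #|{: dual_index}|.

Lemma card_dual_index : (N + count_mem 1%N la = n)%N.
Proof.
rewrite -[RHS]sum_big_part card_tagged sumnE big_map big_enum; congr (_ + _)%N.
by apply: eq_bigr => i _; rewrite card_ord.
Qed.

(** Parameters with an index out of range are 0, so that g_i can be written as a
    polynomial without bounds. *)
Definition entry (R : zmodType) (w : 'I_N -> R) (i : I) (b : nat) : R :=
  if insub b is Some b' then w (enum_rank (Tagged (fun i => 'I_(big_part i)) (b' : 'I_(big_part i)))) else 0.

Lemma entry_val (R : zmodType) (w : 'I_N -> R) (a : dual_index) :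
  entry w (tag a) (tagged a) = w (enum_rank a).
Proof. by rewrite /entry valK; congr (w (enum_rank _)); case: a. Qed.

Definition sval_of (R : zmodType) (w : 'I_N -> R) i := entry w i 0.
Definition gval_of (R : nzRingType) (w : 'I_N -> R) i : {poly R} :=
  \poly_(b < (part i).-1) entry w i b.+1.

Definition encode (s : I -> F) (g : I -> {poly F}) (l : 'I_N) : F :=
  let a := enum_val l in
  if tagged a == 0%N :> nat then s (tag a) else (g (tag a))`_(tagged a).-1.

Lemma sval_encode s (g : I -> {poly F}) i : part i != 1%N -> sval_of (encode s g) i = s i.
Proof.
move=> i1; rewrite /sval_of /entry insubT ?big_part_gt0 // => lt.
by rewrite /encode enum_rankK /=.
Qed.

Lemma gval_encode s (g : I -> {poly F}) i : part i != 1%N -> (size (g i) <= (part i).-1)%N ->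
  gval_of (encode s g) i = g i.
Proof.
move=> i1 sg; apply/polyP => b; rewrite coef_poly; case: ltnP => b1; last first.
  by rewrite nth_default // (leq_trans sg).
rewrite /entry insubT => [|lt]; last by rewrite /encode enum_rankK.
by rewrite big_partE // -(prednK (part_gt0 i)) ltnS.
Qed.

Lemma size_gval (R : nzRingType) (w : 'I_N -> R) i : (size (gval_of w i) <= (part i).-1)%N.
Proof. exact: size_poly. Qed.

Definition dual_family_poly : {poly {mpoly F[N]}} :=
  dual_poly (sval_of (fun l => 'X_l)) (gval_of (fun l => 'X_l)).

Lemma size_dual_family : (size dual_family_poly <= n.+1)%N.
Proof. by apply: size_dual_poly => i _; apply: size_gval. Qed.

Implicit Types (v u : 'I_N -> F).

Lemma meval_entry v i b : (entry (fun l => 'X_l) i b).@[v] = entry v i b.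
Proof. by rewrite /entry; case: insub => [?|]; rewrite ?mevalXU ?meval0. Qed.

Lemma dirder_entry v u i b : dirder v u (entry (fun l => 'X_l) i b) = entry u i b.
Proof. by rewrite /entry; case: insub => [?|]; rewrite ?dirderX ?raddf0. Qed.

Lemma eval_gval v i : evalp v (gval_of (fun l => 'X_l) i) = gval_of v i.
Proof.
apply/polyP => b; rewrite coef_evalp !coef_poly; case: ifP => _; last by rewrite meval0.
exact: meval_entry.
Qed.

Lemma derp_gval v u i : derp v u (gval_of (fun l => 'X_l) i) = gval_of u i.
Proof.
apply/polyP => b; rewrite coef_derp !coef_poly; case: ifP => _; last by rewrite raddf0.
exact: dirder_entry.
Qed.

Lemma eval_dual_family v : evalp v dual_family_poly = dual_poly (sval_of v) (gval_of v).
Proof.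
rewrite rmorph_sum; apply: eq_bigr => i _.
by rewrite rmorphM rmorphXn /= evalp_XaddC meval_entry eval_gval.
Qed.

(** The factor left in the variation of the i-th term after (X + s_i)^(n - part i + 1) is
    taken out. *)
Definition tangent_part v u i : {poly F} :=
  ('X + (sval_of v i)%:P) * gval_of u i + (sval_of u i * (n - part i + 2)%:R)%:P * gval_of v i.

Lemma derp_dual_family v u : derp v u dual_family_poly =
  \sum_(i | part i != 1%N) ('X + (sval_of v i)%:P) ^+ (n.+1 - part i) * tangent_part v u i.
Proof.
rewrite derp_sum; apply: eq_bigr => i i1.
rewrite derpM derp_exp derpD derpX add0r derpC dirder_entry derp_gval eval_gval.
rewrite rmorphXn /= evalp_XaddC meval_entry tangent_exponent.
rewrite addrC /tangent_part mulrDr.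
have -> : (n - part i + 2 = (n.+1 - part i).+1)%N by rewrite -tangent_exponent addn2.
rewrite exprS /sval_of -[_ *+ (n.+1 - part i).+1]mulr_natr polyCM polyC_natr; congr (_ + _); ring.
Qed.

Lemma size_tangent_part v u i : part i != 1%N -> (size (tangent_part v u i) <= part i)%N.
Proof.
move=> i1; have p1 : (1 < part i)%N by have := part_gt0 i; lia.
apply: leq_trans (size_polyD _ _) _; rewrite geq_max; apply/andP; split.
  apply: leq_trans (size_polyMleq _ _) _; rewrite size_XaddC /=.
  by apply: leq_ltn_trans (size_gval _ _) _; rewrite prednK // part_gt0.
rewrite mul_polyC; apply: leq_trans (size_scale_leq _ _) _.
by apply: leq_trans (size_gval _ _) (leq_pred _).
Qed.

(** The parameters at which the formula will be seen to be an immersion. *)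
Definition good v := (forall i j, part i != 1%N -> part j != 1%N -> sval_of v i = sval_of v j -> i = j)
  /\ (forall i, part i != 1%N -> (gval_of v i).[- sval_of v i] != 0).

Lemma exponent_neq0 i : (n - part i + 2)%:R != 0 :> F.
Proof. by rewrite natF_eq0 // addn2. Qed.

Lemma big_sum_neq1 (s : I -> F) (k : I -> {poly F}) :
  \sum_(i | part i != 1%N) ('X + (s i)%:P) ^+ (n.+1 - part i) * k i =
  \sum_i ('X + (s i)%:P) ^+ (n.+1 - big_part i) * (if part i != 1%N then k i else 0).
Proof.
rewrite big_mkcond; apply: eq_bigr => i _; case: ifP => i1; last by rewrite mulr0.
by rewrite big_partE.
Qed.

(** The independence of the dual powers isolates each term, and at X = -s_i its vanishing
    forces the variation of s_i to vanish, as g_i(-s_i) is not 0. *)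
Lemma dual_family_immersion v : good v ->
  forall u, derp v u dual_family_poly = 0 -> forall l, u l = 0.
Proof.
case=> sinj gs u; rewrite derp_dual_family big_sum_neq1 => D0.
have T0 i : part i != 1%N -> tangent_part v u i = 0.
  move=> i1.
  have sI j j' : (0 < big_part j)%N -> (0 < big_part j')%N -> sval_of v j = sval_of v j' -> j = j'.
    by rewrite !big_part_gt0; apply: sinj.
  have sz j : (size (if part j != 1%N then tangent_part v u j else 0%R) <= big_part j)%N.
    case: ifP => j1; last by rewrite size_poly0.
    by rewrite big_partE // size_tangent_part.
  by have := dual_powers_free charF (leqW sum_big_part_le) sI sz D0 i; rewrite i1.
have su i : part i != 1%N -> sval_of u i = 0.
  (* only the term with the variation of s_i survives at - s_i *)
  move=> i1; have : (tangent_part v u i).[- sval_of v i] = 0 by rewrite T0 ?horner0.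
  rewrite hornerD !hornerM hornerD hornerX !hornerC addNr mul0r add0r => /eqP.
  rewrite !mulf_eq0 (negbTE (gs i i1)) (negbTE (exponent_neq0 i)) !orbF.
  by move/eqP.
have gu i : part i != 1%N -> gval_of u i = 0.
  move=> i1; have := T0 i i1; rewrite /tangent_part su // mul0r polyC0 mul0r addr0 => /eqP.
  by rewrite mulf_eq0 -[sval_of v i]opprK polyCN polyXsubC_eq0 => /eqP.
move=> l; pose a := enum_val l; have bp := ltn_ord (tagged a).
have i1 : part (tag a) != 1%N by rewrite -big_part_gt0 (leq_trans _ bp).
have ul b : b = tagged a :> nat -> entry u (tag a) b = u l.
  by move=> ->; rewrite entry_val enum_valK.
case e : (nat_of_ord (tagged a)) => [|b].
  by rewrite -(ul 0%N) //; exact: su i1.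
rewrite -(ul b.+1) //; have /polyP/(_ b) := gu _ i1; rewrite coef_poly coef0 ifT //.
by move: bp; rewrite e big_partE // -{1}(prednK (part_gt0 (tag a))) ltnS.
Qed.
End Dual.
End Partition.

(** * Conormal forms, and parameters recovered from tangent spaces *)

Section Matching.
Variables (n : nat) (la : seq nat) (hla : is_partition n la).
Variables (F : fieldType) (charF : [pchar F] =i pred0).
Local Notation I := 'I_(size la).
Implicit Types (i j : I) (s : I -> F) (g : I -> {poly F}) (f h G : {poly F}).

Definition inj_big s := forall i j, part i != 1%N -> part j != 1%N -> s i = s j -> i = j.
Definition sized g := forall i, part i != 1%N -> (size (g i) <= (part i).-1)%N.

Lemma apolar_dual f s g : sized g -> (size f <= n.+1)%N ->
  (forall i, ('X - (s i)%:P) ^+ (part i).-1 %| f) -> apolar n f (dual_poly n s g) = 0.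
Proof.
move=> sg sf H; rewrite /dual_poly apolar_sumr big1 // => i i1.
rewrite (dual_exponent hla i1); apply: apolar_contact => //; last exact: sg.
exact: leq_trans (leq_pred _) (leqW (part_le hla i)).
Qed.

Lemma tangent_factor_dvd s i h : ('X - (s i)%:P) ^+ (part i).-1 %| tangent_factor s * h.
Proof. by rewrite /tangent_factor (bigD1 i) //= -mulrA dvdp_mulr. Qed.

(** The tangent space consists of the multiples of the tangent factor, so its annihilator
    is described by [apolar_complement] with mu_i = part i - 1. *)
Lemma conormal_dual v G : v ord0 != 0 -> injective (fun i : I => v (lift ord0 i)) ->
  (size G <= n.+1)%N -> (forall u, apolar n (derp v u (root_family_poly la F)) G = 0) ->
  exists2 g, sized g & G = dual_poly n (fun i => v (lift ord0 i)) g.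
Proof.
move=> v0 vinj sG H; set s := fun i => _.
have sum_mu : (\sum_(i : I) (part i).-1 <= n.+1)%N.
  by have := sum_pred_part hla; lia.
have s_inj i j : (0 < (part i).-1)%N -> (0 < (part j).-1)%N -> s i = s j -> i = j.
  by move=> _ _ /vinj.
have [h sh|k sk GE] := apolar_complement charF sum_mu s_inj sG.
  have sh' : (size h <= (size la).+1)%N.
    have [->|h0] := eqVneq h 0; first by rewrite size_poly0.
    have st := size_tangent_factor hla s.
    have t0 : tangent_factor s != 0.
      by rewrite -size_poly_gt0 -(ltn_add2r (size la)) st add0n ltnS -(sum_pred_part hla) leq_addl.
    move: sh; rewrite -/(tangent_factor s) size_mul // => sh.
    by rewrite -(leq_add2l (size (tangent_factor s))) addnS st (leq_trans (leqSpred _)).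
  (* every multiple of the tangent factor of degree at most n is a tangent vector *)
  have [u uE] := root_family_tangent hla charF v0 vinj sh'.
  by have := H u; rewrite uE.
exists k => [i _|]; first exact: sk.
rewrite GE /dual_poly (bigID (fun i => part i != 1%N)) /= [X in _ + X]big1 ?addr0.
  by apply: eq_bigr => i i1; rewrite (dual_exponent hla i1).
move=> i /negPn/eqP i1; have := sk i; rewrite i1 leqn0 size_poly_eq0 => /eqP->.
by rewrite mulr0.
Qed.

Lemma dual_poly_inj s g g' : inj_big s -> sized g -> sized g' ->
  dual_poly n s g = dual_poly n s g' -> forall i, part i != 1%N -> g i = g' i.
Proof.
move=> s_inj sg sg' /eqP; rewrite -subr_eq0 -sumrB => /eqP E i i1.
pose k i := if part i != 1%N then g i - g' i else 0.
have sum_mu : (\sum_(i : I) (big_part i).-1 <= n.+1)%N.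
  apply: leq_trans (leqW (sum_big_part_le hla)); apply: leq_sum => j _; exact: leq_pred.
have sI j j' : (0 < (big_part j).-1)%N -> (0 < (big_part j').-1)%N -> s j = s j' -> j = j'.
  move=> pj pj'; apply: s_inj; rewrite -(big_part_gt0 hla); [move: pj|move: pj']; lia.
have sz j : (size (k j) <= (big_part j).-1)%N.
  rewrite /k; case: ifP => j1; last by rewrite size_poly0.
  rewrite big_partE //; apply: leq_trans (size_polyD _ _) _; rewrite size_polyN geq_max.
  by rewrite sg ?sg'.
have E' : \sum_j ('X + (s j)%:P) ^+ (n.+1 - (big_part j).-1) * k j = 0.
  rewrite -[RHS]E [RHS]big_mkcond; apply: eq_bigr => j _; rewrite /k; case: ifP => j1; last by rewrite mulr0.
  by rewrite big_partE // -(dual_exponent hla j1) mulrBr.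
have := dual_powers_free charF sum_mu sI sz E' i; rewrite /k i1 => /eqP.
by rewrite subr_eq0 => /eqP.
Qed.

(** The i-th term of the differential is
    (X + s_i)^(n + 1 - part i) * ((X + s_i) * u_g + e * u_s * g_i); since g_i(-s_i) is
    not 0, the second factor takes all values. *)
Lemma dual_family_tangent v i h : good v -> part i != 1%N -> (size h <= part i)%N ->
  exists u, derp v u (dual_family_poly n la F) = ('X + (sval_of v i)%:P) ^+ (n.+1 - part i) * h.
Proof.
move=> [sinj gs] i1 sh; set s := sval_of v i; set g := gval_of v i.
have g0 : g.[- s] != 0 by apply: gs.
pose e : F := (n - part i + 2)%:R; have e0 : e != 0 by apply: exponent_neq0.
(* the variation of s_i that makes h - sg * e * g_i divisible by X + s_i *)
pose sg := h.[- s] / (e * g.[- s]).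
have /factor_theorem[ga gaE] : root (h - (sg * e)%:P * g) (- s).
  rewrite rootE hornerD hornerN hornerM hornerC /sg subr_eq0; apply/eqP.
  by rewrite -[_ * e * _]mulrA divfK // mulf_neq0.
have p1 : (1 < part i)%N by have := part_gt0 hla i; lia.
have sga : (size ga <= (part i).-1)%N.
  have [->|ga0] := eqVneq ga 0; first by rewrite size_poly0.
  have : (size (ga * ('X - (- s)%:P))%R <= part i)%N.
    rewrite -gaE; apply: leq_trans (size_polyD _ _) _; rewrite geq_max sh size_polyN /=.
    rewrite mul_polyC; apply: leq_trans (size_scale_leq _ _) _.
    exact: leq_trans (size_gval _ _) (leq_pred _).
  by rewrite size_mul ?polyXsubC_eq0 // size_XsubC addn2 /= => H; rewrite -ltnS prednK ?(part_gt0 hla).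
pose ss j := if j == i then sg else 0; pose gg j := if j == i then ga else 0.
have sgg : sized gg.
  by move=> j j1; rewrite /gg; case: eqP => [->//|_]; rewrite size_poly0.
exists (encode ss gg); rewrite (derp_dual_family hla) (bigD1 i) //= big1 ?addr0 => [|j /andP[j1 ji]].
  congr (_ * _); rewrite /tangent_part (sval_encode hla) // (gval_encode hla) ?sgg //.
  rewrite /ss /gg eqxx -/s -/g -/e mulrC -[s]opprK polyCN -gaE -/g.
  by rewrite subrK.
rewrite /tangent_part (sval_encode hla) // (gval_encode hla) ?sgg // /ss /gg (negbTE ji).
by rewrite mul0r mulr0 polyC0 mul0r addr0 mulr0.
Qed.

Definition big_roots s : {poly F} := \prod_(j | part j != 1%N) ('X - (s j)%:P) ^+ part j.

(** The form prod_j (X - s_j)^(part j) is orthogonal to the image of the differential at v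
    by [apolar_contact], and [contact_apolar] reads off its divisibility from that. *)
Lemma tangent_contact v (s : F) i : part i != 1%N ->
  (forall h, (size h <= part i)%N ->
     exists u, derp v u (dual_family_poly n la F) = ('X + s%:P) ^+ (n.+1 - part i) * h) ->
  ('X - s%:P) ^+ part i %| big_roots (sval_of v).
Proof.
move=> i1 H; have sB : (size (big_roots (sval_of v)) <= n.+1)%N.
  rewrite /big_roots size_prod => [|j _]; last by rewrite expf_neq0 ?polyXsubC_eq0.
  under eq_bigr => j _ do rewrite size_exp_XsubC -addn1.
  rewrite big_split /= sum1_card subSn ?leq_addl // addnK ltnS.
  by rewrite -[X in (_ <= X)%N](sum_part hla) [X in (_ <= X)%N](bigID (fun j => part j != 1%N)) leq_addr.
apply: (contact_apolar charF (leqW (part_le hla i)) sB) => h sh.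
have [u <-] := H h sh; rewrite (derp_dual_family hla) apolar_sumr big1 // => j j1.
apply: apolar_contact => //; first exact: leqW (part_le hla j).
  by rewrite /big_roots (bigD1 j) //= dvdp_mulr.
exact: size_tangent_part.
Qed.

Lemma contact_root s (c : F) a : inj_big s -> (0 < a)%N -> ('X - c%:P) ^+ a %| big_roots s ->
  exists j, [/\ part j != 1%N, s j = c & (a <= part j)%N].
Proof.
move=> s_inj a0 aB.
have [j j1 jc] : exists2 j, part j != 1%N & s j = c.
  have : root (big_roots s) c.
    rewrite -dvdp_XsubCl; apply: dvdp_trans aB.
    by rewrite -(prednK a0) exprS dvdp_mulr.
  rewrite /root /big_roots horner_prod prodf_seq_eq0 => /hasP[j _ /andP[j1]].
  rewrite horner_exp hornerXsubC expf_eq0 => /andP[_]; rewrite subr_eq0 => /eqP e.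
  by exists j.
exists j; split => //.
move: aB; rewrite /big_roots (bigD1 j) //= jc Gauss_dvdpl; last first.
  rewrite coprimep_expl // coprimep_sym coprimep_XsubC rootE horner_prod.
  apply/prodf_neq0 => i /andP[i1 ij]; rewrite horner_exp expf_neq0 // hornerXsubC subr_eq0.
  by apply: contraNneq ij => ci; apply/eqP/s_inj => //; rewrite jc.
by rewrite dvdp_Pexp2l // size_XsubC.
Qed.

(** Each root of s' is a root of s of at least the same multiplicity; as the total
    multiplicities agree, all these inequalities are equalities. *)
Lemma matching s s' : inj_big s -> inj_big s' ->
  (forall i, part i != 1%N -> ('X - (s' i)%:P) ^+ part i %| big_roots s) ->
  exists sg : {perm I}, [/\ forall i, part (sg i) = part i,
     forall i, part i = 1%N -> sg i = i & forall i, part i != 1%N -> s' i = s (sg i)].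
Proof.
move=> s_inj s_inj' H.
have /fin_all_exists[f fP] i : exists j, [/\ (part i <= part j)%N, part i = 1%N -> j = i &
    part i != 1%N -> part j != 1%N /\ s j = s' i].
  have [i1|i1] := eqVneq (part i) 1%N; first by exists i.
  have [j [j1 jE ij]] := contact_root s_inj (part_gt0 hla i) (H i i1).
  by exists j; split => // /eqP; rewrite (negbTE i1).
have finj : injective f.
  move=> i j fij; have [_ i1 i2] := fP i; have [_ j1 j2] := fP j.
  have [ei|ei] := eqVneq (part i) 1%N; have [ej|ej] := eqVneq (part j) 1%N.
  - by rewrite -(i1 ei) -(j1 ej).
  - by case: (j2 ej); rewrite -fij i1 // ei.
  - by case: (i2 ei); rewrite fij j1 // ej.
  by apply: s_inj' => //; rewrite -(i2 ei).2 -(j2 ej).2 fij.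
exists (perm finj); split => i; rewrite permE.
(* f only increases the parts and permutes them *)
- have le j : xpredT j -> (part j <= part (f j) ?= iff (part j == part (f j)))%N.
    by have [fj _ _] := fP j; split.
  have [_] := leqif_sum le; rewrite [X in (_ == X)](_ : _ = (\sum_(j : I) part j)%N).
    by rewrite eqxx => /esym/forallP/(_ i)/eqP.
  by rewrite [RHS](reindex_inj finj).
- by have [] := fP i.
- by move=> i1; have [_ _ /(_ i1)[_ ->]] := fP i.
Qed.
End Matching.

(** * Tangent spaces of parametrized cones *)

(** D is a subspace given without generators; rows of maximal rank in it generate it, and
    reduce the statement to the duality of [cokermx]. *)
Lemma double_annihilator (F : fieldType) M (D : 'rV[F]_M -> Prop) (phi : 'rV_M) :
  D 0 -> (forall c r r', D r -> D r' -> D (c *: r + r')) ->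
  (forall h : 'cV_M, (forall r, D r -> r *m h = 0) -> phi *m h = 0) -> D phi.
Proof.
move=> D0 Dlin H.
pose P (A : {m & 'M[F]_(m, M)}) := forall i, D (row i (tagged A)).
have [|[m A] PA maxA] := @min_measure _ P (fun A => M - \rank (tagged A))%N.
  by exists (Tagged (fun m => 'M_(m, M)) (0 : 'M_(0, M))) => -[].
have Dsum k (B : 'M_(k, M)) u : (forall i, D (row i B)) -> D (u *m B).
  move=> DB; rewrite mulmx_sum_row; elim/big_rec: _ => // i r _ Dr.
  exact: Dlin.
have DA r : D r -> (r <= A)%MS.
  (* a new row in D cannot increase the maximal rank *)
  move=> Dr; have Pcol : P (Tagged (fun m => 'M_(m, M)) (col_mx r A)).
    move=> i; rewrite /=; case: (split_ordP i) => j ->.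
      by rewrite rowKu (ord1 j) row_id.
    by rewrite rowKd; apply: PA.
  have le := maxA _ Pcol.
  have le' : (\rank (col_mx r A) <= \rank A)%N.
    by have := rank_leq_col (col_mx r A); move: le => /=; lia.
  have sA : (A <= col_mx r A)%MS by rewrite -addsmxE addsmxSr.
  have : (col_mx r A <= A)%MS by rewrite -(geq_leqif (mxrank_leqif_sup sA)).
  by rewrite col_mx_sub => /andP[].
have : phi *m cokermx A = 0.
  apply/row_matrixP => i; apply/matrixP => a b; rewrite (ord1 a).
  have -> : row i (phi *m cokermx A) 0 b = (phi *m col b (cokermx A)) 0 0.
    by rewrite (ord1 i) row_id colE mulmxA -colE [in RHS]mxE.
  rewrite H => [|r /DA]; first by rewrite !mxE.
  by rewrite submxE colE mulmxA => /eqP->; rewrite mul0mx.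
move/eqP; rewrite -submxE => /submxP[u ->]; exact: Dsum.
Qed.

Section Tangent.
Variables (F : fieldType) (infF : infinite_field F) (W : vectType F).
Hypothesis charF : [pchar F] =i pred0.
Local Notation M := (\dim {:W}).
Variables (N : nat) (f : M.-tuple {mpoly F[N]}) (X : point_set W).
Hypothesis f_conic : forall c v, exists v', param_vec f v' = c *: param_vec f v.
Hypothesis image_X : forall v x, val x = <[param_vec f v]>%VS -> X x.
Hypothesis X_closure : sub_pset X (in_image_closure f).
Implicit Types (x : proj W) (w h : W) (p : {mpoly F[M]}).

Definition dpoly p w h : F := \sum_k (p^`M(k)).@[coords w] * coords h k.

Definition tangent_cond w h := forall p, p \mPo f = 0 -> dpoly p w h = 0.

Lemma dhomog_mderiv n (p : {mpoly F[n]}) d i : p \is d.-homog -> p^`M(i) \is d.-1.-homog.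
Proof.
move=> pd; apply/dhomogP => m; rewrite mcoeff_msupp mcoeff_deriv => H.
have : (m + U_(i))%MM \in msupp p.
  by rewrite mcoeff_msupp; apply: contraNneq H => ->; rewrite mul0rn.
by move/(dhomog_mf pd) => <-; rewrite /= mdegD mdeg1 addn1.
Qed.

Lemma dpoly_scale p d w h c : p \is d.-homog -> dpoly p (c *: w) h = c ^+ d.-1 * dpoly p w h.
Proof.
move=> pd; rewrite mulr_sumr; apply: eq_bigr => k _; rewrite mulrA; congr (_ * _).
rewrite -(meval_homog _ _ (dhomog_mderiv k pd)); apply: meval_eq => i.
exact: coordsZ.
Qed.

Lemma dpoly_sum (I : Type) (r : seq I) (P : pred I) (E : I -> {mpoly F[M]}) w h :
  dpoly (\sum_(i <- r | P i) E i) w h = \sum_(i <- r | P i) dpoly (E i) w h.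
Proof.
rewrite exchange_big; apply: eq_bigr => k _ /=.
by rewrite (raddf_sum (mderiv k)) raddf_sum mulr_suml.
Qed.

Lemma param_homog_vanish p d x : X x -> p \is d.-homog -> (forall y, X y -> vanishes_at p y) -> p \mPo f = 0.
Proof.
move=> Xx pd pX; apply: (mpoly_eq0_points infF) => v; rewrite -meval_param.
have [->|f0] := eqVneq (param_vec f v) 0.
  by apply: (vanishes_cone pd (pX x Xx)); rewrite mem0v.
have [y yE] := point_of f0.
by apply: (vanishes_cone pd (pX y (image_X yE))); rewrite yE memv_line.
Qed.

Lemma pihomog_comp p d : p \mPo f = 0 -> pihomog mdeg d p \mPo f = 0.
Proof.
move=> pf; apply: (mpoly_eq0_points infF) => v; rewrite -meval_param.
apply: (pihomog_vanish infF) => c _; have [v' v'E] := f_conic c v.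
rewrite (meval_eq (v2 := coords (param_vec f v'))); first by rewrite meval_param pf meval0.
by move=> i; rewrite v'E coordsZ.
Qed.

(** The tangent space may be computed at any nonzero vector of the line, and with
    equations that need not be homogeneous, as their components are equations too. *)
Lemma tangentP x w h : X x -> w \in val x -> w != 0 ->
  (forall p, homogeneous_poly p -> (forall y, X y -> vanishes_at p y) ->
    \sum_i (p^`M(i)).@[hcoords x] * coords h i = 0) <-> tangent_cond w h.
Proof.
move=> Xx wx w0; have [c wE] := mem_line (memv_pick (val x)) (vpick_point x) wx.
have c0 : c != 0 by apply: contraNneq w0 => c0; rewrite wE c0 scale0r.
split => [H p pf|H p [d pd] pX].
  rewrite (pihomog_partitionE (leqnn (msize p))) dpoly_sum big1 // => d _.
  rewrite wE (dpoly_scale _ _ _ (pihomogP mdeg d p)) [X in _ * X]H ?mulr0 //.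
    by exists d; apply: pihomogP.
  by move=> y Xy; apply: cone_vanishes; apply: X_closure Xy _ (pihomog_comp d pf).
have := H p (param_homog_vanish Xx pd pX).
rewrite wE (dpoly_scale _ _ _ pd) => /eqP; rewrite mulf_eq0 expf_eq0 (negbTE c0) andbF.
by move/eqP.
Qed.

Lemma jac_dpoly p v h (u : 'rV_N) : p \mPo f = 0 ->
  (forall k, coords h k = (u *m jac f v) 0 k) -> dpoly p (param_vec f v) h = 0.
Proof.
move=> pf hE; rewrite /dpoly.
under eq_bigr => k _ do rewrite hE mxE mulr_sumr.
rewrite exchange_big big1 //= => l _.
transitivity (u 0 l * (((p \mPo f)^`M(l)).@[v])); last by rewrite pf mderiv0 meval0 mulr0.
rewrite mderiv_comp raddf_sum mulr_sumr; apply: eq_bigr => k _.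
rewrite /= mevalM mxE mulrCA comp_mpoly_meval; congr (_ * (_ * _)).
by apply: meval_eq => i; rewrite coords_param.
Qed.

Lemma jac_tangent v h (u : 'rV_N) :
  (forall k, coords h k = (u *m jac f v) 0 k) -> tangent_cond (param_vec f v) h.
Proof. by move=> hE p pf; apply: jac_dpoly hE. Qed.

Definition vec_of_row (r : 'rV[F]_M) : W := \sum_k r 0 k *: (vbasis {:W})`_k.

Lemma coords_vec_of_row r k : coords (vec_of_row r) k = r 0 k.
Proof. exact: coords_sum. Qed.

Definition row_of_vec w : 'rV[F]_M := \row_k coords w k.

(** The image of the differential is contained in the tangent space and has dimension N,
    which bounds the dimension of the tangent space. *)
Lemma tangent_is_image (B : 'M[F]_(M, N)) v :
  (forall h : 'rV_M, (forall p, p \mPo f = 0 -> \sum_k (p^`M(k)).@[coords (param_vec f v)] * h 0 k = 0) ->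
     h *m B = 0 -> h = 0) ->
  row_free (jac f v) -> forall h, tangent_cond (param_vec f v) h ->
  exists u : 'rV_N, forall k, coords h k = (u *m jac f v) 0 k.
Proof.
move=> HB Jf h hT.
have HB' r : tangent_cond (param_vec f v) (vec_of_row r) -> r *m B = 0 -> r = 0.
  move=> rT; apply: HB => p pf; rewrite -[RHS](rT p pf); apply: eq_bigr => k _.
  by rewrite coords_vec_of_row.
(* the image of the differential injects by B, like the tangent space *)
have JB : jac f v *m B \in unitmx.
  rewrite -row_free_unit -kermx_eq0; apply/rowV0P => u /sub_kermxP; rewrite mulmxA => uJB.
  have uJ : u *m jac f v = 0.
    apply: HB' uJB; apply: (@jac_tangent _ _ u) => k; exact: coords_vec_of_row.
  by apply/eqP; rewrite -(mulmx_free_eq0 _ Jf) uJ.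
pose u := row_of_vec h *m B *m invmx (jac f v *m B); exists u => k.
apply/eqP; rewrite -subr_eq0; apply/eqP.
have : row_of_vec h - u *m jac f v = 0.
  apply: HB'; last by rewrite mulmxBl -mulmxA /u mulmxKV // subrr.
  move=> p pf; rewrite /dpoly.
  under eq_bigr => l _ do rewrite coords_vec_of_row 3!mxE mulrBr.
  rewrite sumrB; have := hT p pf; rewrite /dpoly => ->; rewrite sub0r.
  have := @jac_dpoly p v (vec_of_row (u *m jac f v)) u pf (coords_vec_of_row _).
  rewrite /dpoly; under eq_bigr do rewrite coords_vec_of_row.
  move=> E; apply/eqP; rewrite oppr_eq0; apply/eqP; rewrite -[RHS]E.
  done.
by move/rowP/(_ k); rewrite !mxE.
Qed.

Lemma vec_of_row_is_linear : linear vec_of_row.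
Proof.
move=> c r r'; apply: coords_inj => k.
by rewrite coordsD coordsZ !coords_vec_of_row !mxE.
Qed.
HB.instance Definition _ := GRing.isLinear.Build F 'rV[F]_M W _ vec_of_row vec_of_row_is_linear.

Lemma vec_of_row_inj : injective vec_of_row.
Proof. by move=> r r' e; apply/rowP => k; rewrite -!coords_vec_of_row e. Qed.

Lemma tangent_space_param (B : 'M[F]_(M, N)) v x :
  (forall h : 'rV_M, (forall p, p \mPo f = 0 -> \sum_k (p^`M(k)).@[coords (param_vec f v)] * h 0 k = 0) ->
     h *m B = 0 -> h = 0) ->
  row_free (jac f v) -> param_vec f v != 0 -> val x = <[param_vec f v]>%VS ->
  exists T : {vspace W}, [/\ is_tangent_space X x T, \dim T = N &
    forall h, h \in T -> exists u : 'rV_N, forall k, coords h k = (u *m jac f v) 0 k].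
Proof.
move=> HB Jf f0 xE; set J := jac f v.
pose b := [tuple vec_of_row (row i J) | i < N].
have sumE (c : 'I_N -> F) : \sum_i c i *: b`_i = vec_of_row ((\row_i c i) *m J).
  rewrite mulmx_sum_row linear_sum; apply: eq_bigr => i _.
  by rewrite -tnth_nth tnth_mktuple mxE linearZ.
have inT h : h \in <<b>>%VS -> exists u : 'rV_N, forall k, coords h k = (u *m J) 0 k.
  move=> hb; exists (\row_i coord b i h) => k.
  by rewrite {1}(coord_span hb) sumE coords_vec_of_row.
exists <<b>>%VS; split => //.
  move=> h; have Xx : X x by apply: image_X xE.
  rewrite (tangentP h Xx (w := param_vec f v)) ?xE ?memv_line //; split.
    by case/inT => u uE; apply: jac_tangent uE.
  case/(tangent_is_image HB Jf) => u uE.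
  have -> : h = \sum_i u 0 i *: b`_i.
    apply: coords_inj => k; rewrite sumE coords_vec_of_row uE; congr ((_ *m _) 0 k).
    by apply/rowP => i; rewrite mxE.
  by apply: memv_suml => i _; rewrite memvZ // memv_span // mem_nth ?size_tuple.
have fb : free b.
  apply/freeP => c; rewrite sumE => /eqP; rewrite -(linear0 vec_of_row) => /eqP/vec_of_row_inj/eqP.
  by rewrite mulmx_free_eq0 // => /eqP/rowP e i; have := e i; rewrite !mxE.
by have := eqP fb; rewrite size_tuple.
Qed.
End Tangent.

(** * The multiple root locus *)

Lemma natr_inj (F : fieldType) (charF : [pchar F] =i pred0) : injective (fun k : nat => k%:R : F).
Proof.
move=> a b; wlog ab : a b / (a <= b)%N.
  by move=> H e; case/orP: (leq_total a b) => h; [|symmetry]; apply: H.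
move=> /eqP; rewrite eq_sym -subr_eq0 -natrB // natF_eq0 // subn_eq0 => ba.
by apply/eqP; rewrite eqn_leq ab ba.
Qed.

Lemma char0_infinite (F : fieldType) (charF : [pchar F] =i pred0) : infinite_field F.
Proof.
move=> s; pose r := [seq (k%:R : F) | k <- iota 0 (size s).+1].
have ur : uniq r by rewrite map_inj_uniq ?iota_uniq //; apply: natr_inj.
have /allPn[x _ xs] : ~~ all (mem s) r.
  apply/negP => /allP H; have := uniq_leq_size ur H.
  by rewrite size_map size_iota ltnn.
by exists x.
Qed.

Section RootLocus.
Variables (F : fieldType) (charF : [pchar F] =i pred0).
Variables (n : nat) (la : seq nat) (hla : is_partition n la).
Local Notation I := 'I_(size la).
Local Notation W := (form F n).
Local Notation M := (\dim {: form F n}).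
Local Notation X := (@multiple_root_locus F n la).
Let infF := char0_infinite charF.

Lemma xform_eq0 (q : {poly F}) : (size q <= n.+1)%N -> xform n q = 0 -> q = 0.
Proof. by move=> sq q0; rewrite -(xformK sq) q0 linear0. Qed.

Lemma vform_eq0 (q : {poly F}) : (size q <= n.+1)%N -> vform n q = 0 -> q = 0.
Proof. by move=> sq q0; rewrite -(vformK sq) q0 linear0. Qed.

Definition root_family := family (@xform F n) (root_family_poly la F).

Lemma param_root v : param_vec root_family v = xform n (root_poly (v ord0) (fun i : I => v (lift ord0 i))).
Proof. by rewrite param_family ?size_root_family // eval_root_family. Qed.

Definition distinct_roots (v : 'I_(size la).+1 -> F) :=
  v ord0 != 0 /\ injective (fun i : I => v (lift ord0 i)).

Lemma root_family_free v : distinct_roots v -> row_free (jac root_family v).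
Proof.
case=> v0 vinj; apply: family_row_free; [exact: size_root_family|exact: xform_eq0|].
by move=> u; apply: (root_family_immersion hla charF v0 vinj).
Qed.

Lemma root_family_conic c v : exists v', param_vec root_family v' = c *: param_vec root_family v.
Proof.
exists (fun l => if l == ord0 then c * v l else v l); rewrite !param_root /=.
by rewrite -linearZ /root_poly -mul_polyC mulrA -polyCM.
Qed.

Lemma homog_prod_powers (ell : I -> {mpoly F[2]}) : (forall i, ell i \is 1.-homog) ->
  \prod_i ell i ^+ part i \is n.-homog.
Proof.
move=> H; rewrite -[X in X.-homog](sum_part hla).
elim/big_rec2: _ => [|i a p _ IH]; first exact: dhomog1.
by apply: dhomogM IH; rewrite -[X in X.-homog]mul1n; apply: dhomogMn.
Qed.

(** Values at c = 0 are not points, so the equation of the line forces c to be nonzero and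
    the form is a product of powers of linear forms up to scaling. *)
Lemma root_family_image v x : val x = <[param_vec root_family v]>%VS -> X x.
Proof.
set c := v ord0; pose a (i : I) := v (lift ord0 i) => xE.
have c0 : c != 0.
  have [w wx w0] := mem_point x; apply: contraNneq w0 => c0.
  move: wx; rewrite xE param_root -/c c0 /root_poly polyC0 mul0r linear0.
  by case/vlineP => b ->; rewrite scaler0.
pose ell i : form F 1 := xform 1 ('X - (a i)%:P).
have ellE i : xpoly (ell i) = 'X - (a i)%:P by rewrite xformK // size_XsubC.
pose f : form F n := DHomog (homog_prod_powers (fun i => form_homog (ell i))).
exists ell; split.
  move=> i; apply/eqP => e; have := polyXsubC_eq0 (a i).
  by rewrite -ellE e linear0 eqxx.
exists f => //.
have fE : param_vec root_family v = c *: f.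
  rewrite param_root -/c; apply: xpoly_inj; rewrite xformK ?size_root_poly // linearZ.
  rewrite /root_poly mul_polyC; congr (_ *: _).
  rewrite [RHS](_ : _ = dehom ord0 (\prod_i form_poly (ell i) ^+ part i)) // rmorph_prod.
  apply: eq_bigr => i _.
  by rewrite -ellE; apply: esym; exact: rmorphXn.
rewrite xE fE; apply/eqP; rewrite eqEdim -memvE memvZ ?memv_line //= !dim_vline.
by rewrite scaler_eq0 (negbTE c0).
Qed.

(** Any product of powers of linear forms l_i is the value at t = 0 of the product with
    l_i + t * (x - i y) instead, which for all but finitely many t has distinct roots
    and none at infinity. *)
Lemma distinct_roots_dense (p : {mpoly F[M]}) :
  (forall v, distinct_roots v -> p.@[coords (param_vec root_family v)] = 0) ->
  forall x, X x -> forall w, w \in val x -> w != 0 -> p.@[coords w] = 0.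
Proof.
move=> H x [ell [ell0 [f fE xE]]] w; rewrite xE => /vlineP[b ->] bf0.
have b0 : b != 0 by apply: contraNneq bf0 => ->; rewrite scale0r.
pose al i := (xpoly (ell i))`_1; pose be i := (xpoly (ell i))`_0.
have ellE i : xpoly (ell i) = (al i)%:P * 'X + (be i)%:P.
  rewrite [LHS](poly_sum_coef (size_xpoly _)) big_ord_recl big_ord1 /= expr0 expr1.
  by rewrite alg_polyC mul_polyC addrC.
(* the curve of forms: the inner variable is the parameter t *)
pose C : {poly {poly F}} := (b%:P)%:P * \prod_(i : I)
   (((al i)%:P + 'X)%:P * 'X + ((be i)%:P - (i : nat)%:R *: 'X)%:P) ^+ part i.
pose ev t : {poly F} := map_poly (horner_eval t) C.
have evE t : ev t = b%:P * \prod_(i : I) ((al i + t)%:P * 'X + (be i - (i : nat)%:R * t)%:P) ^+ part i.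
  rewrite /ev rmorphM rmorph_prod /=; congr (_ * _).
    by rewrite map_polyC /= /horner_eval hornerC.
  apply: eq_bigr => i _; rewrite rmorphXn rmorphD rmorphM /= !map_polyC map_polyX /= /horner_eval.
  by rewrite !hornerE.
pose cv k : {poly F} := \sum_(j < n.+1) coords (xform n ('X^j : {poly F})) k *: C`_j.
have cvE t k : (size (ev t) <= n.+1)%N -> (cv k).[t] = coords (xform n (ev t)) k.
  move=> st; rewrite [in RHS](poly_sum_coef st) linear_sum /coords linear_sum /cv horner_sum.
  apply: eq_bigr => j _; rewrite hornerZ !linearZ /= mulrC; congr (_ * _).
  by rewrite /ev coef_map.
have ev0 : ev 0 = xpoly (b *: f).
  rewrite evE linearZ /= -mul_polyC; congr (_ * _).
  rewrite /xpoly fE rmorph_prod; apply: eq_bigr => i _.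
  by rewrite mulr0 subr0 addr0 -ellE; apply: esym; exact: rmorphXn.
(* the determinant of the i-th and j-th linear forms, whose coefficient of t^2 is j - i *)
pose De i j : {poly F} := ((be i)%:P - (i : nat)%:R *: 'X) * ((al j)%:P + 'X)
   - ((be j)%:P - (j : nat)%:R *: 'X) * ((al i)%:P + 'X).
have De0 (i j : I) : i != j -> De i j != 0.
  move=> ij; have : (De i j)`_2 != 0; last by apply: contraNneq => ->; rewrite coef0.
  have -> : De i j = ((be i * al j) - (be j * al i))%:P +
      (be i - (i : nat)%:R * al j - be j + (j : nat)%:R * al i) *: 'X + ((j : nat)%:R - (i : nat)%:R) *: 'X^2.
    rewrite /De -!mul_polyC !(polyCD, polyCN, polyCM); ring.
  rewrite !coefD coefC coefZ coefX coefZ coefXn /= mulr0 mulr1 !add0r.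
  by rewrite subr_eq0; apply: contraNneq ij => /(natr_inj charF)/val_inj->.
apply/eqP; apply: contraT => pw.
have along0 : along p cv != 0.
  apply: contraNneq pw => e; have : (along p cv).[0] = 0 by rewrite e horner0.
  rewrite horner_along => e0; apply/eqP; rewrite -[RHS]e0; apply: meval_eq => k.
  by rewrite cvE ev0 ?size_xpoly // xpolyK.
have al0 : \prod_(i : I) ((al i)%:P + 'X) != 0.
  by apply/prodf_neq0 => i _; rewrite addrC -size_poly_gt0 size_XaddC.
have de0 : \prod_(i : I) \prod_(j | i != j) De i j != 0.
  by apply/prodf_neq0 => i _; apply/prodf_neq0 => j; apply: De0.
have [t] := poly_point infF (mulf_neq0 along0 (mulf_neq0 al0 de0)).
rewrite !hornerM !mulf_eq0 !negb_or !horner_prod => /and3P[pt /prodf_neq0 at0 /prodf_neq0 dt0].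
have {}at0 i : al i + t != 0 by have := at0 i isT; rewrite !hornerE.
pose a (i : I) := - (be i - (i : nat)%:R * t) / (al i + t).
pose c := b * \prod_(i : I) (al i + t) ^+ part i.
pose v (l : 'I_(size la).+1) := oapp a c (unlift ord0 l).
have v0 : v ord0 = c by rewrite /v unlift_none.
have vS i : v (lift ord0 i) = a i by rewrite /v liftK.
have evt : ev t = root_poly (v ord0) (fun i : I => v (lift ord0 i)).
  rewrite evE /root_poly v0 /c polyCM -mulrA; congr (_ * _).
  rewrite rmorph_prod -big_split; apply: eq_bigr => i _ /=.
  rewrite rmorphXn -exprMn vS; congr (_ ^+ _).
  rewrite mulrBr -polyCM -polyCN; congr (_ + _%:P).
  by rewrite /a mulNr mulrN opprK [_ * (_ / _)]mulrC divfK.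
have : p.@[coords (param_vec root_family v)] = 0.
  apply: H; split.
    rewrite v0 /c mulf_neq0 //; apply/prodf_neq0 => i _; exact: expf_neq0.
  move=> i j; rewrite !vS => /eqP; rewrite eqr_div ?at0 // => /eqP e.
  apply/eqP; apply: contraT => ij.
  have := dt0 i isT; rewrite horner_prod => /prodf_neq0/(_ j ij).
  rewrite /De !hornerE => /eqP[]; move: e; rewrite !mulNr => /oppr_inj ->.
  by rewrite subrr.
rewrite param_root -evt => pz; move/eqP: pt; case; rewrite -[RHS]pz horner_along.
by apply: meval_eq => k; rewrite cvE // evt size_root_poly.
Qed.

Lemma root_locus_closure : sub_pset X (in_image_closure root_family).
Proof.
move=> x Xx p pf w wx; have [->|w0] := eqVneq w 0; last first.
  by apply: distinct_roots_dense Xx w wx w0 => v _; rewrite meval_param pf meval0.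
have -> : 0 = param_vec root_family (fun=> 0) :> W.
  by rewrite param_root /root_poly polyC0 mul0r linear0.
by rewrite meval_param pf meval0.
Qed.

Definition base_roots (l : 'I_(size la).+1) : F := oapp (fun i : I => (i : nat)%:R) 1 (unlift ord0 l).

Lemma base_roots_distinct : distinct_roots base_roots.
Proof.
rewrite /base_roots; split; first by rewrite unlift_none oner_eq0.
by move=> i j; rewrite !liftK /= => /(natr_inj charF)/val_inj.
Qed.

Lemma param_root_neq0 v : distinct_roots v -> param_vec root_family v != 0.
Proof.
case=> v0 _; rewrite param_root; apply: contraNneq v0 => /xform_eq0.
rewrite size_root_poly // => /(_ isT)/eqP; rewrite mulf_eq0 polyC_eq0 => /orP[//|].
by case/idPn; apply/prodf_neq0 => i _; rewrite expf_neq0 ?polyXsubC_eq0.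
Qed.

(** The parametrization by the leading coefficient and the roots scales with the former. *)
Lemma root_locus_dim : has_dim X (size la)%:Z.
Proof.
have -> : (size la)%:Z = (size la).+1%:Z - 1 by lia.
apply: (param_has_dim infF charF (root_family_free base_roots_distinct) (e := delta_mx 0 ord0)).
- move=> t; rewrite !param_root -linearZ /root_poly scalerAl; congr (xform n _).
  rewrite -mul_polyC -polyCM; congr (_%:P * _).
    by rewrite mxE !eqxx /base_roots unlift_none /= mulr1 mulr1.
  by apply: eq_bigr => i _; rewrite mxE /= mulr0 addr0.
- by move=> _; apply: param_root_neq0 base_roots_distinct.
- exact: root_family_image.
exact: root_locus_closure.
Qed.
End RootLocus.

(** * Conormal vectors of the multiple root locus *)

Lemma derp_row (F : fieldType) N (v u : 'I_N -> F) Q :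
  derp v u Q = derp v (fun l => (\row_l u l) 0 l) Q.
Proof.
apply/polyP => i; rewrite !coef_derp; apply: eq_bigr => l _.
by rewrite mxE.
Qed.

Lemma coords_big (F : fieldType) (W : vectType F) (J : Type) (r : seq J) (P : pred J) (E : J -> W) k :
  coords (\sum_(i <- r | P i) E i) k = \sum_(i <- r | P i) coords (E i) k.
Proof.
apply: (big_morph (fun w => coords w k)) => [u w|]; first exact: coordsD.
by rewrite -(scale0r 0) coordsZ mul0r.
Qed.

Section DualVariety.
Variables (F : fieldType) (charF : [pchar F] =i pred0).
Variables (n : nat) (la : seq nat) (hla : is_partition n la).
Local Notation I := 'I_(size la).
Local Notation W := (form F n).
Local Notation M := (\dim {: form F n}).
Local Notation X := (@multiple_root_locus F n la).
Local Notation D := (dual_variety X).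
Let infF := char0_infinite charF.
Local Notation fr := (root_family F n la).
Implicit Types (s : I -> F) (g : I -> {poly F}).

Definition dual_family := family (@vform F n) (dual_family_poly n la F).
Local Notation fd := dual_family.

Lemma param_dual v : param_vec fd v = vform n (dual_poly n (sval_of v) (gval_of v)).
Proof. by rewrite param_family ?(size_dual_family hla) // eval_dual_family. Qed.

Lemma eq_dual_poly s s' g g' : (forall i, part i != 1%N -> s i = s' i) ->
  (forall i, part i != 1%N -> g i = g' i) -> dual_poly n s g = dual_poly n s' g'.
Proof. by move=> es eg; apply: eq_bigr => i i1; rewrite es ?eg. Qed.

Lemma param_encode s g : sized g -> param_vec fd (encode s g) = vform n (dual_poly n s g).
Proof.
move=> sg; rewrite param_dual; congr (vform n _); apply: eq_dual_poly => i i1.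
  by rewrite (sval_encode hla).
by rewrite (gval_encode hla) ?sg.
Qed.

Lemma dual_family_free v : good v -> row_free (jac fd v).
Proof.
move=> gv; apply: family_row_free.
- exact: (size_dual_family hla).
- exact: vform_eq0.
by move=> u; apply: (dual_family_immersion hla charF gv).
Qed.

Lemma sizedZ c g : sized g -> sized (fun i => c *: g i).
Proof. by move=> sg i i1; apply: leq_trans (size_scale_leq _ _) (sg i i1). Qed.

Lemma dual_polyZ c s g : dual_poly n s (fun i => c *: g i) = c *: dual_poly n s g.
Proof. by rewrite scaler_sumr; apply: eq_bigr => i _; rewrite scalerAr. Qed.

Lemma sized_gval v : sized (gval_of v : I -> {poly F}).
Proof. by move=> i _; apply: size_gval. Qed.

Definition one_cofactor (i : I) : {poly F} := if part i != 1%N :> nat then 1 else 0.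

Definition base_dual := encode (fun i : I => (i : nat)%:R : F) one_cofactor.

Lemma sized_one : sized one_cofactor.
Proof.
by move=> i i1; rewrite /one_cofactor i1 size_poly1; have := part_gt0 hla i; lia.
Qed.

Lemma base_dual_good : good base_dual.
Proof.
split=> [i j i1 j1|i i1]; rewrite !(sval_encode hla) //.
  by move/(natr_inj charF)/val_inj.
by rewrite (gval_encode hla) ?sized_one // /one_cofactor i1 hornerC oner_eq0.
Qed.

(** The pairing with monomials recovers the coefficients. *)
Lemma apolar_nondegenerate (G G' : {poly F}) : (size G <= n.+1)%N -> (size G' <= n.+1)%N ->
  (forall j, (j <= n)%N -> apolar n 'X^j G = apolar n 'X^j G') -> G = G'.
Proof.
move=> sG sG' H; apply/polyP => i; have [ni|ni] := leqP i n; last first.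
  by rewrite !nth_default // (leq_trans _ ni).
have := H (n - i)%N (leq_subr _ _); rewrite !apolar_Xnl ?leq_subr // subKn //.
by apply: mulfI; rewrite invr_eq0 bin_neq0 ?leq_subr.
Qed.

Section Gradient.
Variable p : {mpoly F[M]}.

(** The differential of p, read through the pairing as a form that depends polynomially on
    the point. *)
Definition gradient_poly : {poly {mpoly F[M]}} :=
  \sum_(j < n.+1) ('C(n, j)%:R *: \sum_k coords (xform n ('X^j : {poly F})) k *: p^`M(k))%:P * 'X^(n - j).

Lemma size_gradient : (size gradient_poly <= n.+1)%N.
Proof.
apply: leq_trans (size_sum _ _ _) _; apply/bigmax_leqP => j _.
rewrite mul_polyC; apply: leq_trans (size_scale_leq _ _) _.
by rewrite size_polyXn ltnS leq_subr.
Qed.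

Lemma apolar_gradient (h w : W) : apolar n (xpoly h) (evalp (coords w) gradient_poly) = dpoly p w h.
Proof.
rewrite rmorph_sum apolar_sumr.
have hE k : coords h k = \sum_(j < n.+1) (xpoly h)`_j * coords (xform n ('X^j : {poly F})) k.
  have e : h = \sum_(j < n.+1) (xpoly h)`_j *: xform n ('X^j : {poly F}).
    rewrite -[LHS]xpolyK [X in xform n X](poly_sum_coef (size_xpoly h)) linear_sum.
    by apply: eq_bigr => j _; rewrite linearZ.
  by rewrite {1}e coords_big; apply: eq_bigr => j _; rewrite coordsZ.
rewrite /dpoly; under [RHS]eq_bigr => k _ do rewrite hE mulr_sumr.
rewrite [RHS]exchange_big; apply: eq_bigr => j _ /=.
have jn := leq_ord j.
rewrite rmorphM /= evalpC mul_polyC /evalp map_polyXn apolarZr apolar_Xnr ?leq_subr // subKn // bin_sub //.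
rewrite mevalZ raddf_sum mulr_sumr mulr_suml; apply: eq_bigr => k _.
rewrite /= mevalZ; field.
by rewrite bin_neq0.
Qed.
End Gradient.

(** A conormal vector at x is the gradient of an equation p of the root locus, by
    [double_annihilator].  At forms with distinct roots the gradient of p is conormal
    as well, hence a value of the formula by [conormal_dual]; so it satisfies the
    equations of the image of the formula, and by density the gradient at x does. *)
Lemma dual_base_closure (y : proj W) : (exists x : proj W, exists T : {vspace form F n},
      [/\ smooth_point X x, is_tangent_space X x T &
          forall f (g : W), f \in T -> g \in val y -> pairing f g = 0]) -> in_image_closure fd y.
Proof.
case=> x [T [[Xx _] TX perp]] q qf w' w'y.
set w := vpick (val x); have wx : w \in val x := memv_pick _; have w0 : w != 0 := vpick_point x.
(* the functional of w' vanishes on the tangent space, hence is the differential of an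
   equation *)
have [p pf pE] : exists2 p, p \mPo fr = 0 & forall h, dpoly p w h = pairing h w'.
  pose Dn (r : 'rV[F]_M) := exists2 p, p \mPo fr = 0 & r = \row_k (p^`M(k)).@[coords w].
  have pairE (h : W) : pairing h w' = \sum_(k < M) pairing (vbasis {:W})`_k w' * coords h k.
    rewrite !(pairingE charF) {1}(sum_coords h) linear_sum apolar_suml; apply: eq_bigr => k _.
    by rewrite linearZ apolarZl mulrC pairingE.
  have [||h hD|p pf /rowP pE] := @double_annihilator F M Dn (\row_(k < M) pairing (vbasis {:W})`_k w').
  - exists 0; first by rewrite comp_mpoly0.
    by apply/rowP => k; rewrite !mxE mderiv0 meval0.
  - move=> c r r' [p pf ->] [p' pf' ->]; exists (c *: p + p').
      by rewrite comp_mpolyD comp_mpolyZ pf pf' scaler0 addr0.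
    by apply/rowP => k; rewrite !mxE mderivD mderivZ mevalD mevalZ.
  - pose h' := vec_of_row (W := form F n) h^T.
    have h'T : h' \in T.
      apply/TX/(tangentP infF (f := fr) _ _ _ h' Xx wx w0).
      - by move=> c v; apply: root_family_conic.
      - by move=> v x0; apply: (root_family_image hla).
      - exact: (root_locus_closure charF hla).
      move=> p pf; have := hD (\row_k (p^`M(k)).@[coords w]) (ex_intro2 _ _ p pf erefl).
      move/matrixP/(_ 0 0); rewrite !mxE => pz; rewrite -[RHS]pz; apply: eq_bigr => k _.
      by rewrite coords_vec_of_row !mxE.
    apply/matrixP => a b; rewrite (ord1 a) (ord1 b) [RHS]mxE -[RHS](perp h' w' h'T w'y) pairE mxE.
    by apply: eq_bigr => k _; rewrite coords_vec_of_row !mxE.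
  exists p => // h; rewrite pairE; apply: eq_bigr => k _.
  by have := pE k; rewrite !mxE => ->.
pose fG := family (@vform F n) (gradient_poly p).
have fGE w1 : param_vec fG (coords w1) = vform n (evalp (coords w1) (gradient_poly p)).
  by rewrite param_family ?size_gradient.
have sG w1 : (size (evalp (coords w1) (gradient_poly p)) <= n.+1)%N.
  exact: leq_trans (size_evalp _ _) (size_gradient p).
have wE : param_vec fG (coords w) = w'.
  rewrite fGE -[RHS]vpolyK; congr (vform n _).
  apply: apolar_nondegenerate; rewrite ?size_vpoly // => j jn.
  have sj : (size ('X^j : {poly F}) <= n.+1)%N by rewrite size_polyXn.
  by rewrite -(xformK sj) apolar_gradient pE pairingE.
rewrite -wE meval_param.
have E w1 : (q \mPo fG).@[coords w1] = q.@[coords (vform n (evalp (coords w1) (gradient_poly p)))].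
  by rewrite -meval_param fGE.
apply: (distinct_roots_dense charF hla _ Xx wx w0) => v dv; have [v0 vinj] := dv.
rewrite E; set G := evalp _ _.
(* at forms with distinct roots the gradient kills the tangent vectors *)
have [|g sg GE] := conormal_dual hla charF v0 vinj (sG (param_vec fr v)).
  move=> u; rewrite derp_row; set u' := \row_l u l.
  have sd : (size (derp v (fun l => u' 0%R l) (root_family_poly la F)) <= n.+1)%N.
    by apply: leq_trans (size_derp _ _ _) _; apply: (size_root_family hla).
  rewrite -(xformK sd) apolar_gradient; apply: (jac_dpoly (u := u') pf) => k.
  by rewrite jac_family ?(size_root_family hla).
by rewrite /G GE -param_encode // meval_param qf meval0.
Qed.

Lemma dual_sub_closure : sub_pset D (in_image_closure fd).
Proof. by move=> y Dy; apply: Dy (zclosed_image_closure infF fd) dual_base_closure. Qed.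

(** Forms with distinct roots outside a proper closed set are smooth points, so there all
    the values of the formula at s = a belong to the dual variety. *)
Lemma generic_conormal : exists2 q : {mpoly F[M]}, q \mPo fr != 0 &
  forall v, distinct_roots v -> q.@[coords (param_vec fr v)] != 0 ->
  forall g, sized g -> forall y, val y = <[vform n (dual_poly n (fun i => v (lift ord0 i)) g)]>%VS -> D y.
Proof.
have [q [qf [B HB]]] := generic_tangent_bound infF charF (root_family_free charF hla (base_roots_distinct charF la)).
exists q => // v dv qv g sg y yE C clC; apply; have f0 := param_root_neq0 hla dv.
have [x xE] := point_of f0.
have Xx : X x by apply: (root_family_image hla) xE.
have [|||T [TX dT TJ]] := tangent_space_param infF (f := fr) (X := X) _ _ _ (HB _ qv) (root_family_free charF hla dv) f0 xE.
- by move=> c v'; apply: root_family_conic.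
- by move=> v' x'; apply: (root_family_image hla).
- exact: (root_locus_closure charF hla).
exists x, T; split => //.
  split => //; exists T, (size la); split => //; exact: (root_locus_dim charF hla).
move=> f g' fT; rewrite yE => /vlineP[b ->].
have [u uE] := TJ f fT.
have sd : (size (derp v (fun l => u 0%R l) (root_family_poly la F)) <= n.+1)%N.
  by apply: leq_trans (size_derp _ _ _) _; apply: (size_root_family hla).
have -> : f = xform n (derp v (fun l => u 0 l) (root_family_poly la F)).
  by apply: coords_inj => k; rewrite uE jac_family ?(size_root_family hla).
rewrite (pairingE charF) xformK // linearZ /= apolarZr vformK; last exact: (size_dual_poly hla).
rewrite (derp_root_family hla) apolar_dual ?mulr0 // -?(derp_root_family hla) //.
by move=> i; rewrite (derp_root_family hla); apply: tangent_factor_dvd.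
Qed.
End DualVariety.

(** * Dimension of the dual variety *)

Section DualDim.
Variables (F : fieldType) (charF : [pchar F] =i pred0).
Variables (n : nat) (la : seq nat) (hla : is_partition n la).
Local Notation I := 'I_(size la).
Local Notation W := (form F n).
Local Notation M := (\dim {: form F n}).
Local Notation X := (@multiple_root_locus F n la).
Local Notation D := (dual_variety X).
Let infF := char0_infinite charF.
Local Notation fr := (root_family F n la).
Local Notation fd := (dual_family F n la).
Local Notation N := #|{: dual_index la}|.
Implicit Types (s : I -> F) (g : I -> {poly F}).

Definition encode_curve (a : I -> {poly F}) g (l : 'I_N) : {poly F} :=
  let x := enum_val l in
  if tagged x == 0%N :> nat then a (tag x) else ((g (tag x))`_(tagged x).-1)%:P.

Lemma encode_curveE a g t l : (encode_curve a g l).[t] = encode (fun i => (a i).[t]) g l.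
Proof. by rewrite /encode_curve /encode; case: ifP => // _; rewrite hornerC. Qed.

Lemma along_dual (p : {mpoly F[M]}) a g t : sized g ->
  (along (p \mPo fd) (encode_curve a g)).[t] =
  p.@[coords (vform n (dual_poly n (fun i => (a i).[t]) g))].
Proof.
move=> sg; rewrite horner_along -(param_encode hla) // meval_param.
by apply: meval_eq => l; apply: encode_curveE.
Qed.

(** Keep g and move s along a line to a general point: for almost all values of the line's
    parameter, s is the tuple of roots of a form to which [generic_conormal] applies,
    and the dual variety is closed. *)
Lemma dual_image_sub v y : val y = <[param_vec fd v]>%VS -> D y.
Proof.
rewrite (param_dual hla); set s := sval_of v; set g : I -> {poly F} := gval_of v => yE C clC base.
have sg : sized g by apply: (@sized_gval F la v).
have [q qf qP] := generic_conormal charF hla.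
have [S CS] := zclosed_conesP clC.
apply/CS => p Sp w; rewrite yE => /vlineP[b ->].
(* the differences of the roots, each twice up to sign *)
pose disc : {mpoly F[(size la).+1]} :=
  \prod_(i : I) \prod_(j | i != j) ('X_(lift ord0 i) - 'X_(lift ord0 j)).
have disc0 : disc != 0.
  apply/prodf_neq0 => i _; apply/prodf_neq0 => j ij; rewrite subr_eq0.
  apply: contraNneq ij => /(congr1 (mcoeff U_(lift ord0 i)))/eqP.
  rewrite !mcoeffXU eqxx; case: (lift ord0 j =P lift ord0 i) => [/lift_inj->//|_].
  by rewrite oner_eq0.
have discP (u : 'I_(size la).+1 -> F) : disc.@[u] != 0 -> injective (fun i : I => u (lift ord0 i)).
  rewrite /disc rmorph_prod => /prodf_neq0 H i j e; apply/eqP; apply: contraT => ij.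
  have := H i isT; rewrite rmorph_prod => /prodf_neq0/(_ j ij).
  by rewrite /= mevalB !mevalXU e subrr eqxx.
have X0 : 'X_ord0 != 0 :> {mpoly F[(size la).+1]}.
  apply: contraTneq (oner_neq0 F) => /(congr1 (mcoeff U_(ord0))).
  by rewrite mcoeffXU eqxx mcoeff0 => /eqP; rewrite oner_eq0.
(* vs: distinct roots, nonzero leading coefficient, outside the bad set of [generic_conormal] *)
have [vs] := mpoly_point infF (mulf_neq0 qf (mulf_neq0 X0 disc0)).
rewrite !mevalM !mulf_eq0 !negb_or mevalXU => /and3P[qs vs0 ds].
pose a (i : I) : {poly F} := (s i)%:P + (vs (lift ord0 i) - s i) *: 'X.
have a0 i : (a i).[0] = s i by rewrite /a !hornerE.
have a1 i : (a i).[1] = vs (lift ord0 i) by rewrite /a hornerD hornerC hornerZ hornerX mulr1 addrC subrK.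
pose vc (l : 'I_(size la).+1) : {poly F} := oapp a (vs ord0)%:P (unlift ord0 l).
pose vt t l := (vc l).[t].
have vt1 : vt 1 =1 vs.
  move=> l; rewrite /vt /vc; case: unliftP => [i ->|->] /=; first exact: a1.
  by rewrite hornerC.
have vt0 t : vt t ord0 = vs ord0 by rewrite /vt /vc unlift_none /= hornerC.
have vtS t i : vt t (lift ord0 i) = (a i).[t] by rewrite /vt /vc liftK.
pose P1 := along (q \mPo fr) vc; pose P2 := along disc vc.
have P1_0 : P1 != 0.
  by apply: contraNneq qs => e; rewrite -(meval_eq _ vt1) -horner_along -/P1 e horner0.
have P2_0 : P2 != 0.
  by apply: contraNneq ds => e; rewrite -(meval_eq _ vt1) -horner_along -/P2 e horner0.
have fE : dual_poly n (fun i => (a i).[0]) g = dual_poly n s g by apply: eq_dual_poly.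
have [k wk] : exists k, coords (vform n (dual_poly n s g)) k != 0.
  have [w1 wy w10] := mem_point y; apply: NNPP => H; case/eqP: w10.
  move: wy; rewrite yE => /vlineP[c ->]; apply: coords_inj => k.
  rewrite coordsZ -(scale0r 0) coordsZ mul0r.
  apply/eqP; apply: contraT => ck; case: H; exists k.
  by apply: contraNneq ck => ->; rewrite mulr0.
(* P3 keeps the value of the formula nonzero along the curve *)
pose P3 := along ('X_k \mPo fd) (encode_curve a g).
have P3E t : P3.[t] = coords (vform n (dual_poly n (fun i => (a i).[t]) g)) k.
  by rewrite along_dual // mevalXU.
have P3_0 : P3 != 0.
  by apply: contraNneq wk => e; rewrite -fE -P3E e horner0.
have sbg : sized (fun i => b *: g i) by apply: sizedZ.
pose P4 := along (p \mPo fd) (encode_curve a (fun i => b *: g i)).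
have P4E t : P4.[t] = p.@[coords (b *: vform n (dual_poly n (fun i => (a i).[t]) g))].
  by rewrite along_dual // dual_polyZ linearZ.
have -> : p.@[coords (b *: vform n (dual_poly n s g))] = P4.[0] by rewrite P4E fE.
suff -> : P4 = 0 by rewrite horner0.
apply/eqP; apply: contraT => P4_0.
have [t] := poly_point infF (mulf_neq0 (mulf_neq0 P1_0 P2_0) (mulf_neq0 P3_0 P4_0)).
rewrite !hornerM !mulf_eq0 !negb_or => /andP[/andP[t1 t2] /andP[t3 /eqP t4]].
have ft0 : vform n (dual_poly n (fun i => (a i).[t]) g) != 0.
  apply: contraNneq t3 => e; rewrite P3E e.
  by rewrite -(scale0r 0) coordsZ mul0r.
have [yt ytE] := point_of ft0.
case: t4; rewrite P4E.
have dvt : distinct_roots (vt t).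
  by split; [rewrite vt0|apply: discP; rewrite -horner_along].
have Dyt : D yt.
  apply: (qP (vt t) dvt _ g sg yt).
    by rewrite meval_param -horner_along.
  by rewrite ytE; congr <[vform n _]>%VS; apply: eq_dual_poly => // i _; rewrite vtS.
have /CS/(_ p Sp) : C yt by apply: Dyt.
by apply; rewrite ytE memvZ ?memv_line.
Qed.

Lemma encode_add s g t : encode s (fun i => (1 + t) *: g i) =1
  (fun l => encode s g l + t * encode (fun=> 0) g l).
Proof.
move=> l; rewrite /encode; case: ifP => _; first by rewrite mulr0 addr0.
by rewrite coefZ mulrDl mul1r.
Qed.

(** The parametrization scales with g. *)
Lemma dual_dim : has_dim D (n%:Z - (count_mem 1%N la)%:Z - 1).
Proof.
have -> : n%:Z - (count_mem 1%N la)%:Z = N%:Z.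
  by have := card_dual_index hla; lia.
have gb := base_dual_good charF hla.
apply: (param_has_dim infF charF (dual_family_free charF hla gb)
  (e := \row_l encode (fun=> 0) (one_cofactor F (la := la)) l)).
- move=> t; have -> : param_vec fd (fun i => base_dual F (la := la) i + t * (\row_l encode (fun=> 0) (one_cofactor F (la := la)) l) 0 i)
    = param_vec fd (encode (fun i : I => (i : nat)%:R) (fun i => (1 + t) *: one_cofactor F i)).
    apply: eq_bigr => k _; congr (_ *: _); apply: meval_eq => l.
    by rewrite mxE encode_add.
  have s1 := sized_one F hla.
  by rewrite !(param_encode hla) ?dual_polyZ ?linearZ //; apply: sizedZ.
- move=> N0; have [a _] : exists a : dual_index la, true by exists (enum_val (Ordinal N0)).
  have a1 : part (tag a) != 1%N.
    by rewrite -(big_part_gt0 hla) (leq_trans _ (ltn_ord (tagged a))).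
  have s1 := sized_one F hla.
  rewrite /base_dual (param_encode hla) //; apply/eqP => /vform_eq0.
  rewrite (size_dual_poly hla) // => /(_ isT) e0.
  have s_inj : inj_big (fun i : I => (i : nat)%:R : F).
    by move=> i j _ _ /(natr_inj charF)/val_inj.
  have s0 : sized (fun _ : I => 0 : {poly F}) by move=> i _; rewrite size_poly0.
  have := dual_poly_inj hla charF s_inj s1 s0 _ a1; rewrite e0.
  rewrite [dual_poly _ _ _]big1 => [/(_ erefl)/eqP|i _]; last by rewrite mulr0.
  by rewrite /one_cofactor a1 oner_eq0.
- exact: dual_image_sub.
exact: (dual_sub_closure charF hla).
Qed.
End DualDim.

(** * The join variety and the formula in coordinates *)

Lemma homog_of_scale (F : fieldType) (infF : infinite_field F) n (p : {mpoly F[n]}) e :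
  (forall c v, p.@[fun i => c * v i] = c ^+ e * p.@[v]) -> p \is e.-homog.
Proof.
move=> H; have E d : d != e -> pihomog mdeg d p = 0.
  move=> de; apply: (mpoly_eq0_points infF) => v.
  have [dp|dp] := leqP (msize p) d.
    rewrite pihomogE big_seq_cond big1 ?meval0 // => m /andP[ms /eqP md].
    by have := msize_mdeg_lt ms; rewrite md ltnNge dp.
  have : \poly_(d < msize p) (pihomog mdeg d p).@[v] = p.@[v] *: 'X^e.
    apply: (poly_eq_points infF) => c; rewrite horner_poly hornerZ hornerXn mulrC -H meval_scale.
    by apply: eq_bigr => i _; rewrite mulrC.
  move/(congr1 (fun q : {poly F} => q`_d)); rewrite coef_poly dp coefZ coefXn.
  by rewrite (negbTE de) mulr0.
rewrite (pihomog_partitionE (leqnn (msize p))); apply: rpred_sum => d _.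
have [<-|/E->] := eqVneq (d : nat) e; first exact: pihomogP.
exact: rpred0.
Qed.

Section JoinVariety.
Variables (F : fieldType) (charF : [pchar F] =i pred0).
Variables (n : nat) (la : seq nat) (hla : is_partition n la).
Local Notation I := 'I_(size la).
Local Notation W := (form F n).
Local Notation JS := (join_space F la).
Local Notation K := (\dim {: JS}).
Local Notation X := (@join_variety F la).
Local Notation D := (dual_variety (@multiple_root_locus F n la)).
Local Notation phi := (@param_map F n la).
Let infF := char0_infinite charF.
Local Notation fd := (dual_family F n la).
Implicit Types (s t : I -> F) (g : I -> {poly F}).

(** The vector of the w_i (x) g_i for univariate g_i; the reversal comes from the index of
    the monomial u^b v^(part i - 2 - b). *)
Definition jvec s t g : JS :=
  [ffun k : join_index la => let i := tag k in let: (a, b) := tagged k in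
     (if a == ord0 then s i else t i) * (g i)`_(rev_ord b)].

(** The coordinate of e_a (x) v^c in the i-th summand, 0 out of range. *)
Definition zof (w : JS) (i : I) (a : 'I_2) (c : nat) : F :=
  if insub c is Some c' then w (Tagged (fun i : I => ('I_2 * 'I_(part i).-1)%type) (a, rev_ord (c' : 'I_(part i).-1))) else 0.

Lemma zof_jvec s t g i a c : sized g -> part i != 1%N ->
  zof (jvec s t g) i a c = (if a == ord0 then s i else t i) * (g i)`_c.
Proof.
move=> sg i1; rewrite /zof; case: insubP => [c' _ <-|].
  rewrite ffunE /=; congr (_ * nth 0 (polyseq _) _).
  by have := ltn_ord c'; move=> /=; lia.
by rewrite -leqNgt => H; rewrite nth_default ?mulr0 // (leq_trans (sg i i1)).
Qed.

Lemma jvecZ b s t g : b *: jvec s t g = jvec s t (fun i => b *: g i).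
Proof.
apply/ffunP => k; rewrite !ffunE; case: (tagged k) => a c /=.
by rewrite coefZ [RHS]mulrCA.
Qed.

Lemma index_part (k : join_index la) : part (tag k) != 1%N.
Proof.
case: k => i [a b] /=; apply/eqP => i1; have := ltn_ord b.
by rewrite {2}i1.
Qed.

Lemma eq_jvec s s' t t' g g' : (forall i, part i != 1%N -> s i = s' i) ->
  (forall i, part i != 1%N -> t i = t' i) -> (forall i, part i != 1%N -> g i = g' i) ->
  jvec s t g = jvec s' t' g'.
Proof.
move=> es et eg; apply/ffunP => k; rewrite !ffunE.
by have k1 := index_part k; case: (tagged k) => a c /=; rewrite es ?et ?eg.
Qed.

Lemma join_vectorE s t (g : cofactors F la) :
  join_vector s t g = jvec s t (fun i => vpoly (g i)).
Proof.
apply/ffunP => k; rewrite !ffunE; have := index_part k; case: k => i [a b] /= i1.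
congr (_ * _); rewrite /vpoly (dehom1E (form_homog (g i))).
have bi := ltn_ord b; have pi := part_gt0 hla i.
rewrite coef_poly /= ifT; last by lia.
by congr (mcoeff (bimonomial _ _) _); lia.
Qed.

Lemma sized_vpoly (g : cofactors F la) : sized (fun i => vpoly (g i)).
Proof.
move=> i i1; apply: leq_trans (size_vpoly _) _.
by have := part_gt0 hla i; lia.
Qed.

Definition cofactors_of g : cofactors F la := fun i => vform (part i - 2) (g i).

Lemma cofactors_ofK g i : sized g -> part i != 1%N -> vpoly (cofactors_of g i) = g i.
Proof.
move=> sg i1; rewrite vformK //; apply: leq_trans (sg i i1) _.
by have := part_gt0 hla i; lia.
Qed.

Lemma param_formula_homog s t (g : cofactors F la) : param_formula n s t g \is n.-homog.
Proof.
apply: rpred_sum => i i1.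
have e : (1 * (n - part i + 2) + (part i - 2))%N = n.
  by have := part_gt0 hla i; have := part_le hla i; lia.
suff : (s i *: 'X_ord0 + t i *: 'X_ord_max) ^+ (n - part i + 2) * form_poly (g i)
    \is (1 * (n - part i + 2) + (part i - 2)).-homog by rewrite e.
apply: dhomogM; last exact: form_homog.
by apply: dhomogMn; apply: rpredD; apply: rpredZ; rewrite dhomogX /= mdeg1.
Qed.

Lemma param_formulaE s (g : cofactors F la) (f : W) :
  form_poly f = param_formula n s (fun=> 1) g ->
  f = vform n (dual_poly n s (fun i => vpoly (g i))).
Proof.
move=> fE; rewrite -[LHS]vpolyK; congr (vform n _); rewrite /vpoly fE rmorph_sum.
apply: eq_bigr => i _; rewrite rmorphM rmorphXn; congr (_ ^+ _ * _).
rewrite rmorphD /= !dehomZ /dehom !mmapX !mmap1U /= scale1r addrC.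
by rewrite alg_polyC.
Qed.

Lemma join_varietyP x : X x <-> exists s t g, sized g /\ val x = <[jvec s t g]>%VS.
Proof.
split=> [[s [t [g xE]]]|[s [t [g [sg xE]]]]].
  by exists s, t, (fun i => vpoly (g i)); rewrite -join_vectorE; split=> //; apply: sized_vpoly.
exists s, t, (cofactors_of g); rewrite join_vectorE xE; congr <[_]>%VS.
by apply: eq_jvec => // i i1; rewrite cofactors_ofK.
Qed.

(** The same data with univariate g_i; both points depend only on the parts at least 2. *)
Lemma param_mapP x y : phi x y <-> exists s g, [/\ sized g, forall i, part i != 1%N -> g i != 0,
  val x = <[jvec s (fun=> 1) g]>%VS & val y = <[vform n (dual_poly n s g)]>%VS].
Proof.
split=> [[s [g [g0 xE [f fE yE]]]]|[s [g [sg g0 xE yE]]]].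
  exists s, (fun i => vpoly (g i)); split.
  - exact: sized_vpoly.
  - move=> i i1; apply: contraNneq (g0 i i1) => e; apply/eqP/vpoly_inj.
    by rewrite e linear0.
  - by rewrite -join_vectorE.
  by rewrite yE (param_formulaE fE).
exists s, (cofactors_of g); split.
- move=> i i1; apply: contraNneq (g0 i i1) => e.
  by rewrite -(cofactors_ofK sg i1) e linear0.
- rewrite join_vectorE xE; congr <[_]>%VS.
  by apply: eq_jvec => // i i1; rewrite cofactors_ofK.
exists (DHomog (param_formula_homog s (fun=> 1) (cofactors_of g))) => //.
rewrite yE; congr <[_]>%VS; rewrite [RHS](@param_formulaE s (cofactors_of g)) //.
by congr (vform n _); apply: eq_dual_poly => // i i1; rewrite cofactors_ofK.
Qed.

Lemma line_scale (V : vectType F) (w w' : V) : w != 0 -> <[w]>%VS = <[w']>%VS ->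
  exists2 c, c != 0 & w = c *: w'.
Proof.
move=> w0 e; have : w \in <[w']>%VS by rewrite -e memv_line.
case/vlineP => c wE; exists c => //.
by apply: contraNneq w0 => c0; rewrite wE c0 scale0r.
Qed.

Lemma line_of_scale (V : vectType F) (c : F) (w : V) : c != 0 -> <[c *: w]>%VS = <[w]>%VS.
Proof.
move=> c0; apply/eqP; rewrite eqEdim -memvE memvZ ?memv_line //= !dim_vline.
by rewrite scaler_eq0 (negbTE c0).
Qed.

Lemma point_neq0 (V : vectType F) (x : proj V) w : val x = <[w]>%VS -> w != 0.
Proof.
move=> xE; have [u ux u0] := mem_point x; apply: contraNneq u0 => w0.
by move: ux; rewrite xE w0 => /vlineP[c ->]; rewrite scaler0.
Qed.

(** The coordinates with a = 1 are the coefficients of g_i, and a nonzero one of them gives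
    s_i as a quotient. *)
Lemma jvec_inj s s' g g' : sized g -> sized g' -> (forall i, part i != 1%N -> g i != 0) ->
  jvec s (fun=> 1) g = jvec s' (fun=> 1) g' ->
  forall i, part i != 1%N -> g i = g' i /\ s i = s' i.
Proof.
move=> sg sg' g0 e i i1.
have gg : g i = g' i.
  apply/polyP => c; have := congr1 (fun w => zof w i ord_max c) e.
  by rewrite /= !zof_jvec // !mul1r.
split=> //; have := congr1 (fun w => zof w i ord0 (size (g i)).-1) e.
rewrite /= !zof_jvec //= -gg; apply: mulIf.
by rewrite -lead_coefE lead_coef_eq0 g0.
Qed.

Lemma param_map_fun x y y' : phi x y -> phi x y' -> y = y'.
Proof.
move=> /param_mapP[s [g [sg g0 xE yE]]] /param_mapP[s' [g' [sg' g0' xE' yE']]].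
have := xE; rewrite xE' => /esym/(line_scale (point_neq0 xE))[c c0].
rewrite jvecZ => /(jvec_inj sg (sizedZ c sg') g0) E.
apply: val_inj; rewrite yE yE' -[RHS](line_of_scale _ c0) -linearZ -dual_polyZ.
by congr <[vform n _]>%VS; apply: eq_dual_poly => i i1; have [e1 e2] := E i i1.
Qed.

Lemma param_map_sub x y : phi x y -> X x /\ D y.
Proof.
move=> xy; split.
  have /param_mapP[s [g [sg _ xE _]]] := xy.
  by apply/join_varietyP; exists s, (fun=> 1), g.
have /param_mapP[s [g [sg _ _ yE]]] := xy.
by apply: (dual_image_sub charF hla (v := encode s g)); rewrite (param_encode hla).
Qed.

(** A local formula for the map: s_i is recovered as the quotient of the coordinates
    (i, 0, be i) and (i, 1, be i) of the point, and the denominators are cleared, so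
    that be selects a coefficient of each g_i. *)
Definition cleared (R : comNzRingType) (z : I -> 'I_2 -> nat -> R) (be : I -> nat) : {poly R} :=
  \sum_(i | part i != 1%N)
    (\prod_(j | (part j != 1%N) && (j != i)) z j ord_max (be j) ^+ (n - part j + 2))%:P *
    (((z i ord_max (be i))%:P * 'X + (z i ord0 (be i))%:P) ^+ (n - part i + 2) *
     \poly_(c < (part i).-1) z i ord_max c).

Lemma size_cleared (R : idomainType) (z : I -> 'I_2 -> nat -> R) be :
  (size (cleared z be) <= n.+1)%N.
Proof.
apply: leq_trans (size_sum _ _ _) _; apply/bigmax_leqP => i i1.
rewrite mul_polyC; apply: leq_trans (size_scale_leq _ _) _.
apply: leq_trans (size_polyMleq _ _) _.
have sl : (size ((z i ord_max (be i))%:P * 'X + (z i ord0 (be i))%:P)%R <= 2)%N.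
  rewrite size_MXaddC; case: ifP => // _; rewrite ltnS size_polyC; exact: leq_b1.
have se : (size (((z i ord_max (be i))%:P * 'X + (z i ord0 (be i))%:P) ^+ (n - part i + 2))%R <= (n - part i + 2).+1)%N.
  apply: leq_trans (size_poly_exp_leq _ _) _; rewrite ltnS.
  rewrite -[X in (_ <= X)%N]mul1n leq_mul2r; apply/orP; right.
  by rewrite -subn1 leq_subLR.
have sp : (size (\poly_(c < (part i).-1) z i ord_max c) <= (part i).-1)%N by apply: size_poly.
have := leq_add se sp; have := part_gt0 hla i; have := part_le hla i.
move: (size _) (size _) => a b; lia.
Qed.

Local Notation expo i := (n - part i + 2)%N.

(** At a point of the join the local formula gives the value of the map, multiplied by
    powers of the selected coefficients. *)
Lemma cleared_jvec s g be : sized g -> cleared (zof (jvec s (fun=> 1) g)) be =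
  (\prod_(j | part j != 1%N) (g j)`_(be j) ^+ expo j) *: dual_poly n s g.
Proof.
move=> sg; rewrite scaler_sumr; apply: eq_bigr => i i1.
rewrite !zof_jvec //= mul1r [in RHS](bigD1 i) //= -[RHS]mul_polyC.
have -> : \poly_(c < (part i).-1) zof (jvec s (fun=> 1) g) i ord_max c = g i.
  apply/polyP => c; rewrite coef_poly zof_jvec //= mul1r; case: ltnP => // H.
  by rewrite nth_default // (leq_trans (sg i i1)).
have -> : ((g i)`_(be i))%:P * 'X + (s i * (g i)`_(be i))%:P = ((g i)`_(be i))%:P * ('X + (s i)%:P).
  by rewrite mulrDr -polyCM [s i * _]mulrC.
have -> : \prod_(j | (part j != 1%N) && (j != i)) zof (jvec s (fun=> 1) g) j ord_max (be j) ^+ expo j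
   = \prod_(j | (part j != 1%N) && (j != i)) (g j)`_(be j) ^+ expo j.
  by apply: eq_bigr => j /andP[j1 _]; rewrite zof_jvec //= mul1r.
rewrite exprMn polyCM -polyC_exp; ring.
Qed.

Lemma cleared_eq0 (z : I -> 'I_2 -> nat -> F) be i : part i != 1%N -> z i ord_max (be i) = 0 ->
  (z i ord0 (be i) = 0 \/ forall c, z i ord_max c = 0) -> cleared z be = 0.
Proof.
move=> i1 zi H; apply: big1 => j j1; have [->|ji] := eqVneq j i; last first.
  by rewrite (bigD1 i) ?i1 1?eq_sym //= zi addn2 exprS !mul0r ?polyC0 ?mul0r.
case: H => [H|H].
  by rewrite zi H polyC0 mul0r addr0 addn2 exprS !mul0r mulr0.
rewrite (_ : \poly_(c < _) _ = 0) ?mulr0 //.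
by apply/polyP => c; rewrite coef_poly coef0 H if_same.
Qed.

(** Each term contains the selected coordinate with a = 1 of every other part, at a
    positive power; where that of its own part vanishes, so does its linear factor or
    its cofactor.  So the local formula is nonzero only if these coordinates, which are
    t_i times the selected coefficients, all are. *)
Lemma cleared_neq0 s t g be : sized g -> cleared (zof (jvec s t g)) be != 0 ->
  forall i, part i != 1%N -> t i != 0 /\ (g i)`_(be i) != 0.
Proof.
move=> sg H i i1; apply/andP; apply: contraNT H; rewrite negb_and !negbK => H.
apply/eqP/(cleared_eq0 i1); rewrite ?zof_jvec //=.
  by case/orP: H => /eqP->; rewrite ?mul0r ?mulr0.
case/orP: H => /eqP e; [right => c|left]; rewrite ?zof_jvec //= e ?mul0r ?mulr0 //.
Qed.

Lemma jvec_normalize s t g : (forall i, part i != 1%N -> t i != 0) ->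
  jvec s t g = jvec (fun i => s i / t i) (fun=> 1) (fun i => t i *: g i).
Proof.
move=> t0; apply/ffunP => k; rewrite !ffunE; have k1 := index_part k.
case: (tagged k) => a c /=; rewrite coefZ; case: ifP => _; rewrite ?mul1r //.
by rewrite mulrA divfK // t0.
Qed.

Lemma zofZ b (w : JS) i a c : zof (b *: w) i a c = b * zof w i a c.
Proof. by rewrite /zof; case: insub => [?|]; rewrite ?mulr0 // ffunE. Qed.

Lemma eq_cleared (R : comNzRingType) (z z' : I -> 'I_2 -> nat -> R) be :
  (forall i a c, z i a c = z' i a c) -> cleared z be = cleared z' be.
Proof.
move=> e; apply: eq_bigr => i i1; congr ((_)%:P * (_ * _)).
- by apply: eq_bigr => j _; rewrite e.
- by rewrite !e.
by apply/polyP => c; rewrite !coef_poly e.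
Qed.

(** The common degree of the local formulas: n - part i + 2 for each part, and 1 for the
    coordinates of g_i. *)
Definition total_expo : nat := (\sum_(j : I | part j != 1%N) expo j).+1.

Lemma cleared_scale (z : I -> 'I_2 -> nat -> F) be b :
  cleared (fun i a c => b * z i a c) be = b ^+ total_expo *: cleared z be.
Proof.
rewrite scaler_sumr; apply: eq_bigr => i i1; rewrite /total_expo [in RHS](bigD1 i) //=.
under eq_bigr => j _ do rewrite exprMn.
rewrite big_split /= prodrXr -[RHS]mul_polyC exprS [b ^+ (expo i + _)]exprD.
have -> : \poly_(c < (part i).-1) (b * z i ord_max c) = b%:P * \poly_(c < (part i).-1) z i ord_max c.
  by apply/polyP => c; rewrite coefCM !coef_poly; case: ifP; rewrite ?mulr0.
rewrite (_ : (b * z i ord_max (be i))%:P * 'X + (b * z i ord0 (be i))%:P =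
  b%:P * ((z i ord_max (be i))%:P * 'X + (z i ord0 (be i))%:P)); last by rewrite !polyCM; ring.
rewrite exprMn -polyC_exp !polyCM; ring.
Qed.

Definition zpoly (i : I) (a : 'I_2) (c : nat) : {mpoly F[K]} :=
  if insub c is Some c' then
    \sum_(l < K) (vbasis {:JS})`_l (Tagged (fun i : I => ('I_2 * 'I_(part i).-1)%type) (a, rev_ord (c' : 'I_(part i).-1))) *: 'X_l
  else 0.

Lemma meval_zpoly (w : JS) i a c : (zpoly i a c).@[coords w] = zof w i a c.
Proof.
rewrite /zpoly /zof; case: insub => [c'|]; last by rewrite meval0.
set k := Tagged _ _; rewrite [in RHS](sum_coords w) sum_ffunE raddf_sum.
by apply: eq_bigr => l _; rewrite /= mevalZ mevalXU ffunE mulrC.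
Qed.

Lemma eval_cleared (w : JS) be : evalp (coords w) (cleared zpoly be) = cleared (zof w) be.
Proof.
rewrite rmorph_sum; apply: eq_bigr => i i1.
rewrite !rmorphM rmorphXn rmorphD rmorphM /= !evalpC evalpX !meval_zpoly rmorph_prod.
congr (_%:P * (_ * _)).
  by apply: eq_bigr => j _; rewrite rmorphXn /= meval_zpoly.
by apply/polyP => c; rewrite coef_evalp !coef_poly; case: ifP; rewrite ?meval0 ?meval_zpoly.
Qed.

Definition local_family be := family (@vform F n) (cleared zpoly be).

Lemma param_local (w : JS) be : param_vec (local_family be) (coords w) = vform n (cleared (zof w) be).
Proof. by rewrite param_family ?size_cleared // eval_cleared. Qed.
End JoinVariety.

(** * The formula defines a rational map *)

Section JoinRational.
Variables (F : fieldType) (charF : [pchar F] =i pred0).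
Variables (n : nat) (la : seq nat) (hla : is_partition n la).
Local Notation I := 'I_(size la).
Local Notation W := (form F n).
Local Notation JS := (join_space F la).
Local Notation K := (\dim {: JS}).
Local Notation X := (@join_variety F la).
Local Notation D := (dual_variety (@multiple_root_locus F n la)).
Local Notation phi := (@param_map F n la).
Let infF := char0_infinite charF.
Implicit Types (s t : I -> F) (g : I -> {poly F}) (be : I -> nat).
Local Notation zpoly := (@zpoly F la).

Lemma local_homog be j : tnth (local_family F n (la := la) be) j \is (total_expo n la).-homog.
Proof.
apply: (homog_of_scale infF) => c v.
pose w : JS := \sum_(l < K) v l *: (vbasis {:JS})`_l.
have wE l : coords w l = v l by apply: coords_sum.
rewrite -(meval_eq _ wE) -(meval_eq (v1 := coords (c *: w)) (v2 := fun i => c * v i)); last first.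
  by move=> l; rewrite coordsZ wE.
rewrite -!coords_param !(param_local hla).
rewrite (eq_cleared n (z' := fun i a k => c * zof w i a k)); last by move=> *; apply: zofZ.
by rewrite cleared_scale linearZ coordsZ.
Qed.

Lemma local_value x y be w : phi x y -> w \in val x ->
  vform n (cleared n (zof w) be) != 0 -> val y = <[vform n (cleared n (zof w) be)]>%VS.
Proof.
case/(param_mapP hla) => s [g [sg g0 xE yE]]; rewrite xE => /vlineP[c ->].
have sg' := sizedZ c sg; rewrite jvecZ (cleared_jvec hla s be sg').
rewrite dual_polyZ scalerA linearZ scaler_eq0 negb_or => /andP[k0 _].
by rewrite line_of_scale.
Qed.

(** The common zeros of the local formulas for all choices of the coefficients. *)
Definition undefined_locus : point_set JS := fun x =>
  forall p, (exists be l, p = (cleared n zpoly be)`_l) -> cone_vanish p x.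

Lemma zclosed_undefined : zclosed undefined_locus.
Proof. exact: zclosed_cone. Qed.

Lemma undefinedPn (x : proj JS) : ~ undefined_locus x -> exists be w, w \in val x /\ cleared n (zof w) be != 0.
Proof.
move=> H; apply: NNPP => H'; apply: H => p [be [l ->]] w wx.
rewrite -coef_evalp eval_cleared; apply/eqP; apply: contraT => h; case: H'; exists be, w.
by split => //; apply: contraNneq h => ->; rewrite coef0.
Qed.

Lemma defined_at (x : proj JS) be w : w \in val x -> cleared n (zof w) be != 0 -> ~ undefined_locus x.
Proof.
move=> wx /eqP h H; apply: h; apply/polyP => l; rewrite -eval_cleared coef_evalp coef0.
by apply: H wx; exists be, l.
Qed.

(** At a point of the domain the leading coefficients of the g_i can be selected.
    Conversely a nonzero local formula forces the t_i to be nonzero, and the point can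
    be normalized to t_i = 1. *)
Lemma param_map_domain x : graph_domain phi x <-> X x /\ ~ undefined_locus x.
Proof.
split=> [[y xy]|[/(join_varietyP hla)[s [t [g [sg xE]]]]]].
  split; first by have [] := param_map_sub charF hla xy.
  have [s [g [sg g0 xE yE]]] := (param_mapP hla x y).1 xy.
  (* the leading coefficients are nonzero *)
  pose be i := (size (g i)).-1.
  apply: (@defined_at x be (jvec s (fun=> 1) g)); first by rewrite xE memv_line.
  rewrite cleared_jvec //; have := point_neq0 yE; apply: contraNneq => /eqP.
  rewrite scaler_eq0 => /orP[|/eqP->]; last by rewrite linear0.
  case/idPn; apply/prodf_neq0 => j j1; rewrite expf_neq0 //.
  by rewrite -lead_coefE lead_coef_eq0 g0.
case/undefinedPn => be [w]; rewrite xE => -[/vlineP[b ->]]; rewrite jvecZ => c0.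
have sbg := sizedZ b sg.
have H := cleared_neq0 hla sbg c0.
have t0 i : part i != 1%N -> t i != 0 by move=> /H[].
have sg' : sized (fun i => t i *: (b *: g i)).
  by move=> i i1; apply: leq_trans (size_scale_leq _ _) (sbg i i1).
rewrite (jvec_normalize _ _ t0) (cleared_jvec hla _ _ sg') in c0.
set g' := fun i => t i *: (b *: g i) in c0; set s' := fun i => s i / t i in c0.
rewrite -/g' in sg'.
have d0 : dual_poly n s' g' != 0.
  by apply: contraNneq c0 => ->; rewrite scaler0.
have b0 : b != 0.
  apply: contraNneq d0 => b0; rewrite /dual_poly big1 // => i _.
  by rewrite /g' b0 scale0r scaler0 mulr0.
have f0 : vform n (dual_poly n s' g') != 0.
  by apply: contraNneq d0 => /vform_eq0->//; apply: (size_dual_poly hla).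
have [y yE] := point_of f0; exists y; apply/(param_mapP hla); exists s', g'; split => //.
  move=> i i1; have [_ gi] := H i i1; rewrite /g' scaler_eq0 negb_or t0 //=.
  by apply: contraNneq gi => ->; rewrite coef0.
by rewrite -jvec_normalize // -jvecZ line_of_scale.
Qed.

Lemma cleared_base be : (exists i : I, part i != 1%N) -> (forall i, be i = 0%N) ->
  cleared n (zof (jvec (fun i : I => (i : nat)%:R) (fun=> 1) (one_cofactor F (la := la)))) be != 0.
Proof.
move=> [i i1] be0; have s1 := sized_one F hla.
rewrite cleared_jvec // scaler_eq0 negb_or; apply/andP; split.
  apply/prodf_neq0 => j j1; rewrite be0 /one_cofactor j1 coef1 /= expr1n; exact: oner_neq0.
apply/eqP => e0.
have s_inj : inj_big (fun i : I => (i : nat)%:R : F).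
  by move=> j k _ _ /(natr_inj charF)/val_inj.
have s0 : sized (fun _ : I => 0 : {poly F}) by move=> k _; rewrite size_poly0.
have := dual_poly_inj hla charF s_inj s1 s0 _ i1; rewrite e0.
rewrite [dual_poly _ _ _]big1 => [/(_ erefl)/eqP|k _]; last by rewrite mulr0.
by rewrite /one_cofactor i1 oner_eq0.
Qed.

(** Any point of the join is connected, by a curve in its parameters, to the point with
    s_i = i, t_i = 1 and g_i = 1, which lies in the domain; as do almost all the points
    of that curve. *)
Lemma param_map_dense : dense_in X (graph_domain phi).
Proof.
split=> [x|x /(join_varietyP hla)[s [t [g [sg xE]]]] C clC sub].
  by case/param_map_domain.
have [S CS] := zclosed_conesP clC; apply/CS => p Sp w; rewrite xE => /vlineP[b ->].
have [i0 i01] : exists i : I, part i != 1%N.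
  apply: NNPP => H; have := point_neq0 xE; case/eqP; apply/ffunP => k.
  by case: H; exists (tag k); apply: index_part k.
(* affine interpolation between the given data at u = 0 and the base point at u = 1; the
   entries of the join vector become polynomials in u *)
pose sc (i : I) : {poly F} := (s i)%:P + ((i : nat)%:R - s i) *: 'X.
pose tc (i : I) : {poly F} := (t i)%:P + (1 - t i) *: 'X.
pose gg (i : I) c : {poly F} := ((b *: g i)`_c)%:P + ((one_cofactor F i)`_c - (b *: g i)`_c) *: 'X.
pose cur (k : join_index la) : {poly F} := let i := tag k in let: (a, c) := tagged k in
  (if a == ord0 then sc i else tc i) * gg i (rev_ord c).
pose delta (k : join_index la) : JS := [ffun l => (l == k)%:R].
pose ck (j : 'I_K) : {poly F} := \sum_k coords (delta k) j *: cur k.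
pose wt u : JS := [ffun k => (cur k).[u]].
have ckE u j : (ck j).[u] = coords (wt u) j.
  have -> : wt u = \sum_k (cur k).[u] *: delta k.
    apply/ffunP => l; rewrite sum_ffunE ffunE (bigD1 l) //= !ffunE eqxx big1 ?addr0 => [|k kl].
      by rewrite /GRing.scale /= mulr1.
    by rewrite !ffunE eq_sym (negbTE kl) /GRing.scale /= mulr0.
  rewrite coords_big horner_sum; apply: eq_bigr => k _.
  by rewrite hornerZ coordsZ mulrC.
pose gt u (i : I) := (1 - u) *: (b *: g i) + u *: one_cofactor F i.
pose st u (i : I) := s i + ((i : nat)%:R - s i) * u.
pose tt u (i : I) := t i + (1 - t i) * u.
have wtE u : wt u = jvec (st u) (tt u) (gt u).
  apply/ffunP => -[i [a c]]; rewrite !ffunE /cur /= hornerM; congr (_ * _).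
    by rewrite /sc /tc /st /tt; case: ifP => _; rewrite hornerD hornerC hornerZ hornerX.
  rewrite /gg /gt hornerD hornerC hornerZ hornerX coefD !coefZ; ring.
have sgt u : sized (gt u).
  move=> i i1; rewrite /gt; apply: leq_trans (size_polyD _ _) _; rewrite geq_max.
  rewrite (leq_trans (size_scale_leq _ _) (sized_one F hla i1)) andbT.
  exact: leq_trans (size_scale_leq _ _) (leq_trans (size_scale_leq _ _) (sg i i1)).
have w0 : wt 0 = b *: jvec s t g.
  rewrite wtE jvecZ; apply: eq_jvec => i _; rewrite /st /tt /gt ?mulr0 ?addr0 //.
  by rewrite subr0 scale1r scale0r addr0.
have w1 : wt 1 = jvec (fun i : I => (i : nat)%:R) (fun=> 1) (one_cofactor F (la := la)).
  rewrite wtE; apply: eq_jvec => i _; rewrite /st /tt /gt ?mulr1 ?[_ + (_ - _)]addrC ?subrK //.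
  by rewrite subrr scale0r scale1r add0r.
apply/eqP; apply: contraT; rewrite -w0 => p0.
have aE (q : {mpoly F[K]}) u : (along q ck).[u] = q.@[coords (wt u)].
  by rewrite horner_along; apply: meval_eq => j; apply: ckE.
have P1 : along p ck != 0.
  by apply: contraNneq p0 => e; rewrite -aE e horner0.
have := cleared_base (be := fun=> 0%N) (ex_intro _ i0 i01) (fun=> erefl).
rewrite -w1 -eval_cleared -lead_coef_eq0 lead_coefE coef_evalp; set l := _.-1; set ql := _`_l => q0.
have P2 : along ql ck != 0.
  by apply: contraNneq q0 => e; rewrite -aE e horner0.
have [u] := poly_point infF (mulf_neq0 P1 P2).
rewrite hornerM mulf_eq0 negb_or !aE => /andP[/eqP pu qu]; case: pu.
have cu : cleared n (zof (wt u)) (fun=> 0%N) != 0.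
  rewrite -eval_cleared; apply: contraNneq qu => e.
  by rewrite -coef_evalp e coef0.
have [|xu xuE] := @point_of F JS (wt u).
  apply: contraNneq cu => e; apply/eqP; apply: (@cleared_eq0 F n la _ _ i0 i01).
    by rewrite e /zof; case: insub => // ?; rewrite ffunE.
  by left; rewrite e /zof; case: insub => // ?; rewrite ffunE.
have Cu : C xu.
  apply: sub; apply/param_map_domain; split.
    by apply/(join_varietyP hla); exists (st u), (tt u), (gt u); rewrite xuE wtE.
  by apply: defined_at cu; rewrite xuE memv_line.
by apply: ((CS xu).1 Cu p Sp); rewrite xuE memv_line.
Qed.

Lemma param_map_rational : rational_map X D phi.
Proof.
split.
- exact: (param_map_sub charF hla).
- by move=> x y y' h h'; apply: (param_map_fun hla h h').
- split; last exact: param_map_dense.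
  by exists undefined_locus; [exact: zclosed_undefined|exact: param_map_domain].
move=> x /param_map_domain[Xx /undefinedPn[be [w [wx cw]]]].
exists (total_expo n la), (fun j => tnth (local_family F n be) j).
have ev x' : eval_polys (fun j => tnth (local_family F n be) j) x' = vform n (cleared n (zof (vpick (val x'))) be).
  by rewrite -(param_local hla).
split.
- exact: local_homog.
- rewrite ev; have [c wE] := mem_line (memv_pick (val x)) (vpick_point x) wx.
  have sc : (size (cleared n (zof (vpick (val x))) be) <= n.+1)%N by apply: (size_cleared hla).
  apply: contraNneq cw => /(vform_eq0 sc) e.
  rewrite wE (eq_cleared n (z' := fun i a k => c * zof (vpick (val x)) i a k)); last by move=> *; apply: zofZ.
  by rewrite cleared_scale e scaler0.
by move=> x' y' xy'; rewrite ev => e0; apply: local_value xy' (memv_pick _) e0.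
Qed.
End JoinRational.

(** * Permutations preserving a colouring *)

Definition color_perms (T : finType) (c : T -> nat) (r : seq nat) : {set {perm T}} :=
  [set sg : {perm T} | [forall i, (c (sg i) == c i) && ((c i \in r) || (sg i == i))]].

Lemma color_permsP (T : finType) (c : T -> nat) r (sg : {perm T}) :
  reflect ((forall i, c (sg i) = c i) /\ (forall i, c i \notin r -> sg i = i))
          (sg \in color_perms c r).
Proof.
rewrite inE; apply: (iffP forallP) => [H|[H1 H2] i].
  split=> i; first by have /andP[/eqP] := H i.
  by move=> ir; have := H i; rewrite (negbTE ir) => /andP[_ /eqP].
by rewrite H1 eqxx /=; case: (boolP (c i \in r)) => //= /H2->.
Qed.

(** Each further colour j splits off a factor: a permutation is the product of its
    restriction to the points of colour j and of its restriction to the others. *)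
Lemma card_color_perms (T : finType) (c : T -> nat) r : uniq r ->
  #|color_perms c r| = (\prod_(j <- r) #|[set i | c i == j]|`!)%N.
Proof.
elim: r => [_|j r IH /= /andP[jr ur]].
  rewrite big_nil (_ : color_perms c [::] = [set 1%g]) ?cards1 //.
  apply/setP => sg; rewrite !inE; apply/forallP/eqP => [H|-> i]; last by rewrite perm1 !eqxx.
  by apply/permP => i; have := H i; rewrite perm1 => /andP[_ /eqP].
rewrite big_cons -IH // -card_perm mulnC -(cardsE (perm_on [set i | c i == j])) -cardsX.
set A := [set i | c i == j].
pose m (p : {perm T} * {perm T}) := (p.1 * p.2)%g.
have [mA mN] : (forall p, p \in setX (color_perms c r) [set x | perm_on A x] ->
    (forall i, i \in A -> m p i = p.2 i)) /\
  (forall p, p \in setX (color_perms c r) [set x | perm_on A x] ->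
    (forall i, i \notin A -> m p i = p.1 i)).
  split=> -[sg ta]; rewrite inE /= [X in _ && X]inE => /andP[/color_permsP[sg1 sg2] pA] i iA; rewrite /m /= permM.
    by rewrite sg2 //; move: iA; rewrite inE => /eqP->.
  by rewrite (out_perm pA) //; move: iA; rewrite !inE sg1.
have mi : {in setX (color_perms c r) [set x | perm_on A x] &, injective m}.
  move=> [sg ta] [sg' ta'] p1 p2 e.
  have := p1; rewrite inE /= [X in _ && X]inE => /andP[/color_permsP[_ s1] pA].
  have := p2; rewrite inE /= [X in _ && X]inE => /andP[/color_permsP[_ s2] pA'].
  have mE i : m (sg, ta) i = m (sg', ta') i by rewrite e.
  congr (_, _); apply/permP => i; case: (boolP (i \in A)) => iA; have := mE i.
  - by move=> _; move: iA; rewrite inE => /eqP iA; rewrite s1 ?s2 // iA.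
  - by rewrite (mN _ p1) // (mN _ p2).
  - by rewrite (mA _ p1) // (mA _ p2).
  by rewrite (out_perm pA) ?(out_perm pA').
rewrite -(card_in_imset mi); apply/eq_card => rho; apply/idP/imsetP.
  case/color_permsP => rc rf.
  (* the two restrictions of rho *)
  pose f1 i := if i \in A then i else rho i.
  pose f2 i := if i \in A then rho i else i.
  have rA i : (rho i \in A) = (i \in A) by rewrite !inE rc.
  have i1 : injective f1.
    move=> a b; rewrite /f1; case: ifP => aA; case: ifP => bA //.
    - by move=> e; move: aA; rewrite e rA bA.
    - by move=> e; move: bA; rewrite -e rA aA.
    exact: perm_inj.
  have i2 : injective f2.
    move=> a b; rewrite /f2; case: ifP => aA; case: ifP => bA //.
    - exact: perm_inj.
    - by move=> e; move: bA; rewrite -e rA aA.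
    by move=> e; move: aA; rewrite e rA bA.
  exists (perm i1, perm i2).
    rewrite inE /= [X in _ && X]inE; apply/andP; split.
      apply/color_permsP; split=> i; rewrite permE /f1.
        by case: ifP => // _; rewrite rc.
      move=> ir; case: ifP => // iA; apply: rf; rewrite inE negb_or ir andbT.
      by move: iA; rewrite inE => /negbT.
    by apply/subsetP => i; rewrite inE permE /f2; case: (i \in A) => //; rewrite eqxx.
  apply/permP => i; rewrite /m /= permM !permE /f1 /f2.
  by case: (boolP (i \in A)) => iA; [rewrite iA|rewrite rA (negbTE iA)].
case=> -[sg ta]; rewrite inE /= [X in _ && X]inE => /andP[/color_permsP[s1 s2] pA] ->.
have tc i : c (ta i) = c i.
  case: (boolP (i \in A)) => iA; last by rewrite (out_perm pA).
  by have := perm_closed i pA; rewrite iA; move: iA; rewrite !inE => /eqP-> /eqP.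
apply/color_permsP; split=> i; rewrite /m /= permM; first by rewrite tc s1.
rewrite inE negb_or => /andP[ij ir]; rewrite s2 // (out_perm pA) //.
by rewrite inE.
Qed.

(** * The general fibre *)

(** A polynomial on a line that is not identically zero does not vanish at all the nonzero
    points of the line. *)
Lemma cone_nonvanish (F : fieldType) (infF : infinite_field F) (W : vectType F)
    (p : {mpoly F[\dim {:W}]}) (y : proj W) :
  ~ cone_vanish p y -> exists w, [/\ w \in val y, w != 0 & p.@[coords w] != 0].
Proof.
move=> H; have [w wy pw] : exists2 w, w \in val y & p.@[coords w] != 0.
  apply: NNPP => H'; apply: H => w wy; apply/eqP; apply: contraT => pw.
  by case: H'; exists w.
have [w0 w0y w00] := mem_point y; have [c wE] := mem_line w0y w00 wy.
pose a i : {poly F} := coords w0 i *: 'X.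
have aE c' : (along p a).[c'] = p.@[coords (c' *: w0)].
  rewrite horner_along; apply: meval_eq => i.
  by rewrite /a hornerZ hornerX coordsZ mulrC.
have a0 : along p a != 0.
  by apply: contraNneq pw => e; rewrite wE -aE e horner0.
have X0 : ('X : {poly F}) != 0 by rewrite polyX_eq0.
have [c'] := poly_point infF (mulf_neq0 X0 a0).
rewrite hornerM hornerX mulf_eq0 negb_or aE => /andP[c0 pc].
by exists (c' *: w0); split; rewrite ?memvZ // scaler_eq0 negb_or c0.
Qed.

Section Fibre.
Variables (F : closedFieldType) (charF : [pchar F] =i pred0).
Variables (n : nat) (la : seq nat) (hla : is_partition n la).
Local Notation I := 'I_(size la).
Local Notation W := (form F n).
Local Notation M := (\dim {: form F n}).
Local Notation JS := (join_space F la).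
Local Notation D := (dual_variety (@multiple_root_locus F n la)).
Local Notation phi := (@param_map F n la).
Let infF := char0_infinite charF.
Local Notation fd := (dual_family F n la).
Local Notation N := #|{: dual_index la}|.
Implicit Types (s : I -> F) (g : I -> {poly F}) (v : 'I_N -> F).

Definition good_poly : {mpoly F[N]} :=
  (\prod_(i | part i != 1%N) \prod_(j | (part j != 1%N) && (j != i))
     (sval_of (fun l => 'X_l) i - sval_of (fun l => 'X_l) j)) *
  \prod_(i | part i != 1%N) (gval_of (fun l => 'X_l) i).[- sval_of (fun l => 'X_l) i].

Lemma good_polyP v : reflect (good v) (good_poly.@[v] != 0).
Proof.
have sE i : (sval_of (fun l => 'X_l : {mpoly F[N]}) i).@[v] = sval_of v i by apply: meval_entry.
have gE i : (gval_of (fun l => 'X_l : {mpoly F[N]}) i).[- sval_of (fun l => 'X_l) i].@[v] =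
    (gval_of v i).[- sval_of v i].
  by rewrite -[LHS]horner_map /= -[map_poly _ _]/(evalp v _) eval_gval mevalN sE.
rewrite mevalM mulf_eq0 negb_or !rmorph_prod.
apply: (iffP andP) => -[H1 H2]; split.
- move=> i j i1 j1 e; apply/eqP; rewrite eq_sym; apply: contraT => ji.
  move/prodf_neq0: H1 => /(_ i i1); rewrite rmorph_prod => /prodf_neq0/(_ j).
  by rewrite j1 ji => /(_ isT); rewrite /= mevalB !sE e subrr eqxx.
- by move=> i i1; move/prodf_neq0: H2 => /(_ i i1); rewrite /= gE.
- apply/prodf_neq0 => i i1; rewrite rmorph_prod; apply/prodf_neq0 => j /andP[j1 ji].
  by rewrite /= mevalB !sE subr_eq0; apply: contraNneq ji => e; apply/eqP/H1.
by apply/prodf_neq0 => i i1; rewrite /= gE H2.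
Qed.

(** By [image_hypersurface], the values at parameters that are not good lie in a proper
    closed subset.  All the preimages of a general vector are therefore good. *)
Lemma good_image : exists h : {mpoly F[M]}, h \mPo fd != 0 /\
  forall v, h.@[coords (param_vec fd v)] != 0 -> good v.
Proof.
have gb := base_dual_good charF hla.
have P0 : good_poly != 0.
  by apply/eqP => e; move/good_polyP: gb; rewrite e meval0 eqxx.
have [h [hf H]] := image_hypersurface infF charF (dual_family_free charF hla gb) P0.
exists h; split => // v hv; apply/good_polyP; apply: contraNneq hv => /H.
by rewrite meval_param => ->.
Qed.

Lemma dual_poly_perm (sg : {perm I}) s g : (forall i, part (sg i) = part i) ->
  dual_poly n (s \o sg) (g \o sg) = dual_poly n s g.
Proof.
move=> sgp; rewrite [RHS](reindex_inj (@perm_inj _ sg)).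
by apply: eq_big => i; rewrite sgp.
Qed.

Lemma vform_inj_on (p q : {poly F}) : (size p <= n.+1)%N -> (size q <= n.+1)%N ->
  vform n p = vform n q -> p = q.
Proof. by move=> sp sq e; rewrite -(vformK sp) e vformK. Qed.

(** Equal values have equal tangent spaces, and these are the images of both
    differentials.  By [dual_family_tangent] at v' and [tangent_contact] at v, each s'_i
    is matched with some s_j; the g_i are then equal by independence. *)
Lemma fibre_matching (B : 'M[F]_(M, N)) v v' : good v -> good v' ->
  (forall h : 'rV_M, (forall p, p \mPo fd = 0 -> \sum_k (p^`M(k)).@[coords (param_vec fd v)] * h 0 k = 0) ->
     h *m B = 0 -> h = 0) ->
  param_vec fd v' = param_vec fd v ->
  exists sg : {perm I}, [/\ forall i, part (sg i) = part i,
     forall i, part i = 1%N -> sg i = i &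
     forall i, part i != 1%N -> sval_of v' i = sval_of v (sg i) /\ gval_of v' i = gval_of v (sg i)].
Proof.
move=> gv gv' HB e.
have tg u' : exists u, derp v' u' (dual_family_poly n la F) = derp v u (dual_family_poly n la F).
  pose r := \row_l u' l; pose h := vform n (derp v' (fun l => r 0 l) (dual_family_poly n la F)).
  have sd := size_dual_family hla F.
  have hE k : coords h k = (r *m jac fd v') 0 k by rewrite jac_family.
  have := jac_tangent hE; rewrite e => /(tangent_is_image HB (dual_family_free charF hla gv))[u uE].
  exists (fun l => u 0 l); rewrite derp_row; apply: vform_inj_on.
  - exact: leq_trans (size_derp _ _ _) sd.
  - exact: leq_trans (size_derp _ _ _) sd.
  by apply: coords_inj => k; move: (uE k); rewrite [in RHS]jac_family ?sd // => <-.
have [i|sg [sgp sg1 sgs]] := @matching _ _ hla F (sval_of v) (sval_of v') gv.1 gv'.1.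
  move=> i1; apply: (tangent_contact hla charF) => // h sh.
  have [u' <-] := dual_family_tangent hla charF gv' i1 sh.
  by have [u ->] := tg u'; exists u.
exists sg; split => // i i1; split; first exact: sgs.
(* g' transported back to the indices of s *)
pose g' j := gval_of v' ((sg^-1)%g j).
have sgV j : part ((sg^-1)%g j) = part j by rewrite -[in RHS](permKV sg j) sgp.
have sg' : sized g' by move=> j j1; rewrite /g' -sgV; apply: size_gval.
have E : dual_poly n (sval_of v) g' = dual_poly n (sval_of v) (gval_of v).
  apply: vform_inj_on; [exact: (size_dual_poly hla)|exact: (size_dual_poly hla) (sized_gval v)|].
  rewrite -(param_dual hla) -e (param_dual hla); congr (vform n _).
  rewrite -(dual_poly_perm (sg := sg)) //; apply: eq_dual_poly => j j1 /=; first by rewrite sgs.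
  by rewrite /g' permK.
have := dual_poly_inj hla charF gv.1 sg' (sized_gval v) E (i := sg i).
by rewrite sgp /g' permK => ->.
Qed.

(** The fibre is indexed by the permutations of equal parts that fix the parts equal to 1:
    such a permutation moves the pairs (s_i, g_i), without changing the value. *)
Lemma param_map_fibre (h q : {mpoly F[M]}) (B : 'M[F]_(M, N)) v (y : proj W) :
  (forall v, h.@[coords (param_vec fd v)] != 0 -> good v) ->
  (forall w, q.@[w] != 0 -> forall h : 'rV_M,
   (forall p, p \mPo fd = 0 -> \sum_k (p^`M(k)).@[w] * h 0 k = 0) -> h *m B = 0 -> h = 0) ->
  val y = <[param_vec fd v]>%VS ->
  h.@[coords (param_vec fd v)] != 0 -> q.@[coords (param_vec fd v)] != 0 ->
  exists xs : seq (proj JS), [/\ uniq xs,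
    size xs = #|color_perms (fun i : I => part i) (index_iota 2 (\max_(k <- la) k)%N.+1)| &
    forall x, x \in xs <-> phi x y].
Proof.
move=> hP qP; set w := param_vec fd v => yE hw qw.
have w0 : w != 0 := point_neq0 yE.
have gv : good v := hP v hw.
pose s := sval_of v; pose g : I -> {poly F} := gval_of v.
have sg : sized g := sized_gval v.
have wE : w = vform n (dual_poly n s g) := param_dual hla v.
have g0 i : part i != 1%N -> g i != 0.
  by move=> /gv.2; apply: contraNneq => e; rewrite -/(g i) e horner0.
have [i0 i01] : exists i : I, part i != 1%N.
  apply: NNPP => H; case/eqP: w0; rewrite wE /dual_poly big1 ?linear0 // => i i1.
  by case: H; exists i.
set G := color_perms _ _.
have GP (ta : {perm I}) : reflect ((forall i, part (ta i) = part i) /\ (forall i, part i = 1%N -> ta i = i)) (ta \in G).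
  apply: (iffP (color_permsP _ _ _)) => -[H1 H2]; split=> // i.
    by move=> i1; apply: H2; rewrite i1 mem_index_iota.
  rewrite mem_index_iota => i1; apply: H2.
  have : (part i <= \max_(k <- la) k)%N by apply: (@leq_bigmax_seq _ _ xpredT id); rewrite ?mem_nth.
  by have := part_gt0 hla i; move: i1; lia.
pose jv (ta : {perm I}) := jvec (s \o ta) (fun=> 1) (g \o ta).
have szta ta : ta \in G -> sized (g \o ta).
  by move=> /GP[tp _] i i1; rewrite /= -tp; apply: size_gval.
have gta ta : ta \in G -> forall i, part i != 1%N -> (g \o ta) i != 0.
  by move=> /GP[tp _] i i1; rewrite /= g0 ?tp.
have jv0 ta : ta \in G -> jv ta != 0.
  move=> tG; apply/eqP => e.
  have := jvec_inj hla (szta _ tG) (sizedZ 0 (szta _ tG)) (gta _ tG) (s := s \o ta) (s' := s \o ta).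
  rewrite -[X in _ = X -> _]jvecZ -/(jv ta) e scaler0 => /(_ erefl i0 i01)[/eqP].
  by rewrite scale0r (negbTE (gta _ tG _ i01)).
have G1 : 1%g \in G by apply/GP; split=> i; rewrite perm1.
have [x1 x1E] := point_of (jv0 _ G1).
have /fin_all_exists[xp xpE] (ta : {perm I}) : exists x : proj JS, ta \in G -> val x = <[jv ta]>%VS.
  case: (boolP (ta \in G)) => tG; last by exists x1.
  by have [x xE] := point_of (jv0 _ tG); exists x.
exists [seq xp ta | ta in G]; split.
- rewrite map_inj_in_uniq ?enum_uniq // => ta tb; rewrite !mem_enum => aG bG e.
  have := xpE _ bG; rewrite -e (xpE _ aG) => /(line_scale (jv0 _ aG))[c c0].
  rewrite jvecZ => /(jvec_inj hla (szta _ aG) (sizedZ c (szta _ bG)) (gta _ aG)) E.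
  have [ap a1] := GP _ aG; have [bp b1] := GP _ bG.
  apply/permP => i; have [i1|i1] := eqVneq (part i) 1%N; first by rewrite a1 ?b1.
  by have [_] := E i i1; apply: gv.1; rewrite ?ap ?bp.
- by rewrite size_map -cardE.
move=> x; split.
  case/mapP => ta; rewrite mem_enum => tG ->; apply/(param_mapP hla).
  exists (s \o ta), (g \o ta); split; [exact: szta|exact: gta|exact: xpE|].
  by rewrite dual_poly_perm -?wE //; case/GP: tG.
move/(param_mapP hla) => [s' [g' [sg' g0' xE yE']]].
have := yE; rewrite yE' => /esym/(line_scale w0)[c c0]; rewrite -linearZ -dual_polyZ => wE'.
have scg' := sizedZ c sg'.
(* scaling g' makes the two values equal as vectors *)
pose v' := encode s' (fun i => c *: g' i).
have v'E : param_vec fd v' = w by rewrite (param_encode hla) ?wE'.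
have gv' : good v' by apply: hP; rewrite v'E.
have [ta [tp t1 tsg]] := fibre_matching gv gv' (qP _ qw) v'E.
have tG : ta \in G by apply/GP.
apply/mapP; exists ta; rewrite ?mem_enum //; apply: val_inj.
rewrite xE (xpE _ tG) -(line_of_scale (jvec s' (fun=> 1) g') c0) jvecZ.
congr <[_]>%VS; apply: eq_jvec => // i i1; have [es eg] := tsg i i1.
  by rewrite -(sval_encode hla s' (fun i => c *: g' i)).
by rewrite -(gval_encode hla s' i1 (scg' i i1)).
Qed.

(** The open set is defined by the product of the conditions of [good_image],
    [generic_tangent_bound] and [image_contains_open]. *)
Lemma param_map_degree :
  has_degree D phi #|color_perms (fun i : I => part i) (index_iota 2 (\max_(k <- la) k)%N.+1)|.
Proof.
have gb := base_dual_good charF hla.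
have [q [qf [B qP]]] := generic_tangent_bound infF charF (dual_family_free charF hla gb).
have [h [hf hP]] := good_image.
have [a af aP] := image_contains_open infF fd.
pose Q := h * q * a.
have Qf : Q \mPo fd != 0 by rewrite !rmorphM /= !mulf_neq0.
exists (fun y => D y /\ ~ cone_vanish Q y); split.
- by exists (cone_vanish Q); first exact: zclosed_cone1.
- split=> [y []//|y Dy C clC sub].
  have [S CS] := zclosed_conesP clC; apply/CS => p Sp; apply: (dual_sub_closure charF hla Dy).
  apply/eqP; apply: contraT => pf.
  (* a coordinate that is nonzero somewhere; where it is, the value of the formula is a point *)
  have [k kf] : exists k, 'X_k \mPo fd != 0.
    apply: NNPP => H; have [w wy w0] := mem_point y; case/eqP: w0.
    apply: coords_inj => k; rewrite -(scale0r 0) coordsZ mul0r -mevalXU.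
    apply: (dual_sub_closure charF hla Dy) => //; apply/eqP; apply: contraT => kf.
    by case: H; exists k.
  have [v] := mpoly_point infF (mulf_neq0 pf (mulf_neq0 Qf kf)).
  rewrite !mevalM !mulf_eq0 !negb_or -!meval_param => /and3P[/eqP pv Qv kv].
  have f0 : param_vec fd v != 0.
    by apply: contraNneq kv => e; rewrite mevalXU e -(scale0r 0) coordsZ mul0r.
  have [z zE] := point_of f0; case: pv.
  have Cz : C z.
    apply: sub; split; first exact: (dual_image_sub charF hla zE).
    by move=> /(_ (param_vec fd v)); rewrite zE memv_line => /(_ isT) /eqP; rewrite (negbTE Qv).
  by apply: ((CS z).1 Cz p Sp); rewrite zE memv_line.
move=> y [Dy /(cone_nonvanish infF)[w [wy w0]]].
rewrite !mevalM !mulf_eq0 !negb_or => /andP[/andP[hw qw] aw].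
have [|v vE] := aP (coords w) _ aw.
  by move=> p pf; apply: (dual_sub_closure charF hla Dy) pf _ wy.
have {vE}vE : param_vec fd v = w by apply: coords_inj => k; rewrite coords_param.
apply: (param_map_fibre (h := h) (q := q) (B := B) (v := v) hP qP); rewrite vE //.
exact: point_line.
Qed.
End Fibre.

Section Degree.
Variables (F : fieldType) (W W' : vectType F) (phi : proj W -> proj W' -> Prop).
Variable Y : point_set W'.

Lemma degree_generically_finite k : has_degree Y phi k -> generically_finite Y phi.
Proof.
case=> U [oU dU H]; exists U; split => // y /H[xs [_ _ xsP]].
by exists xs => x /xsP.
Qed.

(** General fibres are nonempty, so the image contains a dense set. *)
Lemma degree_dominant k : (0 < k)%N -> (forall x y, phi x y -> Y y) ->
  has_degree Y phi k -> dominant Y phi.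
Proof.
move=> k0 sub [U [_ [_ dU] H]]; split=> [y [x /sub]//|y Yy C clC im].
apply: (dU y Yy) => // z /H[[|x xs] [_ sz xsP]]; first by rewrite -sz in k0.
by apply: im; exists x; apply/xsP; rewrite mem_head.
Qed.
End Degree.

(** * The theorem *)

Lemma card_part (la : seq nat) j : #|[set i : 'I_(size la) | part i == j]| = count_mem j la.
Proof.
rewrite -sum1_card -sum1_count [RHS](big_nth 0%N) big_mkord.
by apply: eq_bigl => i; rewrite inE.
Qed.

Theorem theorem2p9 (K : fieldType) (charK : [pchar K] =i pred0)
    (L : closedFieldType) (iota : {rmorphism K -> L})
    (algL : forall z : L, algebraicOver iota z)
    (n : nat) (la : seq nat) (hla : is_partition n la) :
  let m (j : nat) : nat := count_mem j la in
  let p : nat := (\max_(k <- la) k)%N in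
  let Ddual := dual_variety (@multiple_root_locus L n la) in
  let phi := @param_map L n la in
  [/\ has_dim Ddual (n%:Z - (m 1%N)%:Z - 1),
      rational_map (@join_variety L la) Ddual phi,
      dominant Ddual phi,
      generically_finite Ddual phi &
      has_degree Ddual phi (\prod_(2 <= j < p.+1) (m j)`!)%N].
Proof.
move=> m p Ddual phi.
have charL : [pchar L] =i pred0 by move=> c; rewrite (fmorph_pchar iota) charK.
have deg : has_degree Ddual phi (\prod_(2 <= j < p.+1) (m j)`!)%N.
  have := param_map_degree charL hla; rewrite card_color_perms ?iota_uniq //.
  by under eq_bigr => j _ do rewrite card_part.
split=> //.
- exact: dual_dim.
- exact: param_map_rational.
- apply: degree_dominant deg; last by move=> x y /(param_map_sub charL hla)[].
  by rewrite prodn_gt0 // => j; apply: fact_gt0.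
exact: degree_generically_finite deg.
Qed.
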